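(* Let $f(z) = e^{2\pi i \alpha} z + O(z^2)$, $\alpha \in \mathbb{R}\setminus\mathbb{Q}$, be a nonlinearizable germ of holomorphic diffeomorphism fixing $0$, and let $K$ be a hedgehog of $f$. Let $T(z) = z + O(z^2)$ be a holomorphic germ tangent to the identity which is univalent on a neighbourhood of $K$, and suppose $K$ is either forward invariant under $T$ (i.e. $T(K)\subseteq K$) or backward invariant under $T$ (i.e. $K \subseteq T(K)$, equivalently $T^{-1}(K)\subseteq K$ for the inverse of $T$ on its image). Then $T$ is the identity.
   Context: A germ $f(z)=e^{2\pi i\alpha}z+O(z^2)$ with $\alpha\in\mathbb{R}\setminus\mathbb{Q}$ is linearizable if there is a holomorphic change of variables $h(w)=w+O(w^2)$ with $h^{-1}\circ f\circ h=R_\alpha$, where $R_\alpha(w)=e^{2\pi i\alpha}w$; otherwise it is nonlinearizable. A Siegel compact of $f$ is a full (complement in the Riemann sphere connected), connected, compact set $K\subset\mathbb{C}$ with $0\in K$, $K\neq\{0\}$, such that $f$ and $f^{-1}$ extend univalently to a neighbourhood of $K$ and $f(K)=f^{-1}(K)=K$. A hedgehog of $f$ is a Siegel compact not contained in the closure of a linearization domain of $f$ (an open set containing $0$ on which $f$ is holomorphically conjugate to $R_\alpha$ on a disc centred at $0$); for nonlinearizable $f$, every Siegel compact is a hedgehog. *)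

(* Defs.v *)
From HB Require Import structures.
From mathcomp Require Import all_boot all_order all_algebra.
From mathcomp Require Import all_classical all_reals all_analysis.
From mathcomp Require Import complex.
Import Order.TTheory GRing.Theory Num.Theory.
Import numFieldNormedType.Exports.

Set Implicit Arguments.
Unset Strict Implicit.
Unset Printing Implicit Defensive.

Local Open Scope ring_scope.
Local Open Scope classical_set_scope.

Section Defs.
Context {R : realType}.

Definition CT : normedModType R[i] := (R[i])^o.

Definition holo_on (U : set R[i]) (f : R[i] -> R[i]) : Prop :=
  forall z, U z -> derivable (f : CT -> CT) (z : CT) (1 : CT).

Definition cderiv (f : R[i] -> R[i]) (z : R[i]) : R[i] :=
  'D_(1 : CT) (f : CT -> CT) (z : CT).

Definition univalent_on (U : set R[i]) (f : R[i] -> R[i]) : Prop :=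
  holo_on U f /\ (forall x y, U x -> U y -> f x = f y -> x = y).

Definition open_nbhd_of (U K : set R[i]) : Prop :=
  @open CT U /\ K `<=` U.

Definition rotnum (a : R) : R[i] := Complex (cos (2 * pi * a)) (sin (2 * pi * a)).

(* f(z) = e^{2 pi i a} z + O(z^2) is a germ of holomorphic diffeomorphism
   fixing 0 (represented by a function univalent on a neighbourhood of 0) *)
Definition germ_rot (f : R[i] -> R[i]) (a : R) : Prop :=
  (exists U, open_nbhd_of U [set 0] /\ univalent_on U f) /\
  f 0 = 0 /\ cderiv f 0 = rotnum a.

(* linearizable: exists a holomorphic change of variables h(w) = w + O(w^2)
   (univalent near 0) with h^{-1} o f o h = R_a near 0, i.e. f o h = h o R_a
   near 0 *)
Definition linearizable (f : R[i] -> R[i]) (a : R) : Prop :=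
  exists h : R[i] -> R[i],
    (exists U, open_nbhd_of U [set 0] /\ univalent_on U h) /\
    h 0 = 0 /\ cderiv h 0 = 1 /\
    \forall w \near (0 : CT), f (h w) = h (rotnum a * w).

(* Siegel compact of f.  "full" (complement in the Riemann sphere connected)
   is expressed, for the compact set K, as: C \ K is connected. *)
Definition siegel_compact (f : R[i] -> R[i]) (K : set R[i]) : Prop :=
  @compact CT K /\ @connected CT K /\ @connected CT (~` K) /\
  K 0 /\ K <> [set 0] /\
  (exists U, open_nbhd_of U K /\ univalent_on U f) /\
  (* f^{-1} (the germ g with g o f = id near 0) extends univalently
     to a neighbourhood of K *)
  (exists (V : set R[i]) (g : R[i] -> R[i]),
      open_nbhd_of V K /\ univalent_on V g /\
      (\forall z \near (0 : CT), g (f z) = z) /\ g @` K = K) /\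
  f @` K = K.

Definition linearization_domain (f : R[i] -> R[i]) (a : R) (D : set R[i]) :
    Prop :=
  @open CT D /\ D 0 /\
  exists (r : R) (phi : R[i] -> R[i]),
    0 < r /\ univalent_on D phi /\ phi @` D = @ball _ CT (0 : CT) (Complex r 0) /\
    (forall z, D z -> D (f z) /\ phi (f z) = rotnum a * phi z).

Definition hedgehog (f : R[i] -> R[i]) (a : R) (K : set R[i]) : Prop :=
  siegel_compact f K /\
  ~ (exists D, linearization_domain f a D /\ K `<=` @closure CT D).

End Defs.

(* Main.v *)
(* Locally at 0, iterating T and its conjugates by f moves points of K in every direction: the
   conjugate of T by f^m is z + a lambda^(km) z^(k+1) + O(z^(k+2)), and composing such conjugates
   yields coefficients c that are arbitrarily small, together with all their rotations c lambda^(km).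
   Moving greedily towards a point p, one sees that K comes within eps |p|^(k+1) of every small p.
   If p lies in a repelling sector of T, its backward orbit p_n tends to 0; a point of K within
   eps |p_n|^(k+1) of p_n is sent by T^n to a point of K, and in the Fatou coordinate 1/z^k the map T
   is nearly an isometry, so this point is within O(eps) of p.  Hence K contains the sector, and by
   rotation under f a neighbourhood of 0.  Then the iterates of f are bounded near 0, and the averages
   of lambda^(-n) f^n linearize f.  When K is contained in T(K), the local inverse of T is used instead.

   Goursat's theorem is proved with Riemann sums, Cauchy's formula with averages over roots of unity,
   and all limits are taken along a fixed nonprincipal ultrafilter on nat. *)

Require Import Defs.
From HB Require Import structures.
From mathcomp Require Import all_boot all_order all_algebra.
From mathcomp Require Import all_classical all_reals all_analysis.
From mathcomp Require Import complex.
From mathcomp Require Import ring lra.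

Set Implicit Arguments.
Unset Strict Implicit.
Unset Printing Implicit Defensive.

Import Order.TTheory GRing.Theory Num.Theory.
Import numFieldNormedType.Exports.
Local Open Scope ring_scope.
Local Open Scope classical_set_scope.

(** * Modulus, complex derivative and ultralimits *)

(** The obstacle is that the backward orbit [p_n] of [p] is not known to lie in [K]: invariance only
    pushes points of [K] forward, so [p] has to be reached from neighbours of [p_n]. Mere closeness
    is not enough, since the passage from [p_n] to [p] multiplies distances by about
    [(|p| / |p_n|)^(k+1)]. Hence the scale [|p|^(k+1)], the size of one step of [T] and the
    denominator in the derivative [-k / z^(k+1)] of [1/z^k]. The Fatou coordinate is never built:
    the modulus [|1 + (k+1) a x^k|] of the derivative is compared directly with
    [(|T x| / |x|)^(k+1)]. The greedy motion is replaced by an extremal argument: a nearest point of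
    [K] to [p] cannot be improved. Irrationality enters through [mu = lambda^k]: its powers come
    close to 1 without reaching it, and since [mu] and [mu^2] differ from 1, one of finitely many
    powers turns any given vector [u] so that [Re u >= |u| / 4]. Sectors are cut out by the weaker
    constant [1/5]; the gap absorbs the nonlinear error of rotating by [f]. *)

Section Modulus.
Context {R : realType}.
Local Notation C := (R[i]).
Implicit Types (z w : C) (x y : R).

(** Real-valued companion of [|z|], which lives in [R[i]] where the order is only partial; estimates
    in [R] are within reach of [lra] and [nra]. *)
Definition nm (z : C) : R := Num.sqrt (complex.Re z ^+ 2 + complex.Im z ^+ 2).

Lemma normE z : `|z| = (nm z)%:C%C.
Proof. exact: normc_def. Qed.

Lemma nm_ge0 z : 0 <= nm z.
Proof. exact: sqrtr_ge0. Qed.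

Lemma nm0 : nm 0 = 0.
Proof. by apply: complexI; rewrite -normE normr0. Qed.

Lemma nm1 : nm 1 = 1.
Proof. by apply: complexI; rewrite -normE normr1. Qed.

Lemma nm_eq0 z : (nm z == 0) = (z == 0).
Proof. by rewrite -(inj_eq (@complexI R)) -normE normr_eq0. Qed.

Lemma nm_gt0 z : (0 < nm z) = (z != 0).
Proof. by rewrite lt_def nm_ge0 andbT nm_eq0. Qed.

Lemma nmM z w : nm (z * w) = nm z * nm w.
Proof. by apply: complexI; rewrite rmorphM /= -!normE normrM. Qed.

Lemma nmN z : nm (- z) = nm z.
Proof. by apply: complexI; rewrite -!normE normrN. Qed.

Lemma nmV z : nm z^-1 = (nm z)^-1.
Proof. by apply: complexI; rewrite fmorphV /= -!normE normfV. Qed.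

Lemma nmX z n : nm (z ^+ n) = nm z ^+ n.
Proof. by apply: complexI; rewrite rmorphXn /= -!normE normrX. Qed.

Lemma nmD z w : nm (z + w) <= nm z + nm w.
Proof. by rewrite -lecR rmorphD /= -!normE ler_normD. Qed.

Lemma nmB z w : nm (z - w) <= nm z + nm w.
Proof. by rewrite -(nmN w) nmD. Qed.

Lemma nmBC z w : nm (z - w) = nm (w - z).
Proof. by rewrite -nmN opprB. Qed.

Lemma nmB_ge z w : nm z - nm w <= nm (z - w).
Proof. by rewrite lerBlDr -{1}(subrK w z) nmD. Qed.

Lemma nm_tri w z u : nm (z - u) <= nm (z - w) + nm (w - u).
Proof.
have -> : z - u = (z - w) + (w - u) by ring.
exact: nmD.
Qed.

Lemma nm_real x : nm x%:C%C = `|x|.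
Proof. by rewrite /nm /= expr0n addr0 sqrtr_sqr. Qed.

Lemma nm_nat n : nm n%:R = n%:R.
Proof.
by have := nm_real n%:R; rewrite normr_nat => <-; rewrite rmorph_nat.
Qed.

Lemma nmZ x z : nm (x%:C%C * z) = `|x| * nm z.
Proof. by rewrite nmM nm_real. Qed.

Lemma nm_sqr z : nm z ^+ 2 = complex.Re z ^+ 2 + complex.Im z ^+ 2.
Proof. by rewrite /nm sqr_sqrtr // addr_ge0 ?sqr_ge0. Qed.

Lemma Re_le_nm z : `|complex.Re z| <= nm z.
Proof. by rewrite /nm -sqrtr_sqr ler_wsqrtr // lerDl sqr_ge0. Qed.

Lemma Im_le_nm z : `|complex.Im z| <= nm z.
Proof. by rewrite /nm -sqrtr_sqr ler_wsqrtr // lerDr sqr_ge0. Qed.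

Lemma nm_le_ReIm z : nm z <= `|complex.Re z| + `|complex.Im z|.
Proof.
rewrite -(@ler_pXn2r _ 2) ?nnegrE ?nm_ge0 ?addr_ge0 //.
by rewrite nm_sqr -(real_normK (num_real (complex.Re z))) -(real_normK (num_real (complex.Im z))) sqrrD lerD2r lerDl mulrn_wge0 ?mulr_ge0.
Qed.

Lemma ReD z w : complex.Re (z + w) = complex.Re z + complex.Re w.
Proof. by case: z; case: w. Qed.

Lemma ImD z w : complex.Im (z + w) = complex.Im z + complex.Im w.
Proof. by case: z; case: w. Qed.

Lemma ReN z : complex.Re (- z) = - complex.Re z.
Proof. by case: z. Qed.

Lemma ImN z : complex.Im (- z) = - complex.Im z.
Proof. by case: z. Qed.

Lemma ReZ x z : complex.Re (x%:C%C * z) = x * complex.Re z.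
Proof. by case: z => a b /=; rewrite mul0r subr0. Qed.

Lemma nm_sum (I : Type) (s : seq I) (P : pred I) (F : I -> C) :
  nm (\sum_(i <- s | P i) F i) <= \sum_(i <- s | P i) nm (F i).
Proof.
elim/big_rec2: _ => [|i x y _ H]; first by rewrite nm0.
by rewrite (le_trans (nmD _ _)) // lerD2l.
Qed.

Lemma nm_le0 z : nm z <= 0 -> z = 0.
Proof. by move=> H; apply/eqP; rewrite -nm_eq0 eq_le H nm_ge0. Qed.

Lemma nm_small z : (forall e : R, 0 < e -> nm z <= e) -> z = 0.
Proof.
move=> H; apply: nm_le0; rewrite leNgt; apply/negP => h.
by have := H (nm z / 2) ltac:(lra); lra.
Qed.

Lemma nm_X2 (z : C) : (nm z ^+ 2)%:C%C = z * z^*%C.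
Proof.
rewrite nm_sqr; case: z => a b /=.
by apply/eqP; rewrite eq_complex /=; apply/andP; split; apply/eqP; ring.
Qed.

Lemma lt0c_real (e : C) : 0 < e -> e = (complex.Re e)%:C%C /\ 0 < complex.Re e.
Proof.
rewrite ltcE /= => /andP [/eqP h1 h2]; split => //.
by case: e h1 h2 => a b /= ->.
Qed.

Lemma nbhsCT (z : C) (P : set C) :
  nbhs (z : @CT R) P <-> exists2 e : R, 0 < e & forall w, nm (w - z) < e -> P w.
Proof.
split.
  move/(@nbhs_normP C (@CT R) z) => [e /= /lt0c_real [-> e0] H].
  exists (complex.Re e) => // w hw; apply: H => /=.
  by rewrite -/(`|z - w|) normE ltcR nmBC.
move=> [e e0 H]; apply/(@nbhs_normP C (@CT R) z); exists e%:C%C.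
  by rewrite /= ltcR.
by move=> w /=; rewrite -/(`|z - w|) normE ltcR nmBC; exact: H.
Qed.

Lemma openCT (U : set C) : @open (@CT R) U ->
  forall z, U z -> exists2 e : R, 0 < e & forall w, nm (w - z) < e -> U w.
Proof. by move=> oU z Uz; apply/nbhsCT; exact: open_nbhs_nbhs. Qed.

(** Multiplied out and with a non-strict bound: the inequality is trivial at [w = z], so neither
    division nor a punctured neighbourhood appears. *)
Definition cdiff (f : C -> C) (z l : C) : Prop :=
  forall e : R, 0 < e -> exists2 d : R, 0 < d &
    forall w, nm (w - z) < d -> nm (f w - f z - l * (w - z)) <= e * nm (w - z).

Lemma cdiff_derive (f : C -> C) (z : C) :
  derivable (f : @CT R -> @CT R) (z : @CT R) (1 : @CT R) ->
  cdiff f z (cderiv f z).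
Proof.
set l := cderiv f z => H e e0.
have {H} : (h^-1 *: ((f : @CT R -> @CT R) (h *: (1 : @CT R) + z) - f z)
   @[h --> (0 : @CT R)^']) --> (l : @CT R) by exact: H.
move=> /cvgr_dist_le /(_ e%:C%C); rewrite ltcR => /(_ e0).
rewrite /dnbhs /within /= => /(nbhsCT 0) [d d0 H].
exists d => // w hw.
have [->|wz] := eqVneq w z; first by rewrite !subrr mulr0 subr0 nm0 mulr0.
have wz0 : w - z != 0 by rewrite subr_eq0.
have wE : (w - z) *: (1 : @CT R) + z = w.
  by rewrite [_ *: _](mulr1 (w - z)) subrK.
have h : nm (l - (w - z)^-1 * (f w - f z)) <= e.
  rewrite -lecR -normE; have := H (w - z); rewrite subr0 => /(_ hw wz0).
  by rewrite wE.
rewrite -[X in nm (_ - X)]mulrC.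
have -> : f w - f z - (w - z) * l = (w - z) * ((w - z)^-1 * (f w - f z) - l).
  by field.
by rewrite nmM mulrC ler_wpM2r ?nm_ge0 // nmBC.
Qed.

Lemma cdiff_is_derive (f : C -> C) (z l : C) : cdiff f z l ->
  is_derive (z : @CT R) (1 : @CT R) (f : @CT R -> @CT R) (l : @CT R).
Proof.
move=> H.
have cv : (h^-1 *: ((f : @CT R -> @CT R) (h *: (1 : @CT R) + z) - f z)
   @[h --> (0 : @CT R)^']) --> (l : @CT R).
  apply/cvgrPdist_le => e' /lt0c_real [-> e0].
  set e : R := complex.Re e' in e0 *.
  have [d d0 {}H] := H _ e0.
  rewrite /dnbhs /within /=; apply/(nbhsCT 0); exists d => // h hd h0.
  rewrite subr0 in hd.
  have hE : h *: (1 : @CT R) + z = h + z by rewrite [_ *: _](mulr1 h).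
  rewrite hE; change (`| l - h^-1 * (f (h + z) - f z)| <= e%:C%C).
  rewrite normE lecR.
  have := H (h + z); rewrite addrK => /(_ hd).
  have -> : f (h + z) - f z - l * h = h * (h^-1 * (f (h + z) - f z) - l) by field.
  by rewrite nmM nmBC mulrC ler_pM2r // nm_gt0.
by apply: DeriveDef; [apply/cvg_ex; exists l | exact: cvg_lim cv].
Qed.

Lemma cdiff_unique (f : C -> C) (z l m : C) : cdiff f z l -> cdiff f z m -> l = m.
Proof.
move=> /cdiff_is_derive [_ <-] /cdiff_is_derive [_ <-] //.
Qed.

End Modulus.

(** * Ultralimits of bounded sequences *)

Section Ultralimit.
Context {R : realType}.
Local Notation C := (R[i]).

Definition ultra : set_system nat := projT1 (cid (ultraFilterLemma eventually_filter)).

#[local] Instance ultra_ultra : UltraFilter ultra.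
Proof. by rewrite /ultra; case: cid => G []. Qed.

Lemma ultra_eventually (P : set nat) (N : nat) :
  (forall n, (N <= n)%N -> P n) -> ultra P.
Proof.
move=> H; rewrite /ultra; case: cid => G [GU sG] /=; apply: sG.
by exists N => // n /= /H.
Qed.

Lemma ultraI (P Q : set nat) : ultra P -> ultra Q -> ultra (P `&` Q).
Proof. exact: filterI. Qed.

Lemma ultraS (P Q : set nat) : (forall n, P n -> Q n) -> ultra P -> ultra Q.
Proof. by move=> PQ; apply: filterS. Qed.

Lemma ultra_ex (P : set nat) : ultra P -> exists n, P n.
Proof. exact: filter_ex. Qed.

Lemma ultra_ex_ge (P : set nat) (N : nat) : ultra P -> exists2 n, (N <= n)%N & P n.
Proof.
move=> UP; have h : ultra (fun n => (N <= n)%N) by exact: (@ultra_eventually _ N).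
have /ultra_ex [n [nN Pn]] := ultraI h UP.
by exists n.
Qed.

(** The image of [ultra] under [u] is again an ultrafilter, and compactness of [[-B, B]] in its
    ultrafilter form provides the limit. *)
Lemma ultra_real_cvg (u : nat -> R) (B : R) : (forall n, `|u n| <= B) ->
  exists l : R, forall e : R, 0 < e -> ultra [set n | `|u n - l| < e].
Proof.
move=> uB.
have := @segment_compact R (- B) B; rewrite compact_ultra => cB.
have uF : UltraFilter (u @ ultra).
  split; first exact: fmap_proper_filter.
  move=> G GF sub; rewrite eqEsubset; split => // A GA.
  have [//|nA] := in_ultra_setVsetC (u @^-1` A) ultra_ultra.
  have GnA : G (~` A) by exact: sub.
  have h : G (A `&` ~` A) by apply: filterI.
  by have [x []] := filter_ex h.
have [|l [_ ul]] := cB (u @ ultra) uF.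
  by apply: (@filterE _ ultra) => n; rewrite /= in_itv /= -ler_norml; exact: uB.
exists l => e e0; have /cvgr_dist_lt /(_ _ e0) := ul.
by apply: filterS => n /=; rewrite distrC.
Qed.

Definition is_ulim (u : nat -> C) (l : C) :=
  forall e : R, 0 < e -> ultra [set n | nm (u n - l) < e].

Definition ulim (u : nat -> C) : C := xget 0 [set l | is_ulim u l].

Lemma ulimP (u : nat -> C) (B : R) : (forall n, nm (u n) <= B) -> is_ulim u (ulim u).
Proof.
move=> uB; suff [l ul] : exists l, is_ulim u l.
  by rewrite /ulim; case: xgetP => [// | /(_ l)].
have [n|a Ha] := @ultra_real_cvg (fun n => complex.Re (u n)) B.
  exact: le_trans (Re_le_nm _) (uB n).
have [n|b Hb] := @ultra_real_cvg (fun n => complex.Im (u n)) B.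
  exact: le_trans (Im_le_nm _) (uB n).
exists (Complex a b) => e e0; have e20 : 0 < e / 2 by lra.
apply: ultraS (ultraI (Ha _ e20) (Hb _ e20)) => n [/= h1 h2].
apply: le_lt_trans (nm_le_ReIm _) _; rewrite !ReD !ImD !ReN !ImN /=; lra.
Qed.

Lemma is_ulim_le (u : nat -> C) (l c : C) (B : R) :
  is_ulim u l -> ultra [set n | nm (u n - c) <= B] -> nm (l - c) <= B.
Proof.
move=> ul UB; apply/ler_addgt0Pr => e e0.
have [n [/= h1 h2]] := ultra_ex (ultraI (ul _ e0) UB).
by rewrite (le_trans (nm_tri (u n) _ _)) // (nmBC l); lra.
Qed.

Lemma is_ulim_unique (u : nat -> C) (l m : C) : is_ulim u l -> is_ulim u m -> l = m.
Proof.
move=> ul um; apply: subr0_eq; apply: nm_small => e e0.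
by apply: (is_ulim_le ul); apply: ultraS (um _ e0) => n /= /ltW.
Qed.

Lemma is_ulimE (u : nat -> C) (l : C) : is_ulim u l -> ulim u = l.
Proof.
move=> ul; rewrite /ulim; case: xgetP => [m _ um | /(_ l)//].
exact: is_ulim_unique um ul.
Qed.

Lemma is_ulim_cvg (u : nat -> C) (l : C) :
  (forall e : R, 0 < e -> exists N, forall n, (N <= n)%N -> nm (u n - l) < e) ->
  is_ulim u l.
Proof. by move=> H e /H [N]; exact: ultra_eventually. Qed.

Lemma is_ulimD (u v : nat -> C) (l m : C) :
  is_ulim u l -> is_ulim v m -> is_ulim (fun n => u n + v n) (l + m).
Proof.
move=> ul vm e e0; have e20 : 0 < e / 2 by lra.
apply: ultraS (ultraI (ul _ e20) (vm _ e20)) => n [/= h1 h2].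
by rewrite opprD addrACA; apply: le_lt_trans (nmD _ _) _; lra.
Qed.

Lemma is_ulimZ (u : nat -> C) (l c : C) :
  is_ulim u l -> is_ulim (fun n => c * u n) (c * l).
Proof.
move=> ul e e0; have c0 := nm_ge0 c.
have h : 0 < e / (nm c + 1) by apply: divr_gt0 => //; lra.
apply: ultraS (ul _ h) => n /=; rewrite -mulrBr nmM ltr_pdivlMr; last by lra.
have := nm_ge0 (u n - l); nra.
Qed.

Lemma is_ulim_cst (c : C) : is_ulim (fun=> c) c.
Proof. by apply: is_ulim_cvg => e e0; exists 0%N => n _; rewrite subrr nm0. Qed.

Lemma is_ulimN (u : nat -> C) (l : C) : is_ulim u l -> is_ulim (fun n => - u n) (- l).
Proof.
by move=> ul e e0; apply: ultraS (ul _ e0) => n /=; rewrite -opprD nmN.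
Qed.

Lemma is_ulimB (u v : nat -> C) (l m : C) :
  is_ulim u l -> is_ulim v m -> is_ulim (fun n => u n - v n) (l - m).
Proof. by move=> ul vm; apply: is_ulimD => //; exact: is_ulimN. Qed.

Lemma is_ulim_ext (u v : nat -> C) (l : C) :
  (forall n, u n = v n) -> is_ulim u l -> is_ulim v l.
Proof. by move=> uv ul e e0; apply: ultraS (ul _ e0) => n /=; rewrite uv. Qed.

End Ultralimit.

(** * Goursat's theorem and primitives *)

Section Goursat.
Context {R : realType}.
Local Notation C := (R[i]).
Implicit Types (f g : C -> C) (a b c p : C) (n : nat).

Definition hol (r : R) f := forall z, nm z < r -> exists l, cdiff f z l.

Definition mid a b : C := (a + b) / 2%:R.

(* Midpoint Riemann sum of [int_a^b f(z) dz] over 2^n equal segments *)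
Fixpoint dsum f n a b : C :=
  if n is n'.+1 then dsum f n' a (mid a b) + dsum f n' (mid a b) b
  else (b - a) * f (mid a b).

Lemma midC a b : mid a b = mid b a.
Proof. by rewrite /mid addrC. Qed.

Lemma nm_half (z : C) : nm (z / 2%:R) = nm z / 2.
Proof. by rewrite nmM nmV nm_nat. Qed.

Lemma mid_ball p (rho : R) a b : nm (a - p) <= rho -> nm (b - p) <= rho ->
  nm (mid a b - p) <= rho.
Proof.
move=> ha hb; have -> : mid a b - p = ((a - p) + (b - p)) / 2%:R by rewrite /mid; field.
rewrite nm_half; have := nmD (a - p) (b - p); lra.
Qed.

(** Midpoints make the sum exactly odd under reversal of the segment at every level [n], so inner
    sides cancel in [eta_split] before any limit is taken. *)
Lemma dsum_anti f n a b : dsum f n b a = - dsum f n a b.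
Proof.
elim: n a b => [|n IH] a b /=; first by rewrite (midC b a); ring.
by rewrite (midC b a) IH (IH a); ring.
Qed.

Lemma dsumB f g n a b :
  dsum (fun z => f z - g z) n a b = dsum f n a b - dsum g n a b.
Proof.
elim: n a b => [|n IH] a b /=; first by ring.
by rewrite !IH; ring.
Qed.

(** The midpoint rule is exact in degree at most one, so an affine function contributes exactly 0
    around a triangle. *)
Lemma dsum_affine (u v : C) n a b :
  dsum (fun z => u + v * z) n a b = u * (b - a) + v * (b ^+ 2 - a ^+ 2) / 2%:R.
Proof.
elim: n a b => [|n IH] a b /=; first by rewrite /mid; field.
by rewrite !IH /mid; field.
Qed.

Lemma dsum_bound f n p (rho B : R) a b :
  (forall z, nm (z - p) <= rho -> nm (f z) <= B) ->
  nm (a - p) <= rho -> nm (b - p) <= rho ->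
  nm (dsum f n a b) <= B * nm (b - a).
Proof.
move=> fB; elim: n a b => [|n IH] a b ha hb /=.
  by rewrite nmM mulrC ler_wpM2r ?nm_ge0 // fB // mid_ball.
have hm := mid_ball ha hb.
apply: le_trans (nmD _ _) _; apply: le_trans (lerD (IH _ _ ha hm) (IH _ _ hm hb)) _.
have -> : mid a b - a = (b - a) / 2%:R by rewrite /mid; field.
have -> : b - mid a b = (b - a) / 2%:R by rewrite /mid; field.
by rewrite nm_half; lra.
Qed.

Definition tri := (C * C * C)%type.

Definition eta f n (t : tri) : C :=
  let: (a, b, c) := t in dsum f n a b + dsum f n b c + dsum f n c a.

Definition child (i : 'I_4) (t : tri) : tri :=
  let: (a, b, c) := t in
  match val i with
  | 0%N => (a, mid a b, mid a c)
  | 1%N => (mid a b, b, mid b c)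
  | 2%N => (mid a c, mid b c, c)
  | _ => (mid b c, mid a c, mid a b)
  end.

(** Level [n+1] on a triangle is level [n] on its half sides; the three inner segments are run
    through twice in opposite directions, which dictates the vertex order of the fourth child. *)
Lemma eta_split f n t : eta f n.+1 t = \sum_(i < 4) eta f n (child i t).
Proof.
case: t => [[a b] c]; rewrite !big_ord_recr big_ord0 /= (midC c a).
rewrite (dsum_anti f n (mid a b) (mid a c)) (dsum_anti f n (mid a b) (mid b c)).
rewrite (dsum_anti f n (mid b c) (mid a c)).
ring.
Qed.

Definition tri_small (d : R) (t : tri) :=
  let: (a, b, c) := t in [/\ nm (b - a) <= d, nm (c - b) <= d & nm (a - c) <= d].

Definition tri_ball p (rho : R) (t : tri) :=
  let: (a, b, c) := t in
  [/\ nm (a - p) <= rho, nm (b - p) <= rho & nm (c - p) <= rho].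

Lemma tri_smallW (d : R) a b c : tri_small d (a, b, c) -> tri_ball a d (a, b, c).
Proof.
move=> [h1 h2 h3]; split; [|exact: h1|by rewrite nmBC].
by rewrite subrr nm0 (le_trans _ h1) ?nm_ge0.
Qed.

Lemma child_ball p rho i t : tri_ball p rho t -> tri_ball p rho (child i t).
Proof.
by case: t => [[a b] c] [ha hb hc]; case: i => [[|[|[|[|//]]]] ?] /=;
   split => //; exact: mid_ball.
Qed.

Lemma child_small d i t : tri_small d t -> tri_small (d / 2) (child i t).
Proof.
case: t => [[a b] c] [h1 h2 h3].
have E (x y : C) : nm x <= d -> y = x / 2%:R -> nm y <= d / 2.
  by move=> hx ->; rewrite nm_half; lra.
have h4 := h1; rewrite nmBC in h4; have h5 := h2; rewrite nmBC in h5.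
have h6 := h3; rewrite nmBC in h6.
by case: i => [[|[|[|[|//]]]] ?] /=; split;
  [ apply: (E (b - a)) | apply: (E (c - b)) | apply: (E (a - c))
  | apply: (E (b - a)) | apply: (E (c - b)) | apply: (E (a - c))
  | apply: (E (b - a)) | apply: (E (c - b)) | apply: (E (a - c))
  | apply: (E (a - b)) | apply: (E (b - c)) | apply: (E (c - a)) ];
  rewrite // /mid; field.
Qed.

Lemma eta_bound f n p (rho d B : R) t :
  0 <= B -> (forall z, nm (z - p) <= rho -> nm (f z) <= B) ->
  tri_ball p rho t -> tri_small d t -> nm (eta f n t) <= 3 * B * d.
Proof.
case: t => [[a b] c] B0 fB [ha hb hc] [h1 h2 h3] /=.
have E1 := dsum_bound n fB ha hb; have E2 := dsum_bound n fB hb hc.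
have E3 := dsum_bound n fB hc ha.
apply: le_trans (nmD _ _) _; apply: le_trans (lerD (nmD _ _) (lexx _)) _.
have := nm_ge0 (b - a); have := nm_ge0 (c - b); have := nm_ge0 (a - c); nra.
Qed.

Lemma eta_affine (u v : C) n t : eta (fun z => u + v * z) n t = 0.
Proof. by case: t => [[a b] c] /=; rewrite !dsum_affine; field. Qed.

Lemma etaB f g n t : eta (fun z => f z - g z) n t = eta f n t - eta g n t.
Proof. by case: t => [[a b] c] /=; rewrite !dsumB; ring. Qed.

(** Stands for smallness of the contour integral before a limit of the sums is known to exist. *)
Definition evsmall f (e : R) t := exists N, forall n, (N <= n)%N -> nm (eta f n t) <= e.

Lemma not_evsmall_child f e t : ~ evsmall f e t ->
  exists i, ~ evsmall f (e / 4) (child i t).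
Proof.
apply: contra_notP => /forallNP H.
have {}H i : exists N, forall n, (N <= n)%N -> nm (eta f n (child i t)) <= e / 4.
  by have /contrapT := H i.
have [N HN] := choice H.
exists (\max_i N i).+1 => -[//|n]; rewrite ltnS => hn.
rewrite eta_split; apply: le_trans (nm_sum _ _ _) _.
have -> : e = \sum_(i < 4) e / 4.
  by rewrite sumr_const card_ord -mulr_natr; field.
apply: ler_sum => i _; apply: HN; apply: leq_trans hn; exact: leq_bigmax.
Qed.

Lemma geometric_ulim (u : nat -> C) (d : R) : 0 <= d ->
  (forall j, nm (u j.+1 - u j) <= d / 2 ^+ j) ->
  exists p, is_ulim u p /\ forall j, nm (u j - p) <= 2 * d / 2 ^+ j.
Proof.
move=> d0 H.
have T j i : nm (u (j + i)%N - u j) <= 2 * d / 2 ^+ j - 2 * d / 2 ^+ (j + i).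
  elim: i => [|i IH]; first by rewrite addn0 !subrr nm0.
  rewrite addnS; apply: le_trans (nm_tri (u (j + i)%N) _ _) _.
  apply: le_trans (lerD (H _) IH) _.
  rewrite exprS; have : 0 < 2 ^+ (j + i) :> R by rewrite exprn_gt0.
  set x := 2 ^+ (j + i) => x0; set y := 2 * d / 2 ^+ j.
  have -> : 2 * d / (2 * x) = d / x by field; rewrite gt_eqF.
  by lra.
have pos k : 0 <= 2 * d / 2 ^+ k by rewrite divr_ge0 ?exprn_ge0 //; lra.
have [p up] : exists p, is_ulim u p.
  exists (ulim u); apply: (@ulimP _ _ (2 * d + nm (u 0%N))) => n.
  have := T 0%N n; rewrite add0n expr0 => h1; have := nm_tri 0 (u n) 0.
  have := nmB_ge (u n) (u 0%N); have := pos n; lra.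
exists p; split => // j; rewrite nmBC; apply: (is_ulim_le up).
apply: (@ultra_eventually _ j) => n jn; rewrite -(subnKC jn) /=.
by have := T j (n - j)%N; have := pos (j + (n - j))%N; lra.
Qed.

Lemma pow2_inv_small (x e : R) : 0 < e -> exists j, x / 2 ^+ j <= e.
Proof.
move=> e0; exists (Num.truncn (x / e)).+1; rewrite ler_pdivrMr ?exprn_gt0 //.
rewrite mulrC -ler_pdivrMr //.
apply: le_trans (ltW (truncnS_gt _)) _.
by rewrite -natrX ler_nat ltnW // ltn_expl.
Qed.

(** Classical bisection: a bad triangle has a child that is bad for a quarter of the threshold. The
    nested triangles shrink to a point [p], where subtracting the affine part of [f] leaves a
    boundary sum below the threshold [e / 4^j]. *)
Lemma goursat f (r rho : R) t : hol r f -> rho < r -> tri_ball 0 rho t ->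
  forall e : R, 0 < e -> evsmall f e t.
Proof.
move=> fh rr tb e e0; apply: contrapT => nbad.
(* Picks a bad child; the default [ord0] is not met along the sequence, since [not_evsmall_child]
   always supplies one. *)
pose next (s : tri * R) : tri * R :=
  (child (xget ord0 [set i | ~ evsmall f (s.2 / 4) (child i s.1)]) s.1, s.2 / 4).
pose s j := iter j next (t, e).
have sS j : s j.+1 = next (s j) by [].
have s2 j : (s j).2 = e / 4 ^+ j.
  elim: j => [|j IH]; first by rewrite /= expr0 divr1.
  by rewrite sS /= IH exprS; field; rewrite expf_neq0 //.
have sbad j : ~ evsmall f (s j).2 (s j).1.
  elim: j => [//|j IH]; rewrite sS /=.
  by case: xgetP => [i //|H]; have [i /H] := not_evsmall_child IH.
have sball j : tri_ball 0 rho (s j).1.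
  by elim: j => [//|j IH]; rewrite sS /=; exact: child_ball.
have [d d0 td] : exists2 d : R, 0 < d & tri_small d t.
  case: {+}t tb => [[a b] c] [h1 h2 h3]; rewrite !subr0 in h1 h2 h3.
  exists (2 * rho + 1); first by have := nm_ge0 a; lra.
  by split; apply: le_trans (nmB _ _) _; lra.
have ssm j : tri_small (d / 2 ^+ j) (s j).1.
  elim: j => [|j IH]; first by rewrite /= expr0 divr1.
  have -> : d / 2 ^+ j.+1 = d / 2 ^+ j / 2 by rewrite exprS; field; rewrite expf_neq0.
  by rewrite sS /=; exact: child_small.
pose u j := ((s j).1).1.1.
have uball j : nm (u j) <= rho.
  by have := sball j; rewrite /u; case: (s j).1 => [[a b] c] [h _ _]; rewrite subr0 in h.
have [|p [up pu]] := @geometric_ulim u d (ltW d0).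
  move=> j; rewrite /u sS /=; move: (ssm j).
  case: (s j).1 => [[a b] c] /tri_smallW /(child_ball (xget ord0 [set i | ~ evsmall f ((s j).2 / 4) (child i (a, b, c))])) .
  by case: child => [[a' b'] c'] [].
have pr : nm p < r.
  apply: le_lt_trans rr; rewrite -(subr0 p); apply: (is_ulim_le up).
  by apply: (@ultra_eventually _ 0%N) => n _; rewrite /= subr0.
have [l hl] := fh _ pr.
(* With [q = 3 d / 2^j], the bound [3 (e1 q) (d / 2^j)] of [eta_bound] is then exactly [e / 4^j]. *)
pose e1 := e / (9 * d ^+ 2).
have e10 : 0 < e1 by rewrite divr_gt0 // mulr_gt0 // exprn_gt0.
have [de de0 Hd] := hl e1 e10.
have [j hj] : exists j, 3 * d / 2 ^+ j <= de / 2 by apply: pow2_inv_small; lra.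
pose h z := f z - ((f p - l * p) + l * z).
(* Distance [2 d / 2^j] from [p] to the first vertex, plus [d / 2^j] for a side. *)
pose q := 3 * d / 2 ^+ j.
have q0 : 0 < q by rewrite divr_gt0 ?exprn_gt0 //; lra.
have hB z : nm (z - p) <= q -> nm (h z) <= e1 * q.
  move=> zp; have -> : h z = f z - f p - l * (z - p) by rewrite /h; ring.
  by apply: le_trans (Hd z _) _; [rewrite -/q in hj; lra|rewrite ler_pM2l].
have tbj : tri_ball p q (s j).1.
  have := ssm j; have := pu j; rewrite /u.
  case: (s j).1 => [[a b] c] /= h1 /tri_smallW [_ h2 h3].
  have -> : q = d / 2 ^+ j + 2 * d / 2 ^+ j by rewrite /q; field; rewrite expf_neq0.
  have d2 : 0 < d / 2 ^+ j by rewrite divr_gt0 // exprn_gt0.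
  split; first by lra.
  - by apply: le_trans (nm_tri a _ _) _; lra.
  - by apply: le_trans (nm_tri a _ _) _; lra.
apply: (sbad j); exists 0%N => n _; rewrite s2.
have := @eta_bound h n p q _ (e1 * q) _ _ hB tbj (ssm j).
rewrite /h etaB eta_affine subr0.
have -> : 3 * (e1 * q) * (d / 2 ^+ j) = e / 4 ^+ j.
  have -> : 4 ^+ j = 2 ^+ j * 2 ^+ j :> R by rewrite -exprMn; congr (_ ^+ _); ring.
  by rewrite /e1 /q; field; rewrite ?expf_neq0 //= gt_eqF.
by apply; rewrite mulr_ge0 ?ltW.
Qed.

Lemma cdiff_cont f z l : cdiff f z l ->
  forall e : R, 0 < e -> exists2 d : R, 0 < d & forall w, nm (w - z) < d -> nm (f w - f z) <= e.
Proof.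
move=> H e e0; have [d d0 {}H] := H 1 ltr01.
have l0 := nm_ge0 l.
exists (Num.min d (e / (1 + nm l))); first by rewrite lt_min d0 divr_gt0 //; lra.
move=> w; rewrite lt_min => /andP [/H h1]; rewrite ltr_pdivlMr; last by lra.
move=> h2; have -> : f w - f z = (f w - f z - l * (w - z)) + l * (w - z) by ring.
apply: le_trans (nmD _ _) _; rewrite nmM; have := nm_ge0 (w - z); nra.
Qed.

(** Otherwise an ultralimit of points with [|f (u n)| > n] would be a point of the disc where [f] is
    not continuous. *)
Lemma hol_bounded f (r rho : R) : hol r f -> rho < r ->
  exists2 B : R, 0 <= B & forall z, nm z <= rho -> nm (f z) <= B.
Proof.
move=> fh rr; apply: contrapT => /forall2NP H.
have {}H n : exists z, nm z <= rho /\ n%:R < nm (f z).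
  have [|/existsNP [z /not_implyP [h1 h2]]] := H n%:R; first by rewrite ler0n.
  by exists z; split => //; rewrite ltNge; apply/negP.
have [u Hu] := choice H.
have up : is_ulim u (ulim u) by apply: (@ulimP _ _ rho) => n; case: (Hu n).
set p := ulim u in up.
have pr : nm p < r.
  apply: le_lt_trans rr; rewrite -(subr0 p); apply: (is_ulim_le up).
  by apply: (@ultra_eventually _ 0%N) => n _; rewrite /= subr0; case: (Hu n).
have [l /cdiff_cont /(_ 1 ltr01) [d d0 Hd]] := fh _ pr.
have [n h1 h2] := ultra_ex_ge (Num.truncn (nm (f p) + 1)).+1 (up d d0).
have := Hd _ h2; have [_] := Hu n; have := nmB_ge (f (u n)) (f p).
have : nm (f p) + 1 < n%:R by apply: lt_le_trans (truncnS_gt _) _; rewrite ler_nat.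
lra.
Qed.

(** The ultralimit of Riemann sums along the segment from 0; Goursat on the triangle [0, z, w] turns
    its increment into the sum from [z] to [w]. *)
Lemma primitive f (r : R) : 0 < r -> hol r f ->
  exists F : C -> C, forall z, nm z < r -> cdiff F z (f z).
Proof.
move=> r0 fh.
have conv a b : nm a < r -> nm b < r -> is_ulim (fun n => dsum f n a b) (ulim (fun n => dsum f n a b)).
  move=> ha hb.
  pose rho := Num.max (nm a) (nm b).
  have hr : rho < r by rewrite /rho gt_max ha hb.
  have [B B0 fB] := hol_bounded fh hr.
  apply: (@ulimP _ _ (B * nm (b - a))) => n.
  apply: (@dsum_bound f n 0 rho); rewrite ?subr0; first by move=> z; rewrite subr0; exact: fB.
    by rewrite /rho le_max lexx.
  by rewrite /rho le_max lexx orbT.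
exists (fun z => ulim (fun n => dsum f n 0 z)) => z hz e e0.
have [l /cdiff_cont /(_ e e0) [d d0 Hd]] := fh z hz.
exists (Num.min d (r - nm z) / 2).
  by rewrite divr_gt0 // lt_min d0 subr_gt0.
move=> w hw.
have hwd : nm (w - z) < d / 2.
  by apply: lt_le_trans hw _; rewrite ler_pM2r ?invr_gt0 // ge_min lexx.
have hwr : nm (w - z) < r - nm z.
  apply: lt_le_trans hw _.
  have : Num.min d (r - nm z) <= r - nm z by rewrite ge_min lexx orbT.
  lra.
have wr : nm w < r by have := nmB_ge w z; lra.
have n0r : nm (0 : C) < r by rewrite nm0.
have tb : tri_ball 0 (Num.max (nm z) (nm w)) (0, z, w).
  by split; rewrite subr0 le_max ?lexx ?orbT // nm0 nm_ge0.
have etaU : is_ulim (fun n => eta f n (0, z, w)) 0.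
  apply: is_ulim_cvg => e' e'0.
  have [||N HN] := @goursat f r (Num.max (nm z) (nm w)) (0, z, w) fh _ tb (e' / 2); [by rewrite gt_max hz wr|lra|].
  by exists N => n /HN h; rewrite subr0; lra.
have E : ulim (fun n => dsum f n 0 w) - ulim (fun n => dsum f n 0 z) = ulim (fun n => dsum f n z w).
  apply: (@is_ulim_unique _ (fun n => dsum f n z w)); last exact: conv.
  have := is_ulimB (is_ulimB (conv _ _ n0r wr) (conv _ _ n0r hz)) (is_ulimN etaU).
  rewrite oppr0 subr0; apply: is_ulim_ext => n /=.
  by rewrite (dsum_anti f n 0 w); ring.
rewrite E -[X in _ - X]addr0; apply: (is_ulim_le (conv _ _ hz wr)).
apply: (@ultra_eventually _ 0%N) => n _.
(* The constant [f z] is written as an affine function so that [dsum_affine] evaluates its sum. *)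
have := @dsum_bound (fun x => f x - (f z + 0 * x)) n z (nm (w - z)) e z w.
rewrite dsumB dsum_affine mul0r mul0r !addr0; apply => //.
- move=> x hx; rewrite mul0r addr0; apply: Hd; lra.
- by rewrite subrr nm0 nm_ge0.
Qed.

End Goursat.

(** * Calculus of complex derivatives *)

Section Derivatives.
Context {R : realType}.
Local Notation C := (R[i]).
Implicit Types (f g : C -> C) (z w l m c : C).

Lemma cdiff_cst c z : cdiff (fun=> c) z 0.
Proof.
move=> e e0; exists 1 => // w _.
by rewrite mul0r subr0 subrr nm0 mulr_ge0 ?nm_ge0 // ltW.
Qed.

Lemma cdiff_affine c d z : cdiff (fun w => c + d * w) z d.
Proof.
move=> e e0; exists 1 => // w _.
have -> : c + d * w - (c + d * z) - d * (w - z) = 0 by ring.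
by rewrite nm0 mulr_ge0 ?nm_ge0 // ltW.
Qed.

Lemma cdiffD f g z l m : cdiff f z l -> cdiff g z m ->
  cdiff (fun w => f w + g w) z (l + m).
Proof.
move=> hf hg e e0; have e20 : 0 < e / 2 by lra.
have [d1 d10 H1] := hf _ e20; have [d2 d20 H2] := hg _ e20.
exists (Num.min d1 d2); first by rewrite lt_min d10.
move=> w; rewrite lt_min => /andP [/H1 h1 /H2 h2].
have -> : f w + g w - (f z + g z) - (l + m) * (w - z) =
  (f w - f z - l * (w - z)) + (g w - g z - m * (w - z)) by ring.
by apply: le_trans (nmD _ _) _; lra.
Qed.

Lemma cdiffZ c f z l : cdiff f z l -> cdiff (fun w => c * f w) z (c * l).
Proof.
move=> hf e e0; have c0 := nm_ge0 c.
have e20 : 0 < e / (nm c + 1) by apply: divr_gt0 => //; lra.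
have [d d0 H] := hf _ e20; exists d => // w /H h.
rewrite -mulrA -mulrBr -mulrBr nmM.
have := ler_wpM2l c0 h; set x := nm (w - z); have x0 : 0 <= x := nm_ge0 _.
move=> h'; apply: le_trans h' _; rewrite mulrA ler_wpM2r // mulrA ler_pdivrMr; nra.
Qed.

Lemma cdiffN f z l : cdiff f z l -> cdiff (fun w => - f w) z (- l).
Proof.
move=> hf; rewrite -mulN1r => e /(cdiffZ (-1) hf) [d d0 H].
by exists d => // w /H; rewrite !mulN1r.
Qed.

Lemma cdiffB f g z l m : cdiff f z l -> cdiff g z m ->
  cdiff (fun w => f w - g w) z (l - m).
Proof. by move=> hf hg; apply: cdiffD => //; exact: cdiffN. Qed.

Lemma cdiff_sum n (f : nat -> C -> C) z (l : nat -> C) :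
  (forall j, (j < n)%N -> cdiff (f j) z (l j)) ->
  cdiff (fun w => \sum_(j < n) f j w) z (\sum_(j < n) l j).
Proof.
elim: n => [|n IH] H.
  rewrite big_ord0 => e e0; have [d d0 h] := cdiff_cst 0 z e0.
  by exists d => // w /h; rewrite !big_ord0.
rewrite big_ord_recr /= => e e0.
have [|d d0 h] := cdiffD (IH _) (H n (ltnSn n)) e0.
  by move=> j jn; apply: H; apply: ltnW.
by exists d => // w /h; rewrite !big_ord_recr.
Qed.

Lemma cdiff_comp f g z l m : cdiff f z l -> cdiff g (f z) m ->
  cdiff (fun w => g (f w)) z (m * l).
Proof.
move=> hf hg e e0.
have m0 := nm_ge0 m; have l0 := nm_ge0 l.
pose a := e / (2 * (nm m + 1)); pose b := e / (2 * (nm l + 1)).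
have a0 : 0 < a by apply: divr_gt0 => //; lra.
have b0 : 0 < b by apply: divr_gt0 => //; lra.
have [d1 d10 H1] := hf _ a0; have [d2 d20 H2] := hf _ ltr01.
have [d3 d30 H3] := hg _ b0; have [d4 d40 H4] := cdiff_cont hf (e := d3 / 2) ltac:(lra).
exists (Num.min (Num.min d1 d2) d4); first by rewrite !lt_min d10 d20.
move=> w; rewrite !lt_min => /andP [/andP [/H1 h1 /H2 h2] /H4 h4].
have h3 : nm (f w - f z) < d3 by lra.
have {}h3 := H3 _ h3.
have -> : g (f w) - g (f z) - m * l * (w - z) =
  (g (f w) - g (f z) - m * (f w - f z)) + m * (f w - f z - l * (w - z)) by ring.
apply: le_trans (nmD _ _) _; rewrite nmM.
set x := nm (w - z) in h1 h2 *; have x0 : 0 <= x := nm_ge0 _.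
have h5 : nm (f w - f z) <= (nm l + 1) * x.
  have -> : f w - f z = (f w - f z - l * (w - z)) + l * (w - z) by ring.
  by apply: le_trans (nmD _ _) _; rewrite nmM -/x; lra.
have h6 : b * nm (f w - f z) <= e / 2 * x.
  apply: le_trans (ler_wpM2l (ltW b0) h5) _.
  have -> : b * ((nm l + 1) * x) = e / 2 * x by rewrite /b; field; rewrite gt_eqF //; lra.
  exact: lexx.
have h7 : nm m * nm (f w - f z - l * (w - z)) <= e / 2 * x.
  apply: le_trans (ler_wpM2l m0 h1) _.
  have -> : nm m * (a * x) = (nm m * a) * x by ring.
  apply: ler_wpM2r => //; rewrite /a mulrA ler_pdivrMr; nra.
lra.
Qed.

Lemma cdiff_ext f g z l (d : R) : 0 < d -> (forall w, nm (w - z) < d -> f w = g w) ->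
  cdiff f z l -> cdiff g z l.
Proof.
move=> d0 fg hf e /hf [d1 d10 H]; exists (Num.min d d1); first by rewrite lt_min d0.
move=> w; rewrite lt_min => /andP [h1 /H]; rewrite (fg _ h1) (fg z) //.
by rewrite subrr nm0.
Qed.

(** Complex values admit no mean value equality; the real theorem is applied to the real part of [f]
    along the segment, multiplied by the conjugate of [f b - f a]. *)
Lemma mean_value_ineq f (f' : C -> C) a b (B : R) :
  (forall t : R, 0 <= t <= 1 -> cdiff f (a + t%:C%C * (b - a)) (f' (a + t%:C%C * (b - a)))) ->
  (forall t : R, 0 < t < 1 -> nm (f' (a + t%:C%C * (b - a))) <= B) ->
  nm (f b - f a) <= B * nm (b - a).
Proof.
move=> hf hB; pose c := (f b - f a)^*%C.
pose p (t : R) := a + t%:C%C * (b - a).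
pose u (t : R) := complex.Re (c * f (p t)).
pose u' (t : R) := complex.Re (c * f' (p t) * (b - a)).
have du (t : R) : 0 <= t <= 1 -> is_derive t 1 u (u' t).
  move=> ht.
  have hg : cdiff (fun s => c * f (a + s * (b - a))) t%:C%C (c * f' (p t) * (b - a)).
    have ha : cdiff (fun s => a + s * (b - a)) t%:C%C (b - a).
      apply: cdiff_ext ltr01 _ (cdiff_affine a (b - a) t%:C%C) => w _; by rewrite mulrC.
    by rewrite -mulrA; apply: cdiffZ; apply: cdiff_comp ha _; exact: hf.
  have cv : (h^-1 *: (u (h *: 1 + t) - u t) @[h --> (0 : R)^']) --> u' t.
    apply/cvgrPdist_le => e e0; have [d d0 H] := hg _ e0.
    rewrite /dnbhs /within /=; apply/nbhs_normP; exists d => //= h /= hd h0.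
    have hh : nm ((h + t)%:C%C - t%:C%C) = `|h| by rewrite -rmorphB /= addrK nm_real.
    have := H (h + t)%:C%C; rewrite hh => /(_ _).
    rewrite sub0r normrN in hd => /(_ hd).
    rewrite -rmorphB /= addrK -/(p t) -/(p (h + t)) => h1.
    have h2 := le_trans (Re_le_nm _) h1.
    rewrite ReD ReN ReD ReN -/(u _) -/(u _) mulrC ReZ -/(u' _) in h2.
    have -> : h *: (1 : R) + t = h + t by rewrite [_ *: _]mulr1.
    have h0' : 0 < `|h| by rewrite normr_gt0.
    rewrite distrC -(ler_pM2l h0') -normrM mulrBr [_ *: _]/(h^-1 * _) mulrA divff // mul1r.
    by rewrite [_ * e]mulrC.
  by apply: DeriveDef; [apply/cvg_ex; exists (u' t) | exact: cvg_lim cv].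
have [t||t ht] := @MVT R u u' 0 1 ltr01.
- by rewrite in_itv /= => /andP [/ltW h1 /ltW h2]; apply: du; rewrite h1.
- apply: derivable_within_continuous => t; rewrite in_itv /= => ht.
  by have [] := du t ht.
rewrite in_itv /= in ht; have {du}/andP [t0 t1] := ht.
have p1 : p 1 = b by rewrite /p; ring.
have p0 : p 0 = a by rewrite /p; ring.
rewrite subr0 mulr1 /u p1 p0 -ReN -ReD -mulrN -mulrDr => hu.
have hc : complex.Re (c * (f b - f a)) = nm (f b - f a) ^+ 2.
  by rewrite /c mulrC -nm_X2.
rewrite hc in hu.
have [->|n0] := eqVneq (f b - f a) 0.
  rewrite nm0 mulr_ge0 ?nm_ge0 //; apply: le_trans (hB _ ht); exact: nm_ge0.
have np : 0 < nm (f b - f a) by rewrite nm_gt0.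
rewrite -(ler_pM2l np) -expr2 hu.
apply: le_trans (ler_norm _) _; apply: le_trans (Re_le_nm _) _.
rewrite !nmM -mulrA.
have -> : nm c = nm (f b - f a) by rewrite /c /nm; case: (f b - f a) => x y /=; rewrite sqrrN.
rewrite ler_pM2l // ler_wpM2r ?nm_ge0 //; exact: hB.
Qed.

End Derivatives.

(** * Cauchy's formula *)

Section Rotations.
Context {R : realType}.
Local Notation C := (R[i]).

Lemma nm_rotnum (a : R) : nm (rotnum a) = 1.
Proof. by rewrite /nm /= cos2Dsin2 sqrtr1. Qed.

Lemma rotnumD (a b : R) : rotnum (a + b) = rotnum a * rotnum b.
Proof.
apply/eqP; rewrite eq_complex /= mulrDr cosD sinD.
by apply/andP; split; apply/eqP; ring.
Qed.

Lemma rotnum0 : rotnum (0 : R) = 1.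
Proof. by rewrite /rotnum mulr0 cos0 sin0. Qed.

Lemma rotnumX (a : R) n : rotnum a ^+ n = rotnum (a * n%:R).
Proof.
elim: n => [|n IH]; first by rewrite expr0 mulr0 rotnum0.
by rewrite exprSr IH -rotnumD -natr1 mulrDr mulr1.
Qed.

Lemma rotnum1 : rotnum (1 : R) = 1.
Proof. by rewrite /rotnum mulr1 mulr_natl cos2pi sin2pi. Qed.

(** [cos (2 t) = 1] forces [sin t = 0], impossible for [t = pi x] strictly between 0 and [pi]. *)
Lemma rotnum_frac_neq1 (x : R) : 0 < x < 1 -> rotnum x != 1.
Proof.
move=> /andP [x0 x1]; apply/negP => /eqP []; rewrite -mulrA mulr_natl cos_mulr2n => h _.
have : 0 < sin (pi * x).
  by apply: sin_gt0_pi; rewrite mulr_gt0 ?pi_gt0 //= gtr_pMr ?pi_gt0.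
have := cos2Dsin2 (pi * x); nra.
Qed.

Lemma rotnum_int (m : int) : rotnum (m%:~R : R) = 1.
Proof.
have N (n : nat) : rotnum (n%:R : R) = 1.
  by rewrite -(mul1r n%:R) -rotnumX rotnum1 expr1n.
case: m => n; first exact: N.
rewrite NegzE mulrNz; have := rotnumD n.+1%:R (- n.+1%:R).
by rewrite subrr rotnum0 N mul1r.
Qed.

Lemma rotnum_eq1 (x : R) : rotnum x = 1 -> exists m : int, x = m%:~R.
Proof.
move=> h; exists (Num.floor x).
have := rotnumD (x - (Num.floor x)%:~R) (Num.floor x)%:~R.
rewrite subrK h rotnum_int mulr1 => h'.
apply/eqP; rewrite -subr_eq0; apply: contraT => n0.
suff : rotnum (x - (Num.floor x)%:~R) != 1 by rewrite -h' eqxx.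
apply: rotnum_frac_neq1; rewrite lt_def n0 /= subr_ge0 floor_le /=.
have := floorD1_gt x; rewrite rmorphD /=; lra.
Qed.

(** Order [N+2], so that the root differs from 1 for every [N]. *)
Definition unity (N : nat) : C := rotnum (N.+2%:R^-1).

Lemma unityXN N : unity N ^+ N.+2 = 1.
Proof. by rewrite /unity rotnumX mulVf ?pnatr_eq0 // rotnum1. Qed.

Lemma unityX_neq1 N m : (0 < m < N.+2)%N -> unity N ^+ m != 1.
Proof.
move=> /andP [m0 mN]; rewrite rotnumX; apply: rotnum_frac_neq1.
rewrite mulr_gt0 ?ltr0n ?invr_gt0 ?ltr0n //=.
by rewrite mulrC ltr_pdivrMr ?ltr0n // mul1r ltr_nat.
Qed.

Lemma unity_neq0 N : unity N != 0.
Proof. by rewrite -nm_gt0 nm_rotnum. Qed.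

Lemma unity_to1 (e : R) : 0 < e -> exists N, forall n, (N <= n)%N -> nm (unity n - 1) < e.
Proof.
move=> e0; have e20 : 0 < e / 2 by lra.
have /cvgrPdist_lt /(_ _ e20) := @continuous_cos R 0.
rewrite cos0 => /nbhs_normP [d1 /= d10 H1].
have /cvgrPdist_lt /(_ _ e20) := @continuous_sin R 0.
rewrite sin0 => /nbhs_normP [d2 /= d20 H2].
have pi0 := pi_gt0 R.
have d0 : 0 < Num.min d1 d2 / (2 * pi).
  by rewrite divr_gt0 ?lt_min ?d10 // mulr_gt0.
exists (Num.truncn (Num.min d1 d2 / (2 * pi))^-1) => n hn.
have hx : `|0 - 2 * pi / n.+2%:R| < Num.min d1 d2.
  rewrite sub0r normrN ger0_norm; last by rewrite divr_ge0 ?ler0n //; lra.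
  rewrite -ltr_pdivlMl; last by lra.
  rewrite mulrC -[X in _ < X]invrK ltf_pV2 ?posrE ?invr_gt0 ?ltr0n //.
  apply: lt_le_trans (truncnS_gt _) _; by rewrite ler_nat ltnS (leq_trans hn) // leqnSn.
move: hx; rewrite lt_min => /andP [/H1 h1 /H2 h2].
apply: le_lt_trans (nm_le_ReIm _) _.
rewrite !ReD !ImD !ReN !ImN /= oppr0 addr0 -normrN opprB.
by rewrite sub0r normrN in h2; lra.
Qed.

(* Averages over the (N+2)-th roots of unity of radius [rho] replace the contour integral *)
Definition avg (rho : R) (N : nat) (b : C -> C) : C :=
  (N.+2%:R)^-1 * \sum_(j < N.+2) b (rho%:C%C * unity N ^+ j).

(** Exact evaluation: with [x = z / rho] and [n = N+2], each term is the sum of [(x q^j)^m] over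
    [m < n], divided by [1 - x^n], because [q^n = 1]; summation over [j] kills every [m > 0]. *)
Lemma avg_const1 (rho : R) N (z : C) : 0 < rho -> nm z < rho ->
  avg rho N (fun u => u / (u - z)) = (1 - (z / rho%:C%C) ^+ N.+2)^-1.
Proof.
move=> r0 hz; pose x := z / rho%:C%C.
have rn0 : rho%:C%C != 0 by rewrite -nm_gt0 nm_real gtr0_norm.
have hx : nm x < 1.
  by rewrite nmM nmV nm_real gtr0_norm // ltr_pdivrMr // mul1r.
pose q := (unity N)^-1.
have qN : q ^+ N.+2 = 1 by rewrite exprVn unityXN invr1.
have q0 : q != 0 by rewrite invr_neq0 // unity_neq0.
have nq j : nm (q ^+ j) = 1 by rewrite nmX nmV nm_rotnum invr1 expr1n.
have D : 1 - x ^+ N.+2 != 0.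
  rewrite subr_eq0; apply: contraTneq (hx) => h.
  have : nm x ^+ N.+2 = 1 by rewrite -nmX -h nm1.
  by move/eqP; rewrite pexprn_eq1 ?nm_ge0 //= => /eqP ->; rewrite ltxx.
have term j : rho%:C%C * unity N ^+ j / (rho%:C%C * unity N ^+ j - z) =
   (\sum_(m < N.+2) (x * q ^+ j) ^+ m) / (1 - x ^+ N.+2).
  have y1 : 1 - x * q ^+ j != 0.
    rewrite subr_eq0; apply: contraTneq (hx) => h.
    by have := congr1 nm h; rewrite nm1 nmM nq mulr1 => <-; rewrite ltxx.
  have un : unity N ^+ j != 0 by rewrite expf_neq0 // unity_neq0.
  have -> : rho%:C%C * unity N ^+ j - z = rho%:C%C * unity N ^+ j * (1 - x * q ^+ j).
    by rewrite /x /q exprVn; field; rewrite un rn0.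
  have -> : 1 - x ^+ N.+2 = (1 - x * q ^+ j) * \sum_(m < N.+2) (x * q ^+ j) ^+ m.
    have := subrX1 (x * q ^+ j) N.+2.
    rewrite exprMn -exprM mulnC exprM qN expr1n mulr1 => h.
    by rewrite -opprB h; ring.
  have s0 : \sum_(m < N.+2) (x * q ^+ j) ^+ m != 0.
    have := subrX1 (x * q ^+ j) N.+2.
    rewrite exprMn -exprM mulnC exprM qN expr1n mulr1 => h.
    apply: contraNneq D => h0; by rewrite -opprB h h0 mulr0 oppr0.
  by field; rewrite un rn0 y1 s0.
have S : \sum_(j < N.+2) \sum_(m < N.+2) (x * q ^+ j) ^+ m = N.+2%:R.
  rewrite exchange_big big_ord_recl /= [X in _ + X]big1 => [|i _].
    under eq_bigr do rewrite expr0.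
    by rewrite sumr_const card_ord addr0.
  under eq_bigr do rewrite exprMn -exprM mulnC exprM.
  rewrite -mulr_sumr.
  have w1 : q ^+ bump 0 i - 1 != 0.
    rewrite subr_eq0 exprVn invr_eq1 unityX_neq1 //=.
    by rewrite /bump /= add1n ltnS ltn_ord.
  suff -> : \sum_(j < N.+2) (q ^+ bump 0 i) ^+ j = 0 by rewrite mulr0.
  by apply: (mulfI w1); rewrite mulr0 -subrX1 -exprM mulnC exprM qN expr1n subrr.
rewrite /avg; under eq_bigr do rewrite term.
by rewrite -mulr_suml S mulrA mulVf ?pnatr_eq0 // mul1r.
Qed.

End Rotations.

(** * Cauchy's formula for a function with continuous derivative *)

Section CauchyFormula.
Context {R : realType}.
Local Notation C := (R[i]).
Implicit Types (f g : C -> C) (z w l m c : C).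

Definition ccont f z := forall e : R, 0 < e ->
  exists2 d : R, 0 < d & forall w, nm (w - z) < d -> nm (f w - f z) <= e.

Lemma unif_cont g (r rho : R) : (forall z, nm z < r -> ccont g z) -> rho < r ->
  forall e : R, 0 < e -> exists2 d : R, 0 < d &
    forall z w, nm z <= rho -> nm w <= rho -> nm (w - z) < d -> nm (g w - g z) <= e.
Proof.
move=> gc rr e e0; apply: contrapT => /forall2NP H.
have {}H n : exists zw : C * C, [/\ nm zw.1 <= rho, nm zw.2 <= rho,
    nm (zw.2 - zw.1) < n.+1%:R^-1 & e < nm (g zw.2 - g zw.1)].
  have [|/existsNP [z /existsNP [w]]] := H n.+1%:R^-1; first by rewrite invr_gt0 ltr0n.
  move=> /not_implyP [h1 /not_implyP [h2 /not_implyP [h3 h4]]].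
  by exists (z, w); split => //=; rewrite ltNge; apply/negP.
have [u Hu] := choice H.
have up : is_ulim (fun n => (u n).1) (ulim (fun n => (u n).1)).
  by apply: (@ulimP _ _ rho) => n; case: (Hu n).
set p := ulim _ in up.
have pr : nm p < r.
  apply: le_lt_trans rr; rewrite -(subr0 p); apply: (is_ulim_le up).
  by apply: (@ultra_eventually _ 0%N) => n _; rewrite /= subr0; case: (Hu n).
have [|d d0 Hd] := gc p pr (e / 2); first by lra.
have d20 : 0 < d / 2 by lra.
have [n h1 /= h2] := ultra_ex_ge (Num.truncn (d / 2)^-1).+1 (up _ d20).
have [_ _ h3 h4] := Hu n.
have h5 : n.+1%:R^-1 < d / 2.
  rewrite -[X in _ < X]invrK ltf_pV2 ?posrE ?invr_gt0 ?ltr0n //.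
  by apply: lt_le_trans (truncnS_gt _) _; rewrite ler_nat ltnW.
have h6 : nm ((u n).1 - p) < d by lra.
have h7 : nm ((u n).2 - p) < d.
  apply: le_lt_trans (nm_tri (u n).1 _ _) _.
  by rewrite [ltRHS]splitr; apply: ltrD h2; exact: lt_trans h3 h5.
have := Hd _ h6; have := Hd _ h7.
have := nm_tri (g p) (g (u n).2) (g (u n).1).
by rewrite (nmBC (g p)); lra.
Qed.

Lemma nm_avg_le (rho B : R) N (b : C -> C) : 0 < rho ->
  (forall u, nm u = rho -> nm (b u) <= B) -> nm (avg rho N b) <= B.
Proof.
move=> r0 hb; rewrite /avg nmM nmV nm_nat ler_pdivrMl ?ltr0n //.
apply: le_trans (nm_sum _ _ _) _.
rewrite [_ * B]mulr_natl -[X in _ *+ X]card_ord -sumr_const.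
apply: ler_sum => j _; apply: hb.
by rewrite nmM nmX nm_rotnum expr1n mulr1 nm_real gtr0_norm.
Qed.

Lemma avgB rho N (b b' : C -> C) : avg rho N (fun u => b u - b' u) = avg rho N b - avg rho N b'.
Proof. by rewrite /avg sumrB mulrBr. Qed.

Lemma avgZ rho N c (b : C -> C) : avg rho N (fun u => c * b u) = c * avg rho N b.
Proof. by rewrite /avg -mulr_sumr mulrCA. Qed.

Lemma eq_avg rho N (b b' : C -> C) : 0 < rho ->
  (forall u, nm u = rho -> b u = b' u) -> avg rho N b = avg rho N b'.
Proof.
move=> r0 E; rewrite /avg; congr (_ * _); apply: eq_bigr => j _; apply: E.
by rewrite nmM nmX nm_rotnum expr1n mulr1 nm_real gtr0_norm.
Qed.

Lemma geo_small (x e : R) : 0 <= x < 1 -> 0 < e -> exists N, forall n, (N <= n)%N -> x ^+ n < e.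
Proof.
move=> /andP [x0 x1] e0.
have /cvgrPdist_lt /(_ _ e0) [N _ H] : (fun n => x ^+ n) @ \oo --> 0.
  by apply: cvg_expr; rewrite ger0_norm.
exists N => n nN; have := H n nN; rewrite sub0r normrN ger0_norm ?exprn_ge0 //.
Qed.

Lemma convex_ball (rho t : R) z w : 0 <= t <= 1 -> nm z <= rho -> nm w <= rho ->
  nm (z + t%:C%C * (w - z)) <= rho.
Proof.
move=> /andP [t0 t1] hz hw.
have -> : z + t%:C%C * (w - z) = (1 - t)%:C%C * z + t%:C%C * w.
  by rewrite rmorphB /= rmorph1; ring.
apply: le_trans (nmD _ _) _; rewrite !nmZ !ger0_norm ?subr_ge0 //; nra.
Qed.

Section Formula.
Variables (f f' : C -> C) (r rho : R) (z0 : C).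
Hypothesis f_diff : forall z, nm z < r -> cdiff f z (f' z).
Hypothesis f'_cont : forall z, nm z < r -> ccont f' z.
Hypothesis rho_gt0 : 0 < rho.
Hypothesis rho_lt : rho < r.
Hypothesis z0_lt : nm z0 < rho.

Lemma first_order_error (d e : R) z w :
  (forall z w, nm z <= rho -> nm w <= rho -> nm (w - z) < d -> nm (f' w - f' z) <= e) ->
  nm z <= rho -> nm w <= rho -> nm (w - z) < d ->
  nm (f w - f z - f' z * (w - z)) <= e * nm (w - z).
Proof.
move=> H hz hw hd; pose g u := f u - (0 + f' z * u).
have -> : f w - f z - f' z * (w - z) = g w - g z by rewrite /g; ring.
apply: (@mean_value_ineq _ g (fun u => f' u - f' z)) => t ht.
  apply: cdiffB; last exact: cdiff_affine.
  by apply: f_diff; apply: le_lt_trans rho_lt; exact: convex_ball.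
have ht' : 0 <= t <= 1 by lra.
apply: H => //; first exact: convex_ball.
rewrite addrC addKr nmZ; apply: le_lt_trans hd; rewrite ler_piMl ?nm_ge0 //.
by rewrite ger0_norm; lra.
Qed.

(** The points [p j] form a closed polygon with steps [t (unity N - 1) ze j], so the average is a
    Riemann sum of [f'] around a loop. The increments of [f] telescope to 0, and dividing the total
    first-order error by [t (unity N - 1)] and by the number of points leaves [e rho]. *)
Lemma homotopy_derivative_small (d e : R) N (t : R) : 0 < e ->
  (forall z w, nm z <= rho -> nm w <= rho -> nm (w - z) < d -> nm (f' w - f' z) <= e) ->
  rho * nm (unity N - 1 : C) < d -> 0 < t < 1 ->
  nm (avg rho N (fun u => u * f' (z0 + t%:C%C * (u - z0)))) <= e * rho.
Proof.
move=> e0 H hN /andP [t0 t1].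
pose ze j : C := rho%:C%C * unity N ^+ j.
pose p j := z0 + t%:C%C * (ze j - z0).
have nze j : nm (ze j) = rho.
  by rewrite /ze nmM nmX nm_rotnum expr1n mulr1 nm_real gtr0_norm.
have pb j : nm (p j) <= rho.
  by apply: convex_ball; [rewrite !ltW | exact: ltW | rewrite nze].
have dp j : p j.+1 - p j = t%:C%C * (unity N - 1) * ze j.
  by rewrite /p /ze exprSr; ring.
pose om : R := nm (unity N - 1 : C).
have om0 : 0 < om by rewrite nm_gt0 subr_eq0 -(expr1 (unity N)) unityX_neq1.
have ndp j : nm (p j.+1 - p j) = t * om * rho.
  by rewrite dp nmM nze nmZ gtr0_norm.
have step j : nm (f (p j.+1) - f (p j) - f' (p j) * (p j.+1 - p j)) <= e * (t * om * rho).
  rewrite -(ndp j); apply: first_order_error H _ _ _ => //.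
  rewrite ndp; apply: le_lt_trans hN; rewrite -/om -mulrA (mulrC rho om).
  by rewrite ler_piMl ?mulr_ge0 ?ltW.
have tel : \sum_(j < N.+2) (f (p j.+1) - f (p j)) = 0.
  rewrite -(big_mkord xpredT (fun j => f (p j.+1) - f (p j))) telescope_sumr //.
  by rewrite /p /ze unityXN expr0 subrr.
have S : nm (\sum_(j < N.+2) f' (p j) * (p j.+1 - p j)) <= N.+2%:R * (e * (t * om * rho)).
  have -> : \sum_(j < N.+2) f' (p j) * (p j.+1 - p j) =
     - \sum_(j < N.+2) (f (p j.+1) - f (p j) - f' (p j) * (p j.+1 - p j)).
    by rewrite [X in - X]sumrB tel sub0r opprK.
  rewrite nmN.
  apply: le_trans (nm_sum _ _ _) _.
  rewrite mulr_natl -[X in _ *+ X]card_ord -sumr_const.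
  by apply: ler_sum => j _; exact: step.
have E : \sum_(j < N.+2) f' (p j) * (p j.+1 - p j) =
   t%:C%C * (unity N - 1) * \sum_(j < N.+2) ze j * f' (p j).
  by rewrite mulr_sumr; apply: eq_bigr => j _; rewrite dp; ring.
rewrite E nmM nmZ gtr0_norm // -/om in S.
have to0 : 0 < t * om by rewrite mulr_gt0.
rewrite /avg nmM nmV nm_nat ler_pdivrMl ?ltr0n //.
rewrite -(ler_pM2l to0); apply: le_trans S _; rewrite le_eqVlt; apply/orP; left; apply/eqP; ring.
Qed.

(** The circle is contracted to [z0]: [I 1] is the Cauchy average, [I 0] is known from [avg_const1],
    and the derivative of [I] is small. The kernel [u / (u - z0)] cancels the inner derivative
    [u - z0], leaving the average of [homotopy_derivative_small]. *)
Lemma cauchy_formula :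
  is_ulim (fun N => avg rho N (fun u => f u * (u / (u - z0)))) (f z0).
Proof.
have un0 u : nm u = rho -> u - z0 != 0.
  move=> hu; rewrite subr_eq0; apply: contraTneq z0_lt => <-; by rewrite hu ltxx.
apply: is_ulim_cvg => e e0.
have fz0 := nm_ge0 (f z0).
pose e1 := e / (3 * rho).
have e10 : 0 < e1 by rewrite divr_gt0 // mulr_gt0.
have [d d0 H] := unif_cont f'_cont rho_lt e10.
have dr0 : 0 < d / rho by rewrite divr_gt0.
have [N1 HN1] := unity_to1 dr0.
pose x := nm (z0 / rho%:C%C).
have hx : 0 <= x < 1.
  by rewrite /x nm_ge0 /= nmM nmV nm_real gtr0_norm // ltr_pdivrMr // mul1r.
(* [1/2] keeps [1 - y] away from 0; the second bound makes the defect of [I 0] at most [e / 3]. *)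
pose e2 := Num.min (1 / 2) (e / (6 * (nm (f z0) + 1))).
have e20 : 0 < e2 by rewrite lt_min divr_gt0 ?divr_gt0 //; lra.
have [N2 HN2] := geo_small hx e20.
exists (maxn N1 N2) => N; rewrite geq_max => /andP [n1 n2].
have hN : rho * nm (unity N - 1 : C) < d.
  by rewrite mulrC -ltr_pdivlMr //; exact: HN1.
pose I (s : C) := avg rho N (fun u => u / (u - z0) * f (z0 + s * (u - z0))).
pose I' (s : C) := avg rho N (fun u => u * f' (z0 + s * (u - z0))).
have dI (t : R) : 0 <= t <= 1 -> cdiff I (0 + t%:C%C * (1 - 0)) (I' (0 + t%:C%C * (1 - 0))).
  move=> ht; rewrite subr0 mulr1 add0r /I /I' /avg.
  apply: cdiffZ.
  pose ze j : C := rho%:C%C * unity N ^+ j.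
  apply: (@cdiff_sum _ N.+2 (fun j s => ze j / (ze j - z0) * f (z0 + s * (ze j - z0)))
     t%:C%C (fun j => ze j * f' (z0 + t%:C%C * (ze j - z0)))) => j _.
  have nze : nm (ze j) = rho.
    by rewrite /ze nmM nmX nm_rotnum expr1n mulr1 nm_real gtr0_norm.
  have -> : ze j * f' (z0 + t%:C%C * (ze j - z0)) =
    ze j / (ze j - z0) * (f' (z0 + t%:C%C * (ze j - z0)) * (ze j - z0)).
    by field; rewrite un0.
  apply: cdiffZ; apply: (cdiff_comp (f := fun s => z0 + s * (ze j - z0))).
    by apply: cdiff_ext ltr01 _ (cdiff_affine z0 (ze j - z0) t%:C%C) => w _; rewrite mulrC.
  apply: f_diff; apply: le_lt_trans rho_lt; apply: convex_ball => //; rewrite ?nze //; exact: ltW.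
have hI : nm (I 1 - I 0) <= e1 * rho * nm (1 - 0 : C).
  apply: (mean_value_ineq dI) => t ht; rewrite subr0 mulr1 add0r.
  exact: homotopy_derivative_small e10 H hN ht.
rewrite subr0 nm1 mulr1 in hI.
have -> : avg rho N (fun u => f u * (u / (u - z0))) = I 1.
  apply: eq_avg => // u _; have -> : z0 + 1 * (u - z0) = u by ring.
  exact: mulrC.
have I0 : I 0 = f z0 * (1 - (z0 / rho%:C%C) ^+ N.+2)^-1.
  rewrite -(avg_const1 N rho_gt0 z0_lt) -avgZ.
  by apply: eq_avg => // u _; rewrite mul0r addr0 mulrC.
have yN : nm ((z0 / rho%:C%C) ^+ N.+2) < e2 by rewrite nmX; apply: HN2; rewrite (leq_trans n2) // ltnW // ltnW.
set y := (z0 / rho%:C%C) ^+ N.+2 in yN I0.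
clearbody y.
have [y1 y2] : nm y < 1 / 2 /\ nm y < e / (6 * (nm (f z0) + 1)).
  by move: yN; rewrite lt_min => /andP [].
have y3 : 1 / 2 <= nm (1 - y) by have := nmB_ge 1 y; rewrite nm1; lra.
have y10 : 1 - y != 0 by rewrite -nm_gt0; lra.
have h0 : nm (I 0 - f z0) <= e / 3.
  have -> : I 0 - f z0 = f z0 * (y / (1 - y)) by rewrite I0; field.
  rewrite !nmM nmV.
  have h : nm y / nm (1 - y) <= 2 * nm y.
    rewrite ler_pdivrMr; last by lra.
    by have := nm_ge0 y; nra.
  apply: le_trans (ler_wpM2l fz0 h) _.
  move: y2; rewrite ltr_pdivlMr; last by lra.
  by have := nm_ge0 y; nra.
have e1r : e1 * rho = e / 3 by rewrite /e1; field; rewrite gt_eqF.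
apply: le_lt_trans (nm_tri (I 0) _ _) _; lra.
Qed.

End Formula.
End CauchyFormula.

(** * Cauchy transforms and Taylor estimates *)

Section CauchyTransform.
Context {R : realType}.
Local Notation C := (R[i]).
Implicit Types (f g : C -> C) (z w l m c : C).

Lemma kernel_le (rho : R) u z : 0 < rho -> nm u = rho -> nm z <= rho / 2 ->
  u - z != 0 /\ nm (u - z)^-1 <= 2 / rho.
Proof.
move=> r0 hu hz; have h : rho / 2 <= nm (u - z) by have := nmB_ge u z; lra.
split; first by rewrite -nm_gt0; lra.
by rewrite nmV -[2 / rho]invrK invf_div lef_pV2 // posrE; lra.
Qed.

(** To be read with [a = 1/(u-z)], [b = 1/(u-w)] and [d = w - z]: the last hypothesis is the
    resolvent identity. The constant survives the induction because [k^2 + (k+1) <= (k+1)^2]. *)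
Lemma kernel_taylor (a b d : C) (K : R) k : 0 <= K -> nm a <= K -> nm b <= K ->
  b = a + d * (b * a) ->
  nm (b ^+ k - a ^+ k - k%:R * a ^+ k.+1 * d) <= k%:R ^+ 2 * K ^+ k.+2 * nm d ^+ 2.
Proof.
move=> K0 ha hb hab; elim: k => [|k IH].
  by rewrite !expr0 subrr mul0r mul0r subrr nm0 expr2 !mul0r.
have -> : b ^+ k.+1 - a ^+ k.+1 - k.+1%:R * a ^+ k.+2 * d =
   b * (b ^+ k - a ^+ k - k%:R * a ^+ k.+1 * d) + k.+1%:R * (d ^+ 2 * (b * a ^+ k.+2)).
  apply: subr0_eq; transitivity (a ^+ k * ((b - a - d * (b * a)) * (1 + k.+1%:R * a * d))).
    by rewrite -natr1 !exprS; ring.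
  by rewrite {1}hab [X in X - _]addrC addKr subrr mul0r mulr0.
apply: le_trans (nmD _ _) _; rewrite (nmM b) (nmM k.+1%:R) nm_nat (nmM (d ^+ 2)) nmX (nmM b) nmX.
have h1 : nm b * nm (b ^+ k - a ^+ k - k%:R * a ^+ k.+1 * d) <=
   K * (k%:R ^+ 2 * K ^+ k.+2 * nm d ^+ 2).
  by apply: ler_pM => //; exact: nm_ge0.
have h2 : nm b * nm a ^+ k.+2 <= K * K ^+ k.+2.
  by apply: ler_pM => //; rewrite ?exprn_ge0 ?nm_ge0 // lerXn2r ?nnegrE ?nm_ge0.
have d0 := exprn_ge0 2 (nm_ge0 d).
have h3 : k.+1%:R * (nm d ^+ 2 * (nm b * nm a ^+ k.+2)) <= k.+1%:R * (nm d ^+ 2 * (K * K ^+ k.+2)).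
  by rewrite ler_wpM2l ?ler0n // ler_wpM2l.
apply: le_trans (lerD h1 h3) _.
have -> : K * (k%:R ^+ 2 * K ^+ k.+2 * nm d ^+ 2) + k.+1%:R * (nm d ^+ 2 * (K * K ^+ k.+2))
  = (k%:R ^+ 2 + k.+1%:R) * (K ^+ k.+3 * nm d ^+ 2) by rewrite [K ^+ k.+3]exprS; ring.
have q0 : 0 <= K ^+ k.+3 * nm d ^+ 2 by apply: mulr_ge0 => //; exact: exprn_ge0.
rewrite -[k.+1%:R ^+ 2 * _ * _]mulrA; apply: (ler_wpM2r q0).
by rewrite -natr1; have := ler0n R k; nra.
Qed.

(** Cauchy transform with kernel [(u - z)^-k]. For [k = 1] the density [f u * u] reproduces [f], the
    factor [u] coming from [du = i u dtheta]. *)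
Definition ctr (rho : R) (b : nat -> C -> C) k z : C :=
  ulim (fun N => avg rho N (fun u => b N u * (u - z)^-1 ^+ k)).

Section Transform.
Variables (rho B : R) (b : nat -> C -> C).
Hypothesis rho_gt0 : 0 < rho.
Hypothesis b_le : forall N u, nm u = rho -> nm (b N u) <= B.

Lemma b_bound_ge0 : 0 <= B.
Proof.
by apply: le_trans (b_le 0%N (u := rho%:C%C) _); rewrite ?nm_ge0 // nm_real gtr0_norm.
Qed.

Lemma avg_ctr_le k z N : nm z <= rho / 2 ->
  nm (avg rho N (fun u => b N u * (u - z)^-1 ^+ k)) <= B * (2 / rho) ^+ k.
Proof.
move=> hz; apply: nm_avg_le => // u hu; have [_ h] := kernel_le rho_gt0 hu hz.
rewrite nmM nmX; apply: ler_pM; rewrite ?nm_ge0 ?exprn_ge0 ?nm_ge0 ?b_le // lerXn2r // nnegrE ?nm_ge0 //.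
by rewrite divr_ge0 // ltW.
Qed.

Lemma ctr_ulim k z : nm z <= rho / 2 ->
  is_ulim (fun N => avg rho N (fun u => b N u * (u - z)^-1 ^+ k)) (ctr rho b k z).
Proof. by move=> hz; apply: ulimP => N; exact: avg_ctr_le. Qed.

Lemma ctr_le k z : nm z <= rho / 2 -> nm (ctr rho b k z) <= B * (2 / rho) ^+ k.
Proof.
move=> hz; rewrite -[ctr _ _ _ _]subr0; apply: (is_ulim_le (ctr_ulim k hz)).
by apply: (@ultra_eventually _ 0%N) => N _; rewrite /= subr0; exact: avg_ctr_le.
Qed.

(** The kernel estimate is uniform on the circle, hence passes to averages and then to the
    ultralimit. *)
Lemma ctr_taylor k z w : nm z <= rho / 2 -> nm w <= rho / 2 ->
  nm (ctr rho b k w - ctr rho b k z - k%:R * ctr rho b k.+1 z * (w - z)) <=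
  B * (k%:R ^+ 2 * (2 / rho) ^+ k.+2) * nm (w - z) ^+ 2.
Proof.
move=> hz hw; rewrite -[X in nm X]subr0.
have U := is_ulimB (is_ulimB (ctr_ulim k hw) (ctr_ulim k hz))
  (is_ulimZ (k%:R * (w - z)) (ctr_ulim k.+1 hz)).
rewrite -[_ * ctr _ _ _ _ * _]mulrAC; apply: (is_ulim_le U).
apply: (@ultra_eventually _ 0%N) => N _; rewrite /= subr0 -avgZ -!avgB.
apply: nm_avg_le => // u hu.
have [uz hkz] := kernel_le rho_gt0 hu hz; have [uw hkw] := kernel_le rho_gt0 hu hw.
have K0 : 0 <= 2 / rho by rewrite divr_ge0 // ltW.
have E : (u - w)^-1 = (u - z)^-1 + (w - z) * ((u - w)^-1 * (u - z)^-1) by field; rewrite uz uw.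
have := kernel_taylor k K0 hkz hkw E.
set x := (_ - _ - _ * _) => hx.
rewrite [X in nm X](_ : _ = b N u * x); last by rewrite /x; ring.
rewrite nmM -mulrA; apply: ler_pM => //; rewrite ?nm_ge0 //; exact: b_le.
Qed.

Lemma taylor_cdiff f z l (c s : R) : 0 < s -> 0 <= c ->
  (forall w, nm (w - z) < s -> nm (f w - f z - l * (w - z)) <= c * nm (w - z) ^+ 2) ->
  cdiff f z l.
Proof.
move=> s0 c0 H e e0; exists (Num.min s (e / (c + 1))).
  by rewrite lt_min s0 divr_gt0 //; lra.
move=> w; rewrite lt_min => /andP [/H h]; rewrite ltr_pdivlMr; last by lra.
move=> h2; apply: le_trans h _; rewrite expr2 mulrA ler_wpM2r ?nm_ge0 //.
by have := nm_ge0 (w - z); nra.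
Qed.

Lemma ctr_cdiff k z : nm z < rho / 2 ->
  cdiff (ctr rho b k) z (k%:R * ctr rho b k.+1 z).
Proof.
move=> hz; apply: (@taylor_cdiff _ _ _ (B * (k%:R ^+ 2 * (2 / rho) ^+ k.+2)) (rho / 2 - nm z)).
- by rewrite subr_gt0.
- apply: mulr_ge0; first exact: b_bound_ge0.
  by apply: mulr_ge0; apply: exprn_ge0; rewrite ?ler0n // divr_ge0 // ltW.
- move=> w hw; apply: ctr_taylor; first exact: ltW.
  by have := nmB_ge w z; lra.
Qed.

Lemma ctr1_cdiff z : nm z < rho / 2 -> cdiff (ctr rho b 1) z (ctr rho b 2 z).
Proof. by move=> hz; have := ctr_cdiff 1 hz; rewrite mul1r. Qed.

End Transform.

Lemma hol_rep_C1 f f' (r rho : R) z : (forall z, nm z < r -> cdiff f z (f' z)) ->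
  (forall z, nm z < r -> ccont f' z) -> 0 < rho -> rho < r -> nm z < rho ->
  f z = ctr rho (fun _ u => f u * u) 1 z.
Proof.
move=> fd fc r0 rr hz; rewrite /ctr; symmetry; apply: is_ulimE.
apply: is_ulim_ext (cauchy_formula fd fc r0 rr hz) => N.
by apply: eq_avg => // u _; rewrite expr1 mulrA.
Qed.

(* A primitive [F] of [f] has a continuous derivative, so Cauchy's formula holds for [F];
   differentiating it twice gives [f'] *)
Lemma hol_C1 f (r rho : R) : hol r f -> 0 < rho -> rho < r ->
  exists2 f' : C -> C, (forall z, nm z < rho / 2 -> cdiff f z (f' z)) &
     (forall z, nm z < rho / 2 -> ccont f' z).
Proof.
move=> fh r0 rr; have [F HF] := primitive (lt_trans r0 rr) fh.
have Fh : hol r F by move=> z /HF; exists (f z).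
have [B B0 HB] := hol_bounded Fh rr.
have bB (N : nat) (u : C) : nm u = rho -> nm (F u * u) <= B * rho.
  by move=> hu; rewrite nmM hu ler_wpM2r ?(ltW r0) // HB // hu.
pose b (N : nat) u := F u * u.
have fE z : nm z < rho / 2 -> f z = ctr rho b 2 z.
  move=> hz; have zr : nm z < rho by have := nm_ge0 z; lra.
  apply: (@cdiff_unique _ F z); first by apply: HF; exact: lt_trans rr.
  have d0 : 0 < rho - nm z by rewrite subr_gt0.
  apply: cdiff_ext d0 _ _; last by apply: (ctr1_cdiff r0 bB).
  move=> w hw; symmetry; apply: (hol_rep_C1 HF) => //.
    by move=> y /fh [l /cdiff_cont].
  by have := nmB_ge w z; lra.
exists (fun z => 2 * ctr rho b 3 z) => z hz; last first.
  by move=> e e0; apply: cdiff_cont e0; apply: cdiffZ; exact: (ctr_cdiff r0 bB).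
have d0 : 0 < rho / 2 - nm z by rewrite subr_gt0.
apply: cdiff_ext d0 _ (ctr_cdiff r0 bB 2 hz) => w hw; symmetry; apply: fE.
by have := nmB_ge w z; lra.
Qed.

(** The restriction [rho < r / 2] comes from [hol_C1], which controls the derivative on half a
    radius only; [rho + r / 2] is below [r] and its half exceeds [rho]. *)
Lemma hol_rep f (r rho : R) z : hol r f -> 0 < rho -> rho < r / 2 -> nm z < rho ->
  f z = ctr rho (fun _ u => f u * u) 1 z.
Proof.
move=> fh r0 rr hz; have [f' fd fc] := @hol_C1 f r (rho + r / 2) fh ltac:(lra) ltac:(lra).
by apply: (hol_rep_C1 fd fc) => //; lra.
Qed.

(** The constants depend only on the bound [M] on one circle; this uniformity is what lets
    derivatives pass to the ultralimit in [linearization]. *)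
Lemma hol_taylor f (r rho M : R) z w l : hol r f -> 0 < rho -> rho < r / 2 ->
  (forall u, nm u = rho -> nm (f u) <= M) ->
  nm z < rho / 2 -> nm w < rho / 2 -> cdiff f z l ->
  nm (f w - f z - l * (w - z)) <= 8 * M / rho ^+ 2 * nm (w - z) ^+ 2 /\
  nm l <= 4 * M / rho.
Proof.
move=> fh r0 rr fM hz hw hl; have r00 := ltW r0.
have bB (N : nat) (u : C) : nm u = rho -> nm (f u * u) <= M * rho.
  by move=> hu; rewrite nmM hu ler_wpM2r // fM.
pose b (N : nat) u := f u * u.
have E y : nm y < rho -> f y = ctr rho b 1 y by exact: (hol_rep fh).
have lE : l = ctr rho b 2 z.
  apply: (cdiff_unique hl); have d0 : 0 < rho - nm z by lra.
  apply: cdiff_ext d0 _ _; last by apply: (ctr1_cdiff r0 bB).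
  by move=> y hy; symmetry; apply: E; have := nmB_ge y z; lra.
rewrite lE (E z) ?(E w); try lra.
split.
  have := ctr_taylor r0 bB 1 (ltW hz) (ltW hw).
  rewrite mul1r expr1n mul1r.
  suff -> : M * rho * (2 / rho) ^+ 3 = 8 * M / rho ^+ 2 by [].
  by field; rewrite gt_eqF.
have := ctr_le r0 bB 2 (ltW hz).
suff -> : M * rho * (2 / rho) ^+ 2 = 4 * M / rho by [].
by field; rewrite gt_eqF.
Qed.

(** A maximum principle with the loss of a factor 2, which [hol_order] can afford. *)
Lemma hol_le f (r rho M : R) z : hol r f -> 0 < rho -> rho < r / 2 ->
  (forall u, nm u = rho -> nm (f u) <= M) -> nm z < rho / 2 -> nm (f z) <= 2 * M.
Proof.
move=> fh r0 rr fM hz.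
have bB (N : nat) (u : C) : nm u = rho -> nm (f u * u) <= M * rho.
  by move=> hu; rewrite nmM hu ler_wpM2r ?(ltW r0) // fM.
rewrite (hol_rep fh r0 rr); last by lra.
have := ctr_le r0 bB 1 (ltW hz).
suff -> : M * rho * (2 / rho) ^+ 1 = 2 * M by [].
by field; rewrite gt_eqF.
Qed.

Lemma cdiffM f g z l m : cdiff f z l -> cdiff g z m ->
  cdiff (fun w => f w * g w) z (l * g z + f z * m).
Proof.
move=> hf hg e e0.
have G0 := nm_ge0 (g z); have F0 := nm_ge0 (f z); have L0 := nm_ge0 l.
pose a := e / (3 * (nm (g z) + 1)); pose b := e / (3 * (nm (f z) + 1)).
pose c := e / (3 * (nm l + 1)).
have a0 : 0 < a by apply: divr_gt0 => //; lra.
have b0 : 0 < b by apply: divr_gt0 => //; lra.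
have c0 : 0 < c by apply: divr_gt0 => //; lra.
have [d1 d10 H1] := hf _ a0; have [d2 d20 H2] := hg _ b0.
have [d3 d30 H3] := hf _ ltr01; have [d4 d40 H4] := cdiff_cont hg c0.
exists (Num.min (Num.min d1 d2) (Num.min d3 d4)); first by rewrite !lt_min d10 d20 d30.
move=> w; rewrite !lt_min => /andP [/andP [/H1 h1 /H2 h2] /andP [/H3 h3 /H4 h4]].
set x := nm (w - z) in h1 h2 h3; have x0 : 0 <= x := nm_ge0 _.
have -> : f w * g w - f z * g z - (l * g z + f z * m) * (w - z) =
  (f w - f z - l * (w - z)) * g z + f z * (g w - g z - m * (w - z)) + (f w - f z) * (g w - g z) by ring.
apply: le_trans (nmD _ _) _; apply: le_trans (lerD (nmD _ _) (lexx _)) _; rewrite !nmM.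
have k1 : nm (f w - f z - l * (w - z)) * nm (g z) <= e / 3 * x.
  apply: le_trans (ler_wpM2r G0 h1) _.
  have -> : a * x * nm (g z) = (a * nm (g z)) * x by ring.
  apply: ler_wpM2r => //; rewrite /a mulrAC ler_pdivrMr; nra.
have k2 : nm (f z) * nm (g w - g z - m * (w - z)) <= e / 3 * x.
  apply: le_trans (ler_wpM2l F0 h2) _.
  have -> : nm (f z) * (b * x) = (b * nm (f z)) * x by ring.
  apply: ler_wpM2r => //; rewrite /b mulrAC ler_pdivrMr; nra.
have k3 : nm (f w - f z) * nm (g w - g z) <= e / 3 * x.
  have h5 : nm (f w - f z) <= (nm l + 1) * x.
    have -> : f w - f z = (f w - f z - l * (w - z)) + l * (w - z) by ring.
    by apply: le_trans (nmD _ _) _; rewrite nmM -/x; lra.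
  apply: le_trans (ler_pM (nm_ge0 _) (nm_ge0 _) h5 h4) _.
  have -> : (nm l + 1) * x * c = e / 3 * x by rewrite /c; field; rewrite gt_eqF //; lra.
  exact: lexx.
rewrite -/x; lra.
Qed.

Lemma cdiff_inv z : z != 0 -> cdiff (fun w => w^-1) z (- z ^- 2).
Proof.
move=> z0; have nz : 0 < nm z by rewrite nm_gt0.
apply: (@taylor_cdiff _ _ _ (2 / nm z ^+ 3) (nm z / 2)).
- by rewrite divr_gt0.
- by rewrite divr_ge0 // exprn_ge0 // ltW.
move=> w hw; have hw2 : nm z / 2 <= nm w by have := nmB_ge z w; rewrite nmBC in hw; lra.
have w0 : w != 0 by rewrite -nm_gt0; lra.
have -> : w^-1 - z^-1 - - z ^- 2 * (w - z) = (w - z) ^+ 2 * (w^-1 * z ^- 2).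
  by field; rewrite w0 z0.
rewrite (nmM ((w - z) ^+ 2)) nmX mulrC; apply: ler_wpM2r.
  by apply: exprn_ge0; exact: nm_ge0.
rewrite (nmM w^-1) !nmV nmX.
have -> : 2 / nm z ^+ 3 = (nm z / 2)^-1 * (nm z ^+ 2)^-1.
  by field; rewrite gt_eqF.
apply: ler_wpM2r; first by rewrite invr_ge0 exprn_ge0 // ltW.
by rewrite lef_pV2 // posrE; lra.
Qed.

(** Near 0 the quotient is the Cauchy transform of [f] itself, because [u/(u-z) - 1 = z/(u-z)];
    farther out it is [f z / z]. Both agree on the punctured small disc. *)
Lemma hol_div f (r : R) : 0 < r -> hol r f -> f 0 = 0 ->
  exists2 g, hol r g & forall z, nm z < r -> f z = z * g z.
Proof.
move=> r0 fh f0.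
pose rho := r / 4; have rho0 : 0 < rho by rewrite /rho; lra.
have rhor : rho < r / 2 by rewrite /rho; lra.
pose h z := ctr rho (fun _ => f) 1 z.
have [M M0 HM] := @hol_bounded _ f r rho fh ltac:(lra).
have bB (N : nat) (u : C) : nm u = rho -> nm (f u) <= M by move=> hu; rewrite HM // hu.
have bB' (N : nat) (u : C) : nm u = rho -> nm (f u * u) <= M * rho.
  by move=> hu; rewrite nmM hu ler_wpM2r ?(ltW rho0) // HM // hu.
have hE z : nm z < rho / 2 -> f z = z * h z.
  move=> hz.
  have z00 : nm (0 : C) <= rho / 2 by rewrite nm0; lra.
  have U0 := ctr_ulim rho0 bB' 1 z00.
  rewrite -(hol_rep fh rho0 rhor) in U0; last by rewrite nm0.
  have Uz := ctr_ulim rho0 bB' 1 (ltW hz).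
  rewrite -(hol_rep fh rho0 rhor) in Uz; last by lra.
  have Uh := is_ulimZ z (ctr_ulim rho0 bB 1 (ltW hz)).
  have := is_ulimB Uz U0; rewrite f0 subr0 => U.
  apply: is_ulim_unique U _; apply: is_ulim_ext Uh => N /=.
  rewrite -avgZ -avgB; apply: eq_avg => // u hu.
  have [uz _] := kernel_le rho0 hu (ltW hz).
  have u0 : u != 0 by rewrite -nm_gt0 hu.
  by rewrite !expr1 subr0; field; rewrite u0 uz.
pose g z := if nm z < rho / 2 then h z else f z / z.
have gE z : z != 0 -> nm z < r -> g z = f z / z.
  move=> z0 zr; rewrite /g; case: ifP => // zs; rewrite hE //; by field.
exists g => z zr; last first.
  have [->|z0] := eqVneq z 0; first by rewrite f0 mul0r.
  by rewrite gE //; field.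
have [zs|zs] := ltP (nm z) (rho / 2).
  exists (1 * ctr rho (fun _ => f) 2 z).
  have d0 : 0 < rho / 2 - nm z by rewrite subr_gt0.
  apply: cdiff_ext d0 _ (ctr_cdiff rho0 bB 1 zs) => w hw.
  by rewrite /g ifT //; have := nmB_ge w z; lra.
have z0 : z != 0 by rewrite -nm_gt0; lra.
have [l hl] := fh z zr.
exists (l * z^-1 + f z * - z ^- 2).
have nz : 0 < nm z by rewrite nm_gt0.
have d0 : 0 < Num.min (nm z) (r - nm z) by rewrite lt_min nz subr_gt0.
apply: cdiff_ext d0 _ (cdiffM hl (cdiff_inv z0)) => w.
rewrite lt_min => /andP [h1 h2]; rewrite gE //; last by have := nmB_ge w z; lra.
by apply: contraTneq h1 => ->; rewrite sub0r nmN ltxx.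
Qed.

(** If [f = z^n g] for every [n], then [|g| <= M / rho^n] on the circle of radius [rho], whence
    [|f z| <= 2 M / 2^n] when [|z| < rho / 2]. *)
Lemma hol_order f (r : R) : 0 < r -> hol r f ->
  (forall z, nm z < r / 8 -> f z = 0) \/
  exists n g, [/\ hol r g, g 0 != 0 & forall z, nm z < r -> f z = z ^+ n * g z].
Proof.
move=> r0 fh.
pose V n := exists2 g, hol r g & forall z, nm z < r -> f z = z ^+ n * g z.
have [|NV] := pselect (exists n g, [/\ hol r g, g 0 != 0 & forall z, nm z < r -> f z = z ^+ n * g z]); first by right.
left.
have HV n : V n.
  elim: n => [|n [g gh gE]]; first by exists f => // z _; rewrite expr0 mul1r.
  have g0 : g 0 = 0.
    by apply/eqP; apply: contrapT => /negP g0; apply: NV; exists n, g.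
  have [h hh hE] := hol_div r0 gh g0; exists h => // z zr.
  by rewrite gE // hE // exprSr mulrA.
move=> z hz.
pose rho := r / 4; have rho0 : 0 < rho by rewrite /rho; lra.
have rhor : rho < r / 2 by rewrite /rho; lra.
have [M M0 HM] := @hol_bounded _ f r rho fh ltac:(lra).
have b n : nm (f z) <= 2 * M / 2 ^+ n.
  have [g gh gE] := HV n.
  have gM u : nm u = rho -> nm (g u) <= M / rho ^+ n.
    move=> hu; rewrite ler_pdivlMr ?exprn_gt0 // mulrC -hu -nmX -nmM -gE; last by lra.
    by apply: HM; rewrite hu.
  have := hol_le gh rho0 rhor gM (z := z); rewrite gE; last by lra.
  have zs : nm z < rho / 2 by rewrite /rho; lra.
  move/(_ zs) => h; rewrite nmM nmX.
  have h2 : nm z ^+ n <= (rho / 2) ^+ n by rewrite lerXn2r ?nnegrE ?nm_ge0 //; lra.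
  apply: le_trans (ler_pM _ _ h2 h) _; rewrite ?exprn_ge0 ?nm_ge0 //.
  rewrite expr_div_n le_eqVlt; apply/orP; left; apply/eqP.
  by field; rewrite !expf_neq0 // gt_eqF.
apply: nm_small => e e0; have [j hj] := pow2_inv_small (2 * M) e0.
exact: le_trans (b j) hj.
Qed.

Lemma exprB_le (z w : C) (m : R) n : nm z <= m -> nm w <= m ->
  nm (z ^+ n - w ^+ n) <= n%:R * m ^+ n.-1 * nm (z - w).
Proof.
move=> hz hw; have m0 : 0 <= m by apply: le_trans hz; exact: nm_ge0.
case: n => [|n]; first by rewrite !expr0 subrr nm0 mul0r mul0r.
rewrite subrXX nmM mulrC ler_wpM2r ?nm_ge0 //=.
apply: le_trans (nm_sum _ _ _) _.
rewrite mulr_natl -[X in _ *+ X](card_ord n.+1) -sumr_const.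
apply: ler_sum => i _; rewrite nmM !nmX /=.
have -> : m ^+ n = m ^+ (n - i) * m ^+ i by rewrite -exprD subnK // -ltnS.
by apply: ler_pM; rewrite ?exprn_ge0 ?nm_ge0 // lerXn2r ?nnegrE ?nm_ge0.
Qed.

Lemma hol_lipschitz f (r : R) : 0 < r -> hol r f ->
  exists s B : R, [/\ 0 < s, s < r, 0 <= B &
   forall z w, nm z < s -> nm w < s -> nm (f z) <= B /\ nm (f z - f w) <= B * nm (z - w)].
Proof.
move=> r0 fh; pose rho := r / 4; have rho0 : 0 < rho by rewrite /rho; lra.
have rhor : rho < r / 2 by rewrite /rho; lra.
have [M M0 HM] := @hol_bounded _ f r rho fh ltac:(lra).
have fM u : nm u = rho -> nm (f u) <= M by move=> hu; rewrite HM // hu.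
have a0 : 0 <= 4 * M / rho by rewrite divr_ge0 //; lra.
have b0 : 0 <= 8 * M / rho ^+ 2 by rewrite divr_ge0 ?exprn_ge0 //; lra.
exists (rho / 2), (M + 4 * M / rho + 8 * M / rho ^+ 2 * rho); split; try lra.
  by rewrite !addr_ge0 // mulr_ge0 // ltW.
move=> z w hz hw; split.
  have := HM z; have := mulr_ge0 b0 (ltW rho0); lra.
have [|l hl] := fh w; first by lra.
have [h1 h2] := hol_taylor fh rho0 rhor fM hw hz hl.
have -> : f z - f w = (f z - f w - l * (z - w)) + l * (z - w) by ring.
apply: le_trans (nmD _ _) _; rewrite nmM.
have x0 := nm_ge0 (z - w); set x := nm (z - w) in h1 x0 *.
have xr : x <= rho by apply: le_trans (nmB _ _) _; lra.
have h3 : 8 * M / rho ^+ 2 * x ^+ 2 <= 8 * M / rho ^+ 2 * rho * x.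
  by rewrite expr2 mulrA ler_wpM2r // ler_wpM2l.
have h4 := ler_wpM2r x0 h2; have h5 := mulr_ge0 M0 x0.
lra.
Qed.

(* [T z = z + a z^(k+1) + Rem z] where [Rem] is Lipschitz with constant [O(|z|^(k+1))] *)
Definition tangent_form (T : C -> C) (k : nat) (a : C) (r D : R) :=
  forall z w (m : R), nm z <= m -> nm w <= m -> m < r ->
   nm ((T z - z - a * z ^+ k.+1) - (T w - w - a * w ^+ k.+1)) <= D * m ^+ k.+1 * nm (z - w).

(** The order of [T z - z] at 0 is neither 0 nor 1, by the values of [T] and of its derivative
    there. Removing the leading coefficient and dividing once more by [z] leaves a remainder
    [z^(k+2) h z] with [h] Lipschitz. *)
Lemma tangent_to_identity (T : C -> C) (r : R) : 0 < r -> hol r T -> T 0 = 0 -> cdiff T 0 1 ->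
  (forall z, nm z < r / 8 -> T z = z) \/
  exists k a s D, [/\ (0 < k)%N, a != 0, 0 < s, 0 <= D & tangent_form T k a s D].
Proof.
move=> r0 Th T0 T1.
have fh : hol r (fun z => T z - (0 + 1 * z)).
  by move=> z /Th [l hl]; exists (l - 1); apply: cdiffB => //; exact: cdiff_affine.
have [H|[n [g [gh g0 gE]]]] := hol_order r0 fh.
  by left=> z /H /eqP; rewrite subr_eq0 add0r mul1r => /eqP.
right; case: n gE => [|[|k]] gE.
- have := gE 0; rewrite nm0 T0 expr0 mulr0 addr0 subrr mul1r => /(_ r0) /esym/eqP.
  by rewrite (negbTE g0).
- have [l hl] := gh 0 ltac:(by rewrite nm0).
  have d1 : cdiff (fun z => T z - (0 + 1 * z)) 0 (1 - 1) by apply: cdiffB T1 _; exact: cdiff_affine.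
  have d2 : cdiff (fun z => T z - (0 + 1 * z)) 0 (1 * g 0 + 0 * l).
    apply: (cdiff_ext r0) _ (cdiffM (f := fun z => z) (l := 1) _ hl) => [w|].
      by rewrite subr0 => /gE ->; rewrite expr1.
    by apply: cdiff_ext ltr01 _ (cdiff_affine 0 1 0) => w _; rewrite add0r mul1r.
  have := cdiff_unique d1 d2; rewrite subrr mul1r mul0r addr0 => /esym/eqP.
  by rewrite (negbTE g0).
have gh' : hol r (fun z => g z - (g 0 + 0 * z)).
  by move=> z /gh [l hl]; exists (l - 0); apply: cdiffB => //; exact: cdiff_affine.
have [|h hh hE] := hol_div r0 gh'; first by rewrite mul0r addr0 subrr.
have [s [B [s0 sr B0 HB]]] := hol_lipschitz r0 hh.
(* The first term bounds the increments of the power, the second those of [h]; the cap 1 allows the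
   surplus factor [m] to be dropped. *)
exists k.+1, (g 0), (Num.min s 1), (k.+3%:R * B + B); split=> //.
- by rewrite lt_min s0 ltr01.
- by rewrite addr_ge0 // mulr_ge0.
move=> z w m hz hw; rewrite lt_min => /andP [ms m1].
have m0 : 0 <= m by apply: le_trans hz; exact: nm_ge0.
have E y : nm y <= m -> T y - y - g 0 * y ^+ k.+2 = y ^+ k.+3 * h y.
  move=> hy; have yr : nm y < r by lra.
  have := gE y yr; rewrite add0r mul1r => ->.
  have := hE y yr; rewrite mul0r addr0 => e.
  by rewrite [y ^+ k.+3]exprSr -mulrA -e; ring.
rewrite !E //.
have -> : z ^+ k.+3 * h z - w ^+ k.+3 * h w = (z ^+ k.+3 - w ^+ k.+3) * h z + w ^+ k.+3 * (h z - h w) by ring.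
apply: le_trans (nmD _ _) _; rewrite (nmM _ (h z)) (nmM (w ^+ _)) nmX.
have [h1 h2] := HB z w ltac:(lra) ltac:(lra).
have h3 := exprB_le k.+3 hz hw; rewrite /= in h3.
have h4 : nm w ^+ k.+3 <= m ^+ k.+2.
  apply: (@le_trans _ _ (m ^+ k.+3)); first by rewrite lerXn2r ?nnegrE ?nm_ge0.
  by rewrite exprS ler_piMl ?exprn_ge0 // ltW.
have h5 := ler_pM (nm_ge0 _) (nm_ge0 _) h3 h1.
have h6 := ler_pM (exprn_ge0 k.+3 (nm_ge0 w)) (nm_ge0 _) h4 h2.
by lra.
Qed.

End CauchyTransform.

(** * Local inverses and linearization *)

Section Linearization.
Context {R : realType}.
Local Notation C := (R[i]).
Implicit Types (f g : C -> C) (z w l m c : C).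

Lemma near_identity f (r : R) : 0 < r -> hol r f -> cdiff f 0 1 ->
  exists s : R, [/\ 0 < s, s < r,
   forall z w, nm z < s -> nm w < s -> nm (f z - f w - (z - w)) <= nm (z - w) / 2 &
   forall z, nm z < s -> exists2 l, cdiff f z l & 1 / 2 <= nm l].
Proof.
move=> r0 fh f1; have [|//|f' fd fc] := @hol_C1 _ f r (r / 2) fh; try lra.
have n00 : nm (0 : C) < r / 2 / 2 by rewrite nm0; lra.
have f'0 : f' 0 = 1 by apply: cdiff_unique f1; exact: fd.
have [d d0 Hd] := fc 0 n00 (1 / 2) ltac:(lra).
pose s := Num.min d (r / 2 / 2).
have [sd sr] : s <= d /\ s <= r / 2 / 2 by rewrite /s !ge_min !lexx orbT.
have s0 : 0 < s by rewrite lt_min d0; lra.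
have f'1 z : nm z < s -> nm (f' z - 1) <= 1 / 2.
  by move=> hz; rewrite -f'0; apply: Hd; rewrite subr0; lra.
exists s; split=> //; first by lra.
  move=> z w hz hw; pose g u := f u - (0 + 1 * u).
  have -> : f z - f w - (z - w) = g z - g w by rewrite /g; ring.
  rewrite mulrC; apply: (@mean_value_ineq _ g (fun u => f' u - 1)) => t ht.
    apply: cdiffB; last exact: cdiff_affine.
    apply: fd; apply: (@le_lt_trans _ _ (Num.max (nm z) (nm w))).
      by apply: convex_ball => //; rewrite le_max lexx ?orbT.
    by rewrite gt_max; apply/andP; split; lra.
  rewrite -[2^-1]mul1r; apply: f'1; apply: (@le_lt_trans _ _ (Num.max (nm z) (nm w))).
    by apply: convex_ball; rewrite ?le_max ?lexx ?orbT //; lra.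
  by rewrite gt_max hz hw.
move=> z hz; exists (f' z); first by apply: fd; lra.
by have := f'1 z hz; have := nmB_ge 1 (f' z); rewrite nm1 nmBC; lra.
Qed.

(** The map [z + (w - f z)] is a contraction of ratio 1/2; started at 0, its steps are at most
    [|w| / 2^n], so the iterates stay within [2 |w|], inside the disc. *)
Lemma solve_near_identity f (s : R) w : f 0 = 0 ->
  (forall z w, nm z < s -> nm w < s -> nm (f z - f w - (z - w)) <= nm (z - w) / 2) ->
  nm w < s / 4 -> exists2 z, nm z <= 2 * nm w & f z = w.
Proof.
move=> f0 H hw; have w0 := nm_ge0 w.
pose u n := iter n (fun z => z + (w - f z)) 0.
have uS n : u n.+1 = u n + (w - f (u n)) by [].
have p2 n : 0 < 2 ^+ n :> R by rewrite exprn_gt0.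
have B n : nm (u n) <= 2 * nm w - 2 * nm w / 2 ^+ n /\ nm (u n.+1 - u n) <= nm w / 2 ^+ n.
  elim: n => [|n [IH1 IH2]].
    by rewrite uS /= nm0 f0 !expr0 !divr1 subrr add0r !subr0.
  have half : nm w / 2 ^+ n.+1 = nm w / 2 ^+ n / 2.
    by rewrite exprS; field; rewrite gt_eqF.
  have pw : 0 <= nm w / 2 ^+ n by rewrite divr_ge0 // ltW.
  have h1 : nm (u n.+1) <= 2 * nm w - 2 * nm w / 2 ^+ n.+1.
    rewrite -[2 * nm w / 2 ^+ n.+1]mulrA half.
    rewrite -[2 * nm w / 2 ^+ n]mulrA in IH1.
    have := nm_tri (u n) (u n.+1) 0; rewrite !subr0; lra.
  split=> //; rewrite half uS.
  have -> : u n.+1 + (w - f (u n.+1)) - u n.+1 = - (f (u n.+1) - f (u n) - (u n.+1 - u n)).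
    by rewrite uS; ring.
  rewrite nmN; apply: le_trans (H _ _ _ _) _.
  - have : 0 <= 2 * nm w / 2 ^+ n.+1 by rewrite divr_ge0 ?mulr_ge0 // ltW.
    lra.
  - have : 0 <= 2 * nm w / 2 ^+ n by rewrite divr_ge0 ?mulr_ge0 // ltW.
    lra.
  - lra.
have [|p [up pu]] := @geometric_ulim _ u (nm w) w0; first by move=> n; case: (B n).
have p_le : nm p <= 2 * nm w.
  by have := pu 0%N; rewrite /= expr0 divr1 sub0r nmN.
exists p => //; apply: subr0_eq; apply: nm_small => e e0.
have [j hj] := pow2_inv_small (4 * nm w) e0.
have [h1 h2] := B j; have h3 := pu j.
have uj : nm (u j) < s.
  have : 0 <= 2 * nm w / 2 ^+ j by rewrite divr_ge0 ?mulr_ge0 // ltW.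
  lra.
have h4 := H p (u j) ltac:(lra) uj.
have h5 : nm (f p - f (u j)) <= 3 / 2 * nm (u j - p).
  have -> : f p - f (u j) = (f p - f (u j) - (p - u j)) + (p - u j) by ring.
  by apply: le_trans (nmD _ _) _; rewrite (nmBC p) in h4 *; lra.
have h6 : nm (f (u j) - w) <= nm w / 2 ^+ j.
  by rewrite nmBC; move: h2; rewrite uS addrC addKr.
apply: le_trans (nm_tri (f (u j)) _ _) _.
move: h3 hj; rewrite -!mulrA; lra.
Qed.

Lemma local_inverse f (r : R) : 0 < r -> hol r f -> f 0 = 0 -> cdiff f 0 1 ->
  exists (s : R) (h : C -> C), [/\ 0 < s, s < r, hol s h, h 0 = 0 & cdiff h 0 1 /\
    forall w, nm w < s -> [/\ nm (h w) <= 2 * nm w, f (h w) = w & h (f w) = w]].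
Proof.
move=> r0 fh f0 f1; have [s [s0 sr H Hl]] := near_identity r0 fh f1.
pose h w := xget 0 [set z | nm z <= 2 * nm w /\ f z = w].
have hP w : nm w < s / 4 -> nm (h w) <= 2 * nm w /\ f (h w) = w.
  move=> hw; have [z z1 z2] := solve_near_identity f0 H hw.
  by rewrite /h; case: xgetP => [y _ []|/(_ z) []].
have h00 : h 0 = 0.
  by have [|+ _] := hP 0; [rewrite nm0; lra|rewrite nm0 mulr0 => /nm_le0].
have low z w : nm z < s -> nm w < s -> nm (z - w) <= 2 * nm (f z - f w).
  move=> hz hw; have := H z w hz hw; rewrite nmBC => h1.
  by have := nmB_ge (z - w) (f z - f w); lra.
have dh w0 : nm w0 < s / 4 -> forall l, cdiff f (h w0) l -> 1 / 2 <= nm l -> cdiff h w0 l^-1.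
  move=> hw0 l hl ll e e0; have [h1 h2] := hP w0 hw0.
  (* [h] is 2-Lipschitz by [low] and [|l| >= 1/2], which costs a factor 4. *)
  have [d d0 Hd] := hl (e / 4) ltac:(lra).
  exists (Num.min (d / 2) (s / 4 - nm w0)); first by rewrite lt_min !subr_gt0 hw0 andbT; lra.
  move=> w; rewrite lt_min => /andP [k1 k2].
  have hw : nm w < s / 4 by have := nmB_ge w w0; lra.
  have [h3 h4] := hP w hw.
  have L := low (h w) (h w0) ltac:(lra) ltac:(lra); rewrite h4 h2 in L.
  have L2 : nm (h w - h w0) < d by apply: le_lt_trans L _; lra.
  have D := Hd _ L2; rewrite h4 h2 in D.
  have l0 : l != 0 by rewrite -nm_gt0; lra.
  have -> : h w - h w0 - l^-1 * (w - w0) = - (l^-1 * (w - w0 - l * (h w - h w0))) by field.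
  rewrite nmN nmM nmV ler_pdivrMl; last by lra.
  apply: le_trans D _; have x0 := nm_ge0 (w - w0).
  have e40 : 0 <= e / 4 by lra.
  apply: le_trans (ler_wpM2l e40 L) _.
  have := mulr_ge0 (ltW e0) x0; nra.
(* As [|f w| <= 3/2 |w|], this radius keeps [f w] below [s / 4], where [f (h w) = w] is known. *)
exists (s / 8), h; split=> //; try lra.
- move=> w hw; have [|h1 _] := hP w; first by lra.
  have [|l hl ll] := Hl (h w); first by lra.
  by exists l^-1; apply: dh => //; lra.
split; first by rewrite -invr1; apply: dh; rewrite ?nm0 ?nm1 ?h00 //; lra.
move=> w hw; have [|h1 h2] := hP w; first by lra.
split=> //.
have fw : nm (f w) <= 3 / 2 * nm w.
  have := H w 0 ltac:(lra) ltac:(by rewrite nm0); rewrite f0 !subr0.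
  by have := nmB_ge (f w) w; lra.
have [|h3 h4] := hP (f w); first by lra.
have := low (h (f w)) w ltac:(lra) ltac:(lra).
by rewrite h4 subrr nm0 mulr0 => /nm_le0 /subr0_eq.
Qed.

Definition birkhoff f (la : C) N z : C :=
  (N.+1%:R)^-1 * \sum_(n < N.+1) (la^-1 ^+ n * iter n f z).

Section Averaging.
Variables (f : C -> C) (K : set C) (la : C) (r B : R).
Hypothesis r_gt0 : 0 < r.
Hypothesis ball_K : forall z, nm z < r -> K z.
Hypothesis fK : forall z, K z -> K (f z).
Hypothesis K_le : forall z, K z -> nm z <= B.
Hypothesis f_diff : forall z, K z -> exists l, cdiff f z l.
Hypothesis f0 : f 0 = 0.
Hypothesis df0 : cdiff f 0 la.
Hypothesis la1 : nm la = 1.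

Local Notation phi := (birkhoff f la).

Lemma iterK n z : K z -> K (iter n f z).
Proof. by move=> Kz; elim: n => //= n; exact: fK. Qed.

Lemma iter_diff n z : nm z < r -> exists l, cdiff (iter n f) z l.
Proof.
move=> hz; elim: n => [|n [l hl]].
  exists 1; by apply: cdiff_ext ltr01 _ (cdiff_affine 0 1 z) => w _ /=; rewrite add0r mul1r.
have [m hm] := f_diff (iterK n (ball_K hz)).
by exists (m * l); exact: (cdiff_comp hl hm).
Qed.

Lemma iter_diff0 n : cdiff (iter n f) 0 (la ^+ n).
Proof.
elim: n => [|n IH].
  by apply: cdiff_ext ltr01 _ (cdiff_affine 0 1 0) => w _ /=; rewrite add0r mul1r.
have i0 : iter n f 0 = 0 by elim: n {IH} => //= n ->.
by rewrite exprS; apply: (cdiff_comp IH); rewrite i0.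
Qed.

Lemma la_neq0 : la != 0.
Proof. by rewrite -nm_gt0 la1 ltr01. Qed.

Lemma nm_laV n : nm (la^-1 ^+ n) = 1.
Proof. by rewrite nmX nmV la1 invr1 expr1n. Qed.

Lemma phi_le N z : K z -> nm (phi N z) <= B.
Proof.
move=> Kz; rewrite /birkhoff nmM nmV nm_nat ler_pdivrMl ?ltr0n //.
apply: le_trans (nm_sum _ _ _) _.
rewrite mulr_natl -[X in _ *+ X](card_ord N.+1) -sumr_const.
by apply: ler_sum => n _; rewrite nmM nm_laV mul1r; apply: K_le; exact: iterK.
Qed.

Lemma phi_hol N : hol r (phi N).
Proof.
move=> z hz; have /choice [l hl] := fun n => iter_diff n hz.
exists ((N.+1%:R)^-1 * \sum_(n < N.+1) (la^-1 ^+ n * l n)).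
by apply: cdiffZ; apply: (@cdiff_sum _ N.+1 (fun n w => la^-1 ^+ n * iter n f w) z (fun n => la^-1 ^+ n * l n)) => n _; apply: cdiffZ.
Qed.

Lemma phi_diff0 N : cdiff (phi N) 0 1.
Proof.
have -> : 1 = (N.+1%:R)^-1 * \sum_(n < N.+1) (la^-1 ^+ n * la ^+ n) :> C.
  under eq_bigr do rewrite -exprMn mulVf ?la_neq0 // expr1n.
  by rewrite sumr_const card_ord mulVf // pnatr_eq0.
apply: cdiffZ; apply: (@cdiff_sum _ N.+1 (fun n w => la^-1 ^+ n * iter n f w) 0 (fun n => la^-1 ^+ n * la ^+ n)) => n _.
by apply: cdiffZ; exact: iter_diff0.
Qed.

(** The sums for [f z] and [z] differ by an index shift, so only the two end terms remain; on a
    bounded [K] they are negligible after division by [N+1]. *)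
Lemma phi_f N z : phi N (f z) - la * phi N z =
  (N.+1%:R)^-1 * (la * (la^-1 ^+ N.+1 * iter N.+1 f z - z)).
Proof.
rewrite /birkhoff mulrCA -mulrBr; congr (_ * _).
have E : \sum_(n < N.+1) la^-1 ^+ n * iter n f (f z) =
  la * \sum_(n < N.+1) la^-1 ^+ n.+1 * iter n.+1 f z.
  rewrite mulr_sumr; apply: eq_bigr => n _.
  by rewrite -iterSr exprS; field; rewrite la_neq0.
rewrite E -mulrBr -sumrB; congr (_ * _).
rewrite -(big_mkord xpredT (fun n => la^-1 ^+ n.+1 * iter n.+1 f z - la^-1 ^+ n * iter n f z)).
by rewrite telescope_sumr // expr0 mul1r.
Qed.

(** The averages are uniformly bounded on [K], so [hol_taylor] gives them a common second-order
    constant and their ultralimit [Phi] is differentiable, with derivative 1 at 0 and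
    [Phi (f z) = la * Phi z]. The map [h] is its local inverse. *)
Lemma linearization : exists (s : R) (h : C -> C),
  [/\ 0 < s, hol s h, h 0 = 0, cdiff h 0 1 &
      (forall x y, nm x < s -> nm y < s -> h x = h y -> x = y) /\
      (forall w, nm w < s -> f (h w) = h (la * w))].
Proof.
have r0 : 0 < r by exact: r_gt0.
pose Phi z := ulim (fun N => phi N z).
have PhiU z : K z -> is_ulim (fun N => phi N z) (Phi z).
  by move=> Kz; apply: ulimP => N; exact: phi_le.
have B0 : 0 <= B.
  by apply: le_trans (K_le (ball_K (z := 0) _)); rewrite nm0.
pose rho := r / 4; have rho0 : 0 < rho by rewrite /rho; lra.
have rhor : rho < r / 2 by rewrite /rho; lra.
have M N u : nm u = rho -> nm (phi N u) <= B.
  by move=> hu; apply: phi_le; apply: ball_K; rewrite hu /rho; lra.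
have taylor z (l : nat -> C) : nm z < rho / 2 -> (forall N, cdiff (phi N) z (l N)) ->
   cdiff Phi z (ulim l).
  move=> hz hl.
  have lU : is_ulim l (ulim l).
    apply: (@ulimP _ _ (4 * B / rho)) => N.
    by have [_] := hol_taylor (phi_hol N) rho0 rhor (M N) hz hz (hl N).
  apply: (@taylor_cdiff _ _ _ _ (8 * B / rho ^+ 2) (rho / 2 - nm z)).
  - by rewrite subr_gt0.
  - by rewrite divr_ge0 ?mulr_ge0 ?exprn_ge0 // ltW.
  move=> w hw; have hw' : nm w < rho / 2 by have := nmB_ge w z; lra.
  have Kz : K z by apply: ball_K; lra.
  have Kw : K w by apply: ball_K; lra.
  have U := is_ulimB (is_ulimB (PhiU _ Kw) (PhiU _ Kz)) (is_ulimZ (w - z) lU).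
  rewrite -[X in nm X]subr0 mulrC; apply: (is_ulim_le U).
  apply: (@ultra_eventually _ 0%N) => N _; rewrite /= subr0 [_ * l N]mulrC.
  by have [+ _] := hol_taylor (phi_hol N) rho0 rhor (M N) hz hw' (hl N).
have Phi_hol : hol (rho / 2) Phi.
  move=> z hz; have /choice [l hl] := fun N => phi_hol N (z := z) ltac:(lra).
  by exists (ulim l); exact: taylor.
have n00 : nm (0 : C) < rho / 2 by rewrite nm0; lra.
have Phi1 : cdiff Phi 0 1.
  by rewrite -(is_ulimE (is_ulim_cst 1)); apply: taylor => // N; exact: phi_diff0.
have Phi0 : Phi 0 = 0.
  apply: is_ulimE; apply: is_ulim_ext (is_ulim_cst 0) => N.
  rewrite /birkhoff big1 ?mulr0 // => n _.
  have -> : iter n f 0 = 0 by elim: (n : nat) => //= m ->.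
  by rewrite mulr0.
have Phif z : K z -> Phi (f z) = la * Phi z.
  move=> Kz; apply: subr0_eq.
  apply: (is_ulim_unique (is_ulimB (PhiU _ (fK Kz)) (is_ulimZ la (PhiU _ Kz)))).
  apply: is_ulim_cvg => e e0; exists (Num.truncn (2 * B / e)).+1 => N hN.
  rewrite subr0 phi_f nmM nmV nm_nat nmM la1 mul1r ltr_pdivrMl ?ltr0n //.
  have h1 : nm (la^-1 ^+ N.+1 * iter N.+1 f z) <= B.
    by rewrite nmM nm_laV mul1r; apply: K_le; exact: iterK.
  have h2 := K_le Kz; apply: le_lt_trans (nmB _ _) _.
  have h3 : 2 * B / e < N.+1%:R.
    by apply: lt_le_trans (truncnS_gt _) _; rewrite ler_nat ltnW.
  by move: h3; rewrite ltr_pdivrMr //; lra.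
have rho20 : 0 < rho / 2 by lra.
have [s [h [s0 sr hh h0 [dh hP]]]] := local_inverse rho20 Phi_hol Phi0 Phi1.
have [d d0 Hd] := cdiff_cont df0 (e := s / 2) ltac:(lra).
(* Puts [h w] in the disc contained in [K] and [f (h w)] where [h] inverts [Phi], using
   [|h w| <= 2 |w|]. *)
pose s' := Num.min s (Num.min (d / 2) (r / 2)).
have [k1 k2 k3] : [/\ s' <= s, s' <= d / 2 & s' <= r / 2].
  by rewrite /s' !ge_min !lexx !orbT.
have s'0 : 0 < s' by rewrite !lt_min s0; apply/andP; split; lra.
exists s', h; split=> //.
  by move=> z hz; apply: hh; lra.
split=> [x y hx hy|w hw].
  have [_ h1 _] := hP x ltac:(lra); have [_ h2 _] := hP y ltac:(lra).
  by move=> E; rewrite -h1 E h2.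
have [h1 h2 _] := hP w ltac:(lra).
have h3 : nm (f (h w)) < s.
  by have := Hd (h w); rewrite f0 !subr0 => /(_ ltac:(lra)); lra.
have [_ _ <-] := hP _ h3; congr h.
by rewrite Phif ?h2 //; apply: ball_K; lra.
Qed.

End Averaging.
End Linearization.

(** * Rotations and cones *)

Section Rotating.
Context {R : realType}.
Local Notation C := (R[i]).
Implicit Types (z w c u : C).

Lemma small_radius (c e : R) : 0 <= c -> 0 < e ->
  exists2 r : R, 0 < r & forall x : R, 0 <= x -> x < r -> c * x <= e.
Proof.
move=> c0 e0; exists (e / (c + 1)); first by rewrite divr_gt0 //; lra.
move=> x x0; rewrite ltr_pdivlMr; last by lra.
by nra.
Qed.

Lemma geometric_sum_le (mu : C) n : nm mu = 1 -> mu != 1 ->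
  nm (\sum_(j < n) mu ^+ j) <= 2 / nm (mu - 1).
Proof.
move=> m1 mu1; have h : mu - 1 != 0 by rewrite subr_eq0.
rewrite ler_pdivlMr ?nm_gt0 // mulrC -nmM -subrX1.
by apply: le_trans (nmB _ _) _; rewrite nmX m1 expr1n nm1; lra.
Qed.

Lemma Re_sqr z : complex.Re z ^+ 2 = (nm z ^+ 2 + complex.Re (z ^+ 2)) / 2.
Proof. by rewrite nm_sqr; case: z => x y /=; field. Qed.

Lemma Re_sum n (F : nat -> C) : complex.Re (\sum_(j < n) F j) = \sum_(j < n) complex.Re (F j).
Proof.
elim: n => [|n IH]; first by rewrite !big_ord0.
by rewrite !big_ord_recr /= ReD IH.
Qed.

(* If all [x_j = Re (mu^j u)] were below [nm u / 4], summing
   [(x_j + nm u) (nm u / 4 - x_j) >= 0] would contradict [sum x_j^2 ~ M (nm u)^2 / 2]. *)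
Lemma rotation_Re_large (mu : C) : nm mu = 1 -> mu != 1 -> mu ^+ 2 != 1 ->
  exists M : nat, forall u, exists2 j, (j < M)%N & nm u / 4 <= complex.Re (mu ^+ j * u).
Proof.
move=> m1 mu1 mu2.
pose b1 := 2 / nm (mu - 1); pose b2 := 2 / nm (mu ^+ 2 - 1).
(* Combining [S1] to [S4] would give [M / 4 <= 3 b1 / 4 + b2 / 2]. *)
pose M := (Num.truncn (3 * b1 + 2 * b2)).+1.
have MB : 3 * b1 + 2 * b2 < M%:R by exact: truncnS_gt.
exists M => u; apply: contrapT => /forall2NP H.
have {}H j : (j < M)%N -> complex.Re (mu ^+ j * u) < nm u / 4.
  by move=> jM; have [//|/negP] := H j; rewrite -ltNge.
have v0 := nm_ge0 u; set v := nm u in H v0 *.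
have vp : 0 < v.
  rewrite lt_neqAle v0 andbT; apply/eqP => h.
  have := H 0%N isT; rewrite expr0 mul1r -h.
  have /eqP := esym h; rewrite nm_eq0 => /eqP -> /=; lra.
pose x (j : nat) := complex.Re (mu ^+ j * u).
have nx j : nm (mu ^+ j * u) = v by rewrite nmM nmX m1 expr1n mul1r.
have S1 : - (b1 * v) <= \sum_(j < M) x j.
  rewrite -(Re_sum M (fun j => mu ^+ j * u)) -mulr_suml.
  have := Re_le_nm ((\sum_(j < M) mu ^+ j) * u); rewrite nmM -/v.
  have := ler_wpM2r v0 (geometric_sum_le M m1 mu1); rewrite -/b1 ler_norml => h /andP [h2 _].
  by lra.
have S2 : M%:R * v ^+ 2 / 2 - b2 * v ^+ 2 / 2 <= \sum_(j < M) x j ^+ 2.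
  have -> : \sum_(j < M) x j ^+ 2 = M%:R * v ^+ 2 / 2 + complex.Re ((\sum_(j < M) (mu ^+ 2) ^+ j) * u ^+ 2) / 2.
    rewrite mulr_suml (Re_sum M (fun j => (mu ^+ 2) ^+ j * u ^+ 2)) mulr_suml -mulrA mulr_natl -[X in _ *+ X]card_ord -sumr_const -big_split.
    apply: eq_bigr => j _; rewrite /x Re_sqr nx /=.
    have -> : (mu ^+ 2) ^+ j * u ^+ 2 = (mu ^+ j * u) ^+ 2.
      by rewrite -exprM mulnC exprM -exprMn.
    by field.
  have := Re_le_nm ((\sum_(j < M) (mu ^+ 2) ^+ j) * u ^+ 2); rewrite nmM nmX -/v.
  have m21 : nm (mu ^+ 2) = 1 by rewrite nmX m1 expr1n.
  have v2 : 0 <= v ^+ 2 by rewrite exprn_ge0.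
  have := ler_wpM2r v2 (geometric_sum_le M m21 mu2); rewrite -/b2 ler_norml => h /andP [h2 _].
  by lra.
have S3 : \sum_(j < M) ((x j + v) * (v / 4 - x j)) =
   M%:R * v ^+ 2 / 4 - 3 / 4 * v * \sum_(j < M) x j - \sum_(j < M) x j ^+ 2.
  rewrite (eq_bigr (fun j : 'I_M => v ^+ 2 / 4 - 3 / 4 * v * x j - x j ^+ 2)); last first.
    by move=> j _; field.
  by rewrite !sumrB sumr_const card_ord -mulr_sumr -mulr_natl; field.
have S4 : 0 <= \sum_(j < M) ((x j + v) * (v / 4 - x j)).
  apply: sumr_ge0 => j _; apply: mulr_ge0.
    by have := Re_le_nm (mu ^+ j * u); rewrite nx ler_norml -/(x j) => /andP [h _]; lra.
  by have := H j (ltn_ord j); rewrite -/(x j); lra.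
rewrite S3 in S4.
have S5 : 3 / 4 * v * - (b1 * v) <= 3 / 4 * v * \sum_(j < M) x j by rewrite ler_wpM2l //; lra.
have S6 : (3 * b1 + 2 * b2) * v ^+ 2 < M%:R * v ^+ 2 by rewrite ltr_pM2r // exprn_gt0.
by nra.
Qed.

(** Two distinct powers close to the same ultralimit have a quotient close to 1. *)
Lemma rotation_near_1 (mu : C) (e : R) : nm mu = 1 -> 0 < e ->
  exists2 n, (0 < n)%N & nm (mu ^+ n - 1) < e.
Proof.
move=> m1 e0; have e20 : 0 < e / 2 by lra.
have U : is_ulim (fun n => mu ^+ n) (ulim (fun n => mu ^+ n)).
  by apply: (@ulimP _ _ 1) => n; rewrite nmX m1 expr1n.
have [i _ hi] := ultra_ex_ge 0 (U _ e20).
have [j ij hj] := ultra_ex_ge i.+1 (U _ e20).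
exists (j - i)%N; first by rewrite subn_gt0.
have -> : nm (mu ^+ (j - i) - 1) = nm (mu ^+ j - mu ^+ i).
  have -> : mu ^+ j - mu ^+ i = mu ^+ i * (mu ^+ (j - i) - 1).
    by rewrite mulrBr mulr1 -exprD subnKC // ltnW.
  by rewrite nmM nmX m1 expr1n mul1r.
apply: le_lt_trans (nm_tri (ulim (fun n => mu ^+ n)) _ _) _.
by rewrite [ltRHS]splitr; apply: ltrD => //; rewrite nmBC.
Qed.

Lemma binomial_error (y : C) n : nm y <= 1 ->
  nm ((1 + y) ^+ n - 1 - n%:R * y) <= 4 ^+ n * nm y ^+ 2.
Proof.
move=> hy; have y0 := nm_ge0 y; elim: n => [|n IH].
  by rewrite !expr0 subrr mul0r subrr nm0 mul1r exprn_ge0.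
have -> : (1 + y) ^+ n.+1 - 1 - n.+1%:R * y =
  (1 + y) * ((1 + y) ^+ n - 1 - n%:R * y) + n%:R * (y ^+ 2).
  by rewrite exprS -natr1; ring.
apply: le_trans (nmD _ _) _; rewrite (nmM (1 + y)) (nmM n%:R) nm_nat nmX.
have h1 : nm (1 + y) <= 2 by have := nmD 1 y; rewrite nm1; lra.
have h2 := ler_pM (nm_ge0 _) (nm_ge0 _) h1 IH.
have h3 : n%:R <= 4 ^+ n :> R by rewrite -natrX ler_nat ltnW // ltn_expl.
have y2 : 0 <= nm y ^+ 2 by rewrite exprn_ge0.
have h4 := ler_wpM2r y2 h3.
have h5 : 0 <= 4 ^+ n * nm y ^+ 2 by rewrite mulr_ge0 // exprn_ge0.
apply: le_trans (lerD h2 h4) _; rewrite [4 ^+ n.+1]exprS; lra.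
Qed.

Lemma power_increment (x q : C) n : x != 0 -> nm (q - x) <= nm x ->
  nm (q ^+ n.+1 - x ^+ n.+1 - n.+1%:R * (x ^+ n * (q - x))) <=
  4 ^+ n.+1 * (nm x ^+ n.+1 * (nm (q - x) / nm x) ^+ 2).
Proof.
move=> x0 hd; have X0 : 0 < nm x by rewrite nm_gt0.
pose h := (q - x) / x.
have nh : nm h = nm (q - x) / nm x by rewrite nmM nmV.
have h1 : nm h <= 1 by rewrite nh ler_pdivrMr // mul1r.
have hx : x ^+ n.+1 * h = x ^+ n * (q - x) by rewrite exprSr /h; field.
have qE : x * (1 + h) = q by rewrite /h; field.
have -> : q ^+ n.+1 - x ^+ n.+1 - n.+1%:R * (x ^+ n * (q - x)) =
  x ^+ n.+1 * ((1 + h) ^+ n.+1 - 1 - n.+1%:R * h).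
  by rewrite -hx -{1}qE exprMn; ring.
rewrite (nmM (x ^+ _)) nmX -nh [leRHS]mulrCA ler_wpM2l ?exprn_ge0 ?(ltW X0) //.
exact: binomial_error.
Qed.

(** The arithmetic of one step of [forward_error]: [X = |x|], [L = |T x|], [p = |x|^(k+1)],
    [Q = (L / X)^(k+1)], [N = |1 + (k+1) a x^k|], [al = |a|], and [de], [W] are the old and new
    distances. The gain [B (L - X) >= 2 (C1 + C2) p] pays for the loss [(C1 + C2) p (1 + B X)] since
    [B X <= 1]; this fixes [B al = 20 (C1 + C2)]. *)
Lemma error_combine (e p B X Q C1 C2 N de L W al : R) :
  0 <= e -> 0 <= p -> 0 <= B -> 0 <= X -> B * X <= 1 -> 1 <= Q -> 0 <= C1 -> 0 <= C2 ->
  0 <= de -> de <= e * p * (1 + B * X) -> W <= de * (N + C1 * p) -> 0 <= N -> N <= Q + C2 * p ->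
  X + al / 10 * p <= L -> B * al = 20 * (C1 + C2) -> W <= e * (p * Q) * (1 + B * L).
Proof.
move=> e0 p0 B0 X0 BX Q1 C10 C20 de0 hde hW N0 hN hL hB.
pose C3 := C1 + C2; have C30 : 0 <= C3 by exact: addr_ge0.
have C3p : 0 <= C3 * p by exact: mulr_ge0.
have h1 : N + C1 * p <= Q * (1 + C3 * p).
  have h : 1 * (C3 * p) <= Q * (C3 * p) by rewrite ler_wpM2r.
  by rewrite mulrDr mulr1; move: h; rewrite /C3 mul1r mulrDl; clear -hN; lra.
have h2 : (1 + B * X) * (1 + C3 * p) <= 1 + B * L.
  have h3 : B * X * (C3 * p) <= C3 * p by rewrite ler_piMl.
  have h4 := ler_wpM2l B0 hL.
  have h5 : B * (al / 10 * p) = 2 * (C3 * p).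
    by rewrite -/C3 in hB; have -> : B * (al / 10 * p) = B * al / 10 * p by [ring]; rewrite hB; field.
  by move: h3 h4; rewrite mulrDr h5; clear; lra.
have s1 : 0 <= N + C1 * p by rewrite addr_ge0 // mulr_ge0.
apply: le_trans hW _; apply: le_trans (ler_pM de0 s1 hde h1) _.
have -> : e * p * (1 + B * X) * (Q * (1 + C3 * p)) =
  e * (p * Q) * ((1 + B * X) * (1 + C3 * p)) by ring.
apply: ler_wpM2l => //; apply: mulr_ge0 => //; apply: mulr_ge0 => //.
exact: le_trans Q1.
Qed.

Lemma error_le (e e0 p B P : R) : 0 <= e -> e <= e0 / 2 -> 0 <= p -> p <= 1 ->
  0 <= B * P -> B * P <= 1 -> e * p * (1 + B * P) <= e0.
Proof.
move=> h0 h1 p0 p1 b0 b1.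
have h2 : e * p <= e by rewrite ler_piMr.
have h3 : e * p * (1 + B * P) <= e * 2 by apply: ler_pM => //; [exact: mulr_ge0|lra|lra].
lra.
Qed.

Lemma nm_sub_sqr z w : nm (z - w) ^+ 2 = nm z ^+ 2 + nm w ^+ 2 - 2 * complex.Re (z * w^*%C).
Proof. by rewrite !nm_sqr; case: z => a b; case: w => c d /=; ring. Qed.

Lemma nm_conj z : nm z^*%C = nm z.
Proof. by case: z => a b; rewrite /nm /= sqrrN. Qed.

(** A convex cone symmetric under conjugation, hence stable under addition and inversion. The
    constant [1/5] leaves room below the [1/4] of [rotation_Re_large]. *)
Definition cone u := nm u / 5 <= complex.Re u.

Lemma coneD u w : cone u -> cone w -> cone (u + w).
Proof. by rewrite /cone ReD => h1 h2; have := nmD u w; lra. Qed.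

Lemma coneV u : u != 0 -> cone u -> cone u^-1.
Proof.
move=> u0; have n0 : 0 < nm u by rewrite nm_gt0.
have n20 : 0 < nm u ^+ 2 by rewrite exprn_gt0.
rewrite /cone nmV.
have -> : complex.Re u^-1 = complex.Re u / nm u ^+ 2.
  by rewrite nm_sqr; case: (u) => b c.
rewrite ler_pdivlMr // => h; apply: le_trans h.
by rewrite le_eqVlt; apply/orP; left; apply/eqP; field; rewrite gt_eqF.
Qed.

(** The slack suffices because [1/4 - 1/40] exceeds [(1 + 1/40) / 5]. *)
Lemma cone_near (b y w : C) : nm (w - y) <= nm y / 40 ->
  nm b * nm y / 4 <= complex.Re (b * y) -> cone (b * w).
Proof.
move=> hw hy; have h1 := ler_wpM2l (nm_ge0 b) hw.
have h2 : nm b * nm w <= nm b * (nm y + nm y / 40).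
  by rewrite ler_wpM2l ?nm_ge0 //; have := nmB_ge w y; lra.
have h3 : complex.Re (b * y) - nm b * nm (w - y) <= complex.Re (b * w).
  have := Re_le_nm (b * (w - y)); rewrite nmM mulrBr ReD ReN ler_norml.
  by move=> /andP [h _]; lra.
have h4 : 0 <= nm b * nm y by rewrite mulr_ge0 ?nm_ge0.
by rewrite /cone nmM; lra.
Qed.

(** For [v = a x^k] the last hypothesis concerns [a (T x)^k]. In the coordinate [1/v] one step of
    [T] is nearly the translation by [-k]: [1/v = 1/(v w) + ka] with [ka] within [k/2] of [k], and
    the cone is stable under sums and inverses. *)
Lemma cone_back (v rho : C) k : (0 < k)%N -> v != 0 -> nm rho <= 1 / 16 * nm v ->
  (2 * k%:R + 4 ^+ k.+1) * nm v <= 1 / 16 ->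
  cone (v * (1 + (v + rho)) ^+ k) -> cone v.
Proof.
move=> k0 v0 rho16 c0nu.
have k1 : 1 <= k%:R :> R by rewrite ler1n.
pose y := v + rho; rewrite -/y; pose w := (1 + y) ^+ k; rewrite -/w => sT.
set nu := nm v in rho16 c0nu; have nu0 : 0 < nu by rewrite nm_gt0.
have four0 : 0 <= 4 ^+ k.+1 * nu by rewrite mulr_ge0 ?exprn_ge0 // ltW.
have knu0 : 0 <= k%:R * nu by rewrite mulr_ge0 // ltW.
rewrite mulrDl -mulrA in c0nu.
have four : 4 ^+ k.+1 * nu <= 1 / 16 by move: c0nu knu0; clear; lra.
have nu16 : nu <= 1 / 16.
  apply: le_trans four; rewrite ler_peMl ?(ltW nu0) // exprn_ege1 //.
  by clear; lra.
have y2 : nm y <= 2 * nu.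
  by apply: le_trans (nmD _ _) _; rewrite -/nu; move: rho16 nu0; clear; lra.
have y1 : nm y <= 1 by move: y2 nu16; clear; lra.
have E := binomial_error k y1; rewrite -/w in E.
have y2s : 4 ^+ k * nm y ^+ 2 <= 4 ^+ k.+1 * nu * nu.
  have h : nm y ^+ 2 <= (2 * nu) ^+ 2.
    by rewrite lerXn2r ?nnegrE ?nm_ge0 // mulr_ge0 // ltW.
  have h4 : 0 <= 4 ^+ k :> R by rewrite exprn_ge0.
  apply: le_trans (ler_wpM2l h4 h) _.
  have -> : 4 ^+ k.+1 * nu * nu = 4 ^+ k * (2 * nu) ^+ 2 by rewrite exprS; ring.
  by [].
have {}E := le_trans E y2s.
have w1 : nm (w - 1) <= 1 / 16.
  have -> : w - 1 = (w - 1 - k%:R * y) + k%:R * y by ring.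
  apply: le_trans (nmD _ _) _; rewrite (nmM k%:R) nm_nat.
  have h5 : k%:R * nm y <= k%:R * (2 * nu) by rewrite ler_wpM2l.
  have h6 : 4 ^+ k.+1 * nu * nu <= 4 ^+ k.+1 * nu.
    by rewrite ler_piMr //; apply: le_trans nu16 _; clear; lra.
  by move: h5 h6 E c0nu; clear; lra.
have w34 : 3 / 4 <= nm w.
  have := nmB_ge 1 (1 - w); have -> : 1 - (1 - w) = w by ring.
  by rewrite nm1 (nmBC 1 w); move: w1; clear; lra.
have w_gt0 : 0 < nm w by move: w34; clear; lra.
have w0 : w != 0 by rewrite -nm_gt0.
have vw0 : v * w != 0 by rewrite mulf_neq0.
pose ka := (w - 1) / (v * w).
have ka_near : nm (ka - k%:R) <= k%:R / 2.
  have -> : ka - k%:R = ((w - 1 - k%:R * y) + k%:R * rho - k%:R * (v * (w - 1))) / (v * w).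
    by rewrite /ka /y; field; rewrite v0 w0.
  rewrite nmM nmV (nmM v) -/nu ler_pdivrMr ?mulr_gt0 //.
  apply: le_trans (nmB _ _) _; apply: le_trans (lerD (nmD _ _) (lexx _)) _.
  rewrite (nmM _ rho) (nmM _ (v * _)) (nmM v) nm_nat -/nu.
  have h7 : 4 ^+ k.+1 * nu * nu <= 1 / 16 * nu by rewrite ler_wpM2r // ltW.
  have h8 : k%:R * nm rho <= k%:R * (1 / 16 * nu) by rewrite ler_wpM2l.
  have h9 : k%:R * (nu * nm (w - 1)) <= k%:R * (nu * (1 / 16)).
    by rewrite ler_wpM2l // ler_wpM2l // ltW.
  have h10 : k%:R / 2 * (nu * (3 / 4)) <= k%:R / 2 * (nu * nm w).
    by rewrite ler_wpM2l ?divr_ge0 // ler_wpM2l // ltW.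
  have h11 : nu <= k%:R * nu by rewrite ler_peMl // ltW.
  by move: h7 h8 h9 h10 h11 E knu0; clear; lra.
have ka_cone : cone ka.
  rewrite /cone; have h1 := nmB_ge ka k%:R; rewrite nm_nat in h1.
  have := Re_le_nm (ka - k%:R); rewrite ReD ReN ler_norml => /andP [h2 _].
  have h3 : complex.Re (k%:R : C) = k%:R by rewrite -(rmorph_nat (real_complex R)).
  by rewrite h3 in h2; move: h1 h2 ka_near k1; clear; lra.
have vE : v^-1 = (v * w)^-1 + ka by rewrite /ka; field; rewrite v0 w0.
have cv : cone v^-1 by rewrite vE; apply: coneD => //; exact: coneV.
by rewrite -(invrK v); apply: coneV => //; rewrite invr_eq0.
Qed.

End Rotating.

(** * Dynamics near 0 *)

Ltac nonneg := repeat first [ assumption | exact: ler01 | exact: ler0n | exact: nm_ge0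
  | apply: exprn_ge0 | apply: addr_ge0 | apply: mulr_ge0 ].

Section Dynamics.
Context {R : realType}.
Local Notation C := (R[i]).
Implicit Types (z w c u p q x : C).

(** [K] is seen only through its nearest points, the small circles it meets, and invariance under
    [f], [g] and [T]. Nothing is asked of [S] on [K]: it is a right inverse of [T] near 0. The pair
    can therefore be a map and its local inverse in either order. *)
Variables (K : set C) (f g T S : C -> C) (la a : C) (k : nat) (r0 A : R).
Hypothesis K_proximinal : forall p, exists2 q, K q & forall q', K q' -> nm (q - p) <= nm (q' - p).
Hypothesis K_circles : exists2 s : R, 0 < s & forall rho, 0 < rho -> rho < s ->
  exists2 q, K q & nm q = rho.
Hypothesis r0_gt0 : 0 < r0.
Hypothesis r0_le1 : r0 <= 1.
Hypothesis A_ge1 : 1 <= A.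
Hypothesis la_unit : nm la = 1.
Hypothesis la_irr : forall n, (0 < n)%N -> la ^+ n != 1.
Hypothesis f_est : forall z, nm z < r0 -> nm (f z - la * z) <= A * nm z ^+ 2.
Hypothesis g_est : forall z w (m : R), nm z <= m -> nm w <= m -> m < r0 ->
  nm (g z - g w - la^-1 * (z - w)) <= A * m * nm (z - w).
Hypothesis gf : forall z, nm z < r0 -> g (f z) = z.
Hypothesis fK : forall z, K z -> K (f z).
Hypothesis gK : forall z, K z -> K (g z).
Hypothesis k_gt0 : (0 < k)%N.
Hypothesis a_neq0 : a != 0.
Hypothesis T0 : T 0 = 0.
Hypothesis T_form : tangent_form T k a r0 A.
Hypothesis TK : forall z, nm z < r0 -> K z -> K (T z).
Hypothesis TS : forall z, nm z < r0 -> T (S z) = z.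
Hypothesis S_le : forall z, nm z < r0 -> nm (S z) <= 2 * nm z.

(** * Displacements of order [k+1] inside [K] *)

Lemma expr_k_le (X : R) : 0 <= X -> X <= 1 -> X ^+ k <= X.
Proof.
by move=> X0 X1; rewrite -{2}(expr1 X) ler_wiXn2l.
Qed.

Lemma expr_err z w (m : R) n : nm z <= m -> nm w <= m ->
  nm (z ^+ n.+1 - w ^+ n.+1) <= n.+1%:R * m ^+ n * nm (z - w).
Proof. by move=> hz hw; exact: (exprB_le n.+1 hz hw). Qed.

(** A relation on points of [K] rather than a map, so that composition and conjugation need to keep
    track of the leading coefficient alone. *)
Definition moves c := exists r M : R, [/\ 0 < r, 0 <= M & forall z, K z -> nm z < r ->
  exists2 z', K z' & nm (z' - z - c * z ^+ k.+1) <= M * nm z ^+ k.+2].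

Lemma moves_T : moves a.
Proof.
exists r0, A; split=> //; first by apply: le_trans A_ge1.
move=> z Kz hz; exists (T z); first exact: TK.
have := T_form (lexx (nm z)) (_ : nm 0 <= nm z) hz.
rewrite nm0 T0 expr0n /= mulr0 !subr0 => /(_ (nm_ge0 z)).
by rewrite -mulrA -exprSr.
Qed.

Lemma move_size c (M : R) z z' : 0 <= M -> nm z <= 1 -> (nm c + M) * nm z <= 1 ->
  nm (z' - z - c * z ^+ k.+1) <= M * nm z ^+ k.+2 ->
  nm (z' - z) <= (nm c + M) * nm z ^+ k.+1 /\ nm z' <= 2 * nm z.
Proof.
move=> M0 z1 hs H; have x0 := nm_ge0 z; set X := nm z in z1 hs H x0 *.
have c0 := nm_ge0 c.
have p0 : 0 <= X ^+ k.+1 by rewrite exprn_ge0.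
have h1 : nm (z' - z) <= (nm c + M) * X ^+ k.+1.
  have -> : z' - z = (z' - z - c * z ^+ k.+1) + c * z ^+ k.+1 by ring.
  apply: le_trans (nmD _ _) _; rewrite (nmM c) nmX -/X.
  have : M * X ^+ k.+2 <= M * X ^+ k.+1.
    by rewrite ler_wpM2l // exprS ler_piMl.
  lra.
split=> //; have h2 : (nm c + M) * X ^+ k.+1 <= X.
  rewrite exprS mulrA; apply: (@le_trans _ _ (1 * X ^+ k)).
    by rewrite ler_wpM2r // exprn_ge0.
  by rewrite mul1r expr_k_le.
by have := nmB_ge z' z; rewrite -/X; lra.
Qed.

(** Composition adds the leading coefficients: replacing [z] by [z'] in [z^(k+1)] costs order
    [2k+1], at least [k+2]. *)
Lemma moves_add c c' : moves c -> moves c' -> moves (c + c').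
Proof.
move=> [r [M [r_gt0 M0 H]]] [r' [M' [r'_gt0 M'0 H']]].
have cM0 : 0 <= nm c + M by rewrite addr_ge0 // nm_ge0.
have [s s0 hs] := small_radius cM0 ltr01.
pose t := Num.min (Num.min r s) (Num.min (r' / 2) 1).
have t0 : 0 < t by rewrite !lt_min r_gt0 s0 ltr01 andbT; lra.
exists t, (M + M' * 2 ^+ k.+2 + nm c' * (k.+1%:R * 2 ^+ k * (nm c + M))); split=> //.
  by nonneg.
move=> z Kz; rewrite !lt_min => /andP [/andP [zr zs] /andP [zr' z1]].
have [z' Kz' e1] := H z Kz zr.
have [h1 h2] := move_size M0 (ltW z1) (hs _ (nm_ge0 z) zs) e1.
have [z'' Kz'' e2] := H' z' Kz' ltac:(lra).
exists z'' => //.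
have x0 := nm_ge0 z; set X := nm z in zs zr' z1 h1 h2 e1 x0 *.
have -> : z'' - z - (c + c') * z ^+ k.+1 =
  (z' - z - c * z ^+ k.+1) + (z'' - z' - c' * z' ^+ k.+1) + c' * (z' ^+ k.+1 - z ^+ k.+1) by ring.
apply: le_trans (nmD _ _) _; apply: le_trans (lerD (nmD _ _) (lexx _)) _.
rewrite (nmM c').
have k1 : nm (z'' - z' - c' * z' ^+ k.+1) <= M' * 2 ^+ k.+2 * X ^+ k.+2.
  apply: le_trans e2 _; rewrite -mulrA -exprMn ler_wpM2l // lerXn2r ?nnegrE ?nm_ge0 //.
  by rewrite mulr_ge0.
have z2X : nm z <= 2 * X by rewrite -/X; lra.
have k2 : nm (z' ^+ k.+1 - z ^+ k.+1) <= k.+1%:R * 2 ^+ k * (nm c + M) * X ^+ k.+2.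
  apply: le_trans (expr_err k h2 z2X) _.
  have q0 : 0 <= k.+1%:R * (2 * X) ^+ k by nonneg.
  apply: le_trans (ler_wpM2l q0 h1) _.
  have -> : k.+1%:R * (2 * X) ^+ k * ((nm c + M) * X ^+ k.+1) =
    k.+1%:R * 2 ^+ k * (nm c + M) * X ^+ k.+1 * X ^+ k by rewrite exprMn; ring.
  have -> : k.+1%:R * 2 ^+ k * (nm c + M) * X ^+ k.+2 =
    k.+1%:R * 2 ^+ k * (nm c + M) * X ^+ k.+1 * X by rewrite [X ^+ k.+2]exprSr; ring.
  apply: ler_wpM2l; first by nonneg.
  by apply: expr_k_le => //; exact: ltW.
have k3 := ler_wpM2l (nm_ge0 c') k2.
lra.
Qed.

Lemma la_inv_neq0 : la != 0.
Proof. by rewrite -nm_gt0 la_unit ltr01. Qed.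

(** Conjugation by [f]: [la^-1 c (la z)^(k+1) = c la^k z^(k+1)], while the nonlinear parts of [f]
    and [g] enter at order [k+2]. *)
Lemma moves_rot c : moves c -> moves (c * la ^+ k).
Proof.
move=> [r [M [r_gt0 M0 H]]].
have A1 : 1 <= A by exact: A_ge1.
have rr0 : 0 < r0 by exact: r0_gt0.
have A0 : 0 <= A by lra.
have cM0 : 0 <= nm c + M by rewrite addr_ge0 // nm_ge0.
have [s s0 hs] := small_radius cM0 ltr01.
have [s' s'0 hs'] := small_radius A0 ltr01.
pose t := Num.min (Num.min (r / 2) (s / 2)) (Num.min (Num.min s' (1 / 2)) (r0 / 5)).
have t0 : 0 < t by rewrite !lt_min; repeat (apply/andP; split); lra.
exists t, (A * 4 * ((nm c + M) * 2 ^+ k.+1) + M * 2 ^+ k.+2 + nm c * (k.+1%:R * 2 ^+ k * A)).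
split=> //.
  by nonneg.
move=> z Kz; rewrite !lt_min => /andP [/andP [zr zs] /andP [/andP [zs' z1] zr0]].
have x0 := nm_ge0 z; set X := nm z in zs zs' zr z1 zr0 x0 *.
have fz := f_est (z := z) ltac:(rewrite -/X; lra); rewrite -/X in fz.
set w := f z in fz.
have AX := hs' _ x0 zs'.
have AX2 : A * X ^+ 2 <= X by rewrite expr2 mulrA ler_piMl.
have laz : nm (la * z) = X by rewrite nmM la_unit mul1r.
have w2 : nm w <= 2 * X by have := nmB_ge w (la * z); rewrite laz; lra.
have [w' Kw' e1] := H w (fK Kz) ltac:(lra).
have ws := hs _ (nm_ge0 w) ltac:(lra).
have w1 : nm w <= 1 by lra.
have [h1 h2] := move_size M0 w1 ws e1.
exists (g w'); first exact: gK.
have gw : g w = z by apply: gf; rewrite -/X; lra.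
have -> : g w' - z - c * la ^+ k * z ^+ k.+1 =
  (g w' - g w - la^-1 * (w' - w)) + la^-1 * (w' - w - c * w ^+ k.+1)
   + la^-1 * (c * (w ^+ k.+1 - (la * z) ^+ k.+1)).
  by rewrite gw exprMn [la ^+ k.+1]exprS; field; rewrite la_inv_neq0.
apply: le_trans (nmD _ _) _; apply: le_trans (lerD (nmD _ _) (lexx _)) _.
rewrite !(nmM la^-1) !nmV la_unit invr1 !mul1r (nmM c).
have pw n : nm w ^+ n <= 2 ^+ n * X ^+ n.
  by rewrite -exprMn lerXn2r ?nnegrE ?nm_ge0 // mulr_ge0.
have k1 : nm (g w' - g w - la^-1 * (w' - w)) <= A * 4 * ((nm c + M) * 2 ^+ k.+1) * X ^+ k.+2.
  apply: le_trans (g_est (m := 4 * X) _ _ _) _; [lra|lra|lra|].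
  have h3 : nm (w' - w) <= (nm c + M) * (2 ^+ k.+1 * X ^+ k.+1).
    by apply: le_trans h1 _; rewrite ler_wpM2l.
  have q0 : 0 <= A * (4 * X) by nonneg.
  apply: le_trans (ler_wpM2l q0 h3) _.
  by rewrite [X ^+ k.+2]exprS le_eqVlt; apply/orP; left; apply/eqP; ring.
have k2 : nm (w' - w - c * w ^+ k.+1) <= M * 2 ^+ k.+2 * X ^+ k.+2.
  by apply: le_trans e1 _; rewrite -mulrA ler_wpM2l.
have k3 : nm c * nm (w ^+ k.+1 - (la * z) ^+ k.+1) <= nm c * (k.+1%:R * 2 ^+ k * A) * X ^+ k.+2.
  rewrite -mulrA ler_wpM2l ?nm_ge0 //.
  have laz2 : nm (la * z) <= 2 * X by rewrite laz; lra.
  apply: le_trans (expr_err k w2 laz2) _.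
  have q0 : 0 <= k.+1%:R * (2 * X) ^+ k by nonneg.
  apply: le_trans (ler_wpM2l q0 fz) _.
  have -> : X ^+ k.+2 = X ^+ k * X ^+ 2 by rewrite -exprD addn2.
  by rewrite exprMn le_eqVlt; apply/orP; left; apply/eqP; ring.
lra.
Qed.

Lemma moves_rotn c j : moves c -> moves (c * (la ^+ k) ^+ j).
Proof.
move=> Mc; elim: j => [|j IH]; first by rewrite expr0 mulr1.
by rewrite exprSr mulrA; exact: moves_rot.
Qed.

Lemma mu_neq1 n : (0 < n)%N -> (la ^+ k) ^+ n != 1.
Proof. by move=> n0; rewrite -exprM; apply: la_irr; rewrite muln_gt0 k_gt0. Qed.

(* [a (1 + mu + ... + mu^(n-1)) = a (mu^n - 1) / (mu - 1)] is small when [mu^n] is close to 1 *)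
Lemma moves_small (e : R) : 0 < e -> exists c, [/\ c != 0, nm c <= e & moves c].
Proof.
move=> e0; pose mu := la ^+ k.
have mu1 : nm mu = 1 by rewrite nmX la_unit expr1n.
have d0 : 0 < nm (mu - 1) by rewrite nm_gt0 subr_eq0 -(expr1 mu) mu_neq1.
have na : 0 < nm a by rewrite nm_gt0.
have [|n n0 hn] := @rotation_near_1 _ mu (e * nm (mu - 1) / nm a) mu1.
  by rewrite divr_gt0 // mulr_gt0.
have geo : a * \sum_(j < n) mu ^+ j = a * (mu ^+ n - 1) / (mu - 1).
  by rewrite subrX1; field; rewrite -nm_gt0.
exists (a * \sum_(j < n) mu ^+ j); split.
- by rewrite geo !mulf_neq0 // ?invr_eq0 -?nm_gt0 // nm_gt0 subr_eq0 mu_neq1.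
- rewrite geo !nmM nmV ler_pdivrMr // mulrC -ler_pdivlMr //; exact: ltW.
case: n n0 {hn geo} => // n _; elim: n => [|n IH].
  by rewrite big_ord1 expr0 mulr1; exact: moves_T.
by rewrite big_ord_recr /= mulrDr; apply: moves_add => //; apply: moves_rotn; exact: moves_T.
Qed.

(** [K_dense] chooses the rotation according to the point, so the finitely many candidates need a
    common radius and constant. *)
Lemma moves_uniform c M : moves c -> exists r B : R, [/\ 0 < r, 0 <= B &
  forall j, (j < M)%N -> forall z, K z -> nm z < r ->
  exists2 z', K z' & nm (z' - z - c * (la ^+ k) ^+ j * z ^+ k.+1) <= B * nm z ^+ k.+2].
Proof.
move=> Mc; elim: M => [|M [r [B [r_gt0 B0 H]]]]; first by exists 1, 0; split.
have [r' [B' [r'_gt0 B'0 H']]] := moves_rotn M Mc.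
exists (Num.min r r'), (B + B'); split; [by rewrite lt_min r_gt0|exact: addr_ge0|].
move=> j; rewrite ltnS leq_eqVlt => jM z Kz; rewrite lt_min => /andP [h h'].
have p0 : 0 <= nm z ^+ k.+2 by rewrite exprn_ge0 // nm_ge0.
case/orP: jM => [/eqP ->|jM].
  have [z' Kz' e] := H' z Kz h'; exists z' => //; apply: le_trans e _.
  by rewrite ler_wpM2r //; lra.
have [z' Kz' e] := H j jM z Kz h; exists z' => //; apply: le_trans e _.
by rewrite ler_wpM2r //; lra.
Qed.

Lemma iter_f_est M : exists r B : R, [/\ 0 < r, 0 <= B & forall j, (j <= M)%N ->
  forall z, nm z < r -> nm (iter j f z - la ^+ j * z) <= B * nm z ^+ 2 /\ nm (iter j f z) < r0].
Proof.
have A1 : 1 <= A by exact: A_ge1.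
have rr0 : 0 < r0 by exact: r0_gt0.
elim: M => [|M [r [B [r_gt0 B0 H]]]].
  exists r0, 0; split=> // j; rewrite leqn0 => /eqP -> z hz.
  by rewrite expr0 mul1r subrr nm0 mul0r.
have [s s0 hs] := small_radius B0 ltr01.
have B'0 : 0 <= B + 4 * A by lra.
have [s' s'0 hs'] := small_radius B'0 ltr01.
pose t := Num.min (Num.min r s) (Num.min s' (r0 / 2)).
exists t, (B + 4 * A); split=> //.
  by rewrite !lt_min; repeat (apply/andP; split); lra.
move=> j jM z; rewrite !lt_min => /andP [/andP [zr zs] /andP [zs' zr0]].
have x0 := nm_ge0 z; set X := nm z in zs zs' zr zr0 x0 *.
have X20 : 0 <= X ^+ 2 by rewrite exprn_ge0.
suff E : nm (iter j f z - la ^+ j * z) <= (B + 4 * A) * X ^+ 2.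
  split=> //; have := nmB_ge (iter j f z) (la ^+ j * z).
  rewrite nmM nmX la_unit expr1n mul1r -/X.
  have : (B + 4 * A) * X ^+ 2 <= X by rewrite expr2 mulrA ler_piMl // hs'.
  lra.
move: jM; rewrite leq_eqVlt ltnS => /orP [/eqP ->|jM]; last first.
  have [h _] := H j jM z zr; apply: le_trans h _; rewrite ler_wpM2r //; lra.
have [h1 h2] := H M (leqnn M) z zr; rewrite -/X in h1.
have h3 := f_est h2.
have h4 : nm (iter M f z) <= 2 * X.
  have := nmB_ge (iter M f z) (la ^+ M * z).
  rewrite nmM nmX la_unit expr1n mul1r -/X.
  have : B * X ^+ 2 <= X by rewrite expr2 mulrA ler_piMl // hs.
  lra.
have -> : iter M.+1 f z - la ^+ M.+1 * z = (f (iter M f z) - la * iter M f z) + la * (iter M f z - la ^+ M * z).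
  by rewrite /= exprS; ring.
apply: le_trans (nmD _ _) _; rewrite (nmM la) la_unit mul1r.
have h5 : nm (iter M f z) ^+ 2 <= 4 * X ^+ 2.
  have -> : 4 * X ^+ 2 = (2 * X) ^+ 2 by ring.
  by rewrite lerXn2r ?nnegrE ?nm_ge0 // mulr_ge0.
have h6 : A * nm (iter M f z) ^+ 2 <= A * (4 * X ^+ 2) by rewrite ler_wpM2l //; lra.
lra.
Qed.

(** * Density of [K] at the scale [|p|^(k+1)] *)

Lemma iter_fK j z : K z -> K (iter j f z).
Proof. by move=> Kz; elim: j => //= j; exact: fK. Qed.

(* Start from a point of K on the circle |z| = |p|/4, rotated by f towards p *)
Lemma K_roughly_near : exists2 r : R, 0 < r & forall p, 0 < nm p -> nm p < r ->
  exists2 q, K q & nm (q - p) <= 98 / 100 * nm p.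
Proof.
have [M hM] := rotation_Re_large la_unit (la_irr (n := 1) isT) (la_irr (n := 2) isT).
have [r [B [r_gt0 B0 H]]] := iter_f_est M.
have [s s0 hs] := K_circles.
have [s' s'0 hs'] := small_radius B0 (e := 1 / 100) ltac:(lra).
exists (Num.min (Num.min s r) s'); first by rewrite !lt_min s0 r_gt0.
move=> p p0; rewrite !lt_min => /andP [/andP [ps pr] ps'].
have [q Kq nq] := hs (nm p / 4) ltac:(lra) ltac:(lra).
have [j jM hj] := hM (q * p^*%C).
exists (iter j f q); first exact: iter_fK.
have [h _] := H j (ltnW jM) q ltac:(lra).
set P := nm p in p0 ps pr ps' nq *; rewrite nq in h.
rewrite nmM nm_conj -/P nq in hj.
have n1 : nm (la ^+ j * q) = P / 4 by rewrite nmM nmX la_unit expr1n mul1r.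
(* The square is at most [P^2/16 + P^2 - 2 P^2/16 = 15/16 P^2], and [15/16 < (97/100)^2]; one more
   hundredth covers the error of [f]. *)
have h2 : nm (la ^+ j * q - p) <= 97 / 100 * P.
  rewrite -(@ler_pXn2r _ 2) ?nnegrE ?nm_ge0 //; last by lra.
  by rewrite nm_sub_sqr n1 -/P -mulrA; nra.
apply: le_trans (nm_tri (la ^+ j * q) _ _) _.
have := hs' P ltac:(lra) ps'; nra.
Qed.

(** A nearest point [q] to [p], if too far, could be moved inside [K] by some [c mu^j q^(k+1)] whose
    angle with [p - q] has cosine at least 1/4; this gains at least [|c| |q|^(k+1) / 16], against
    minimality. *)
Lemma K_dense (e : R) : 0 < e -> exists2 r : R, 0 < r & forall p, 0 < nm p -> nm p < r ->
  exists2 q, K q & nm (q - p) <= e * nm p ^+ k.+1.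
Proof.
(* The 4 makes the step at most a quarter of the distance, as [h1] requires; [2^(k+1)] allows for
   [|q| <= 2 |p|]. *)
move=> e0; have e'0 : 0 < e / (4 * 2 ^+ k.+1) by rewrite divr_gt0 // mulr_gt0 // exprn_gt0.
have [c [c0 ce Mc]] := moves_small e'0.
pose mu := la ^+ k.
have mu1 : nm mu = 1 by rewrite nmX la_unit expr1n.
have [M hM] := rotation_Re_large mu1 (mu_neq1 (n := 1) isT) (mu_neq1 (n := 2) isT).
have [r [B [r_gt0 B0 H]]] := moves_uniform M Mc.
have nc : 0 < nm c by rewrite nm_gt0.
have [s s0 hs] := small_radius B0 (e := nm c / 16) ltac:(lra).
have [t t0 ht] := K_roughly_near.
exists (Num.min (Num.min (s / 2) (r / 2)) t); first by rewrite !lt_min; repeat (apply/andP; split); lra.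
move=> p p0; rewrite !lt_min => /andP [/andP [ps pr] pt].
have [q Kq qmin] := K_proximinal p.
exists q => //; rewrite leNgt; apply/negP => far.
have [q1 Kq1 hq1] := ht p p0 pt.
set P := nm p in p0 ps pr pt far hq1 *.
set D := nm (q - p) in far qmin.
have D98 : D <= 98 / 100 * P by apply: le_trans hq1; exact: qmin.
have q_le : nm q <= 2 * P by have := nmB_ge q p; rewrite -/P -/D; lra.
(* The rough approximation keeps the nearest point away from 0, where the displacements vanish. *)
have q_ge : 2 / 100 * P <= nm q by have := nmB_ge p q; rewrite nmBC -/P -/D; lra.
have q0 : 0 < nm q by lra.
pose sg := nm c * nm q ^+ k.+1.
have sg0 : 0 < sg by rewrite mulr_gt0 // exprn_gt0.
have D4 : 4 * sg <= D.
  apply: le_trans (ltW far); rewrite /sg.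
  have h1 : nm q ^+ k.+1 <= 2 ^+ k.+1 * P ^+ k.+1.
    by rewrite -exprMn lerXn2r ?nnegrE ?nm_ge0 // mulr_ge0 // ltW.
  have h2 := ler_pM (ltW nc) (exprn_ge0 k.+1 (ltW q0)) ce h1.
  have -> : e * P ^+ k.+1 = 4 * (e / (4 * 2 ^+ k.+1) * (2 ^+ k.+1 * P ^+ k.+1)).
    by field; rewrite expf_neq0.
  by rewrite ler_wpM2l.
have [j jM hj] := hM (c * q ^+ k.+1 * (p - q)^*%C).
have [q' Kq' hq'] := H j jM q Kq ltac:(lra).
have nu : nm (c * q ^+ k.+1 * (p - q)^*%C) = sg * D.
  by rewrite !(nmM _ (_^*%C)) nm_conj (nmM c) nmX nmBC.
rewrite nu in hj.
pose y := c * mu ^+ j * q ^+ k.+1.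
have ny : nm y = sg by rewrite /y !(nmM _ (q ^+ _)) (nmM c) (nmX mu) mu1 expr1n mulr1 nmX.
have h1 : nm (y - (p - q)) <= D - sg / 8.
  rewrite -(@ler_pXn2r _ 2) ?nnegrE ?nm_ge0 //; last by lra.
  rewrite nm_sub_sqr ny (nmBC p) -/D.
  have -> : y * (p - q)^*%C = mu ^+ j * (c * q ^+ k.+1 * (p - q)^*%C) by rewrite /y; ring.
  nra.
have h2 : nm (q' - p) <= D - sg / 16.
  have -> : q' - p = (q' - q - y) + (y - (p - q)) by ring.
  apply: le_trans (nmD _ _) _.
  have h3 : B * nm q ^+ k.+2 <= sg / 16.
    have -> : sg / 16 = nm c / 16 * nm q ^+ k.+1 by rewrite /sg; ring.
    rewrite [nm q ^+ k.+2]exprS mulrA.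
    by rewrite ler_wpM2r ?exprn_ge0 ?nm_ge0 //; apply: hs; lra.
  rewrite -/mu -/y in hq'; lra.
by have := qmin q' Kq'; rewrite -/D; lra.
Qed.

Lemma K_closed p : (forall e : R, 0 < e -> exists2 q, K q & nm (q - p) <= e) -> K p.
Proof.
move=> H; have [q Kq hq] := K_proximinal p.
suff -> : p = q by [].
apply/esym/subr0_eq/nm_small => e e0; have [q' Kq' h] := H e e0.
exact: le_trans (hq _ Kq') h.
Qed.

(** * Repelling sectors and transport along orbits of [T] *)

Lemma step_form x : x != 0 -> nm x < r0 ->
  exists2 rho, T x = x * (1 + (a * x ^+ k + rho)) & nm rho <= A * nm x ^+ k.+1.
Proof.
move=> x0 xr; exists ((T x - x - a * x ^+ k.+1) / x).
  by rewrite exprS; field.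
have := T_form (lexx (nm x)) (_ : nm 0 <= nm x) xr.
rewrite nm0 T0 expr0n /= mulr0 !subr0 => /(_ (nm_ge0 x)) h.
by rewrite nmM nmV ler_pdivrMr ?nm_gt0.
Qed.

Definition sector p := cone (a * p ^+ k).

Lemma sector_back : exists2 r : R, 0 < r & forall x, 0 < nm x -> nm x < r ->
  sector (T x) -> sector x.
Proof.
have al0 : 0 < nm a by rewrite nm_gt0; exact: a_neq0.
have A0 : 0 <= A by exact: le_trans A_ge1.
pose c0 : R := 2 * k%:R + 4 ^+ k.+1.
have q1 : 0 <= c0 * nm a by rewrite /c0; nonneg.
have q2 : 0 <= A / nm a by rewrite divr_ge0 // ltW.
have e16 : 0 < 1 / 16 :> R by rewrite divr_gt0.
have [s1 s10 hs1] := small_radius q1 e16.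
have [s2 s20 hs2] := small_radius q2 e16.
exists (Num.min r0 (Num.min s1 s2)); first by rewrite !lt_min s10 s20 r0_gt0.
move=> x x0; rewrite !lt_min => /andP [xr /andP [xs1 xs2]].
have xn0 : x != 0 by rewrite -nm_gt0.
have X1 : nm x <= 1 by exact: le_trans (ltW xr) r0_le1.
have [rho TE hrho] := step_form xn0 xr.
have v0 : a * x ^+ k != 0 by rewrite mulf_neq0 ?expf_neq0.
have nuE : nm (a * x ^+ k) = nm a * nm x ^+ k by rewrite nmM nmX.
have rho16 : nm rho <= 1 / 16 * nm (a * x ^+ k).
  have -> : 1 / 16 * nm (a * x ^+ k) = 1 / 16 * nm a * nm x ^+ k by rewrite nuE mulrA.
  apply: le_trans hrho _; rewrite exprS mulrA ler_wpM2r ?exprn_ge0 ?nm_ge0 //.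
  have -> : A * nm x = A / nm a * nm x * nm a by field; rewrite gt_eqF.
  by rewrite ler_wpM2r ?(ltW al0) //; exact: hs2 (ltW x0) xs2.
have c0nu : c0 * nm (a * x ^+ k) <= 1 / 16.
  apply: le_trans (hs1 _ (ltW x0) xs1).
  by rewrite nuE mulrA ler_wpM2l // expr_k_le // ltW.
rewrite /sector; have -> : a * T x ^+ k = a * x ^+ k * (1 + (a * x ^+ k + rho)) ^+ k.
  by rewrite TE exprMn; ring.
exact: cone_back k_gt0 v0 rho16 c0nu.
Qed.

(** The sector condition gives a radial gain with constant [|a| / 5]; half of it is given up to the
    remainder of [T]. *)
Lemma sector_growth : exists2 r : R, 0 < r & forall x, 0 < nm x -> nm x < r ->
  sector x -> nm x + nm a / 10 * nm x ^+ k.+1 <= nm (T x).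
Proof.
have A1 : 1 <= A by exact: A_ge1.
have rr0 : 0 < r0 by exact: r0_gt0.
have al0 : 0 < nm a by rewrite nm_gt0; exact: a_neq0.
have A0 : 0 <= A by lra.
have [s1 s10 hs1] := small_radius A0 (e := nm a / 10) ltac:(lra).
exists (Num.min r0 s1); first by rewrite !lt_min; apply/andP; split; lra.
move=> x x0; rewrite !lt_min => /andP [xr xs1].
have xn0 : x != 0 by rewrite -nm_gt0.
have [rho TE hrho] := step_form xn0 xr.
set X := nm x in x0 xr xs1 hrho *.
have {}hs1 := hs1 _ (ltW x0) xs1.
have Xk0 : 0 <= X ^+ k by rewrite exprn_ge0 // ltW.
rewrite /sector /cone nmM nmX -/X => sx.
rewrite TE nmM -/X [X ^+ k.+1]exprS.
have h1 : 1 + nm a * X ^+ k / 5 - nm rho <= nm (1 + (a * x ^+ k + rho)).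
  have := Re_le_nm (1 + (a * x ^+ k + rho)); rewrite !ReD /= ler_norml => /andP [_ h].
  have := Re_le_nm rho; rewrite ler_norml => /andP [h' _]; lra.
have h2 : nm rho <= nm a / 10 * X ^+ k.
  apply: le_trans hrho _; rewrite exprS mulrA ler_wpM2r //.
have h3 : X * (1 + nm a / 10 * X ^+ k) <= X * nm (1 + (a * x ^+ k + rho)).
  by rewrite ler_wpM2l ?(ltW x0) //; lra.
by apply: le_trans h3; rewrite le_eqVlt; apply/orP; left; apply/eqP; ring.
Qed.

Lemma forward_main x q : x != 0 -> 3 * nm x < r0 -> nm (q - x) <= nm x ->
  nm (q - x) <= 2 * nm x ^+ k.+1 ->
  nm (T q - T x) <= nm (q - x) * (nm (1 + k.+1%:R * (a * x ^+ k)) +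
    (nm a * (2 * 4 ^+ k.+1) + A * 2 ^+ k.+1) * nm x ^+ k.+1).
Proof.
move=> xn0 xr deX de2; have x0 : 0 < nm x by rewrite nm_gt0.
set X := nm x in xr deX de2 x0 *; set de := nm (q - x) in deX de2 *.
have de0 : 0 <= de by exact: nm_ge0.
have qX : nm q <= 2 * X by have := nmB_ge q x; rewrite -/X -/de; lra.
have xX : nm x <= 2 * X by rewrite -/X; lra.
have mr : 2 * X < r0 by lra.
have -> : T q - T x = (q - x) * (1 + k.+1%:R * (a * x ^+ k))
   + a * (q ^+ k.+1 - x ^+ k.+1 - k.+1%:R * (x ^+ k * (q - x)))
   + ((T q - q - a * q ^+ k.+1) - (T x - x - a * x ^+ k.+1)) by ring.
apply: le_trans (nmD _ _) _; apply: le_trans (lerD (nmD _ _) (lexx _)) _.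
have R1 := T_form qX xX mr; rewrite exprMn mulrA -/de in R1.
have R2 : nm (a * (q ^+ k.+1 - x ^+ k.+1 - k.+1%:R * (x ^+ k * (q - x)))) <=
    nm a * (2 * 4 ^+ k.+1) * X ^+ k.+1 * de.
  have inc := power_increment k xn0 deX; rewrite -/X -/de in inc.
  rewrite (nmM a) -!mulrA ler_wpM2l ?nm_ge0 //; apply: le_trans inc _.
  rewrite [leRHS]mulrCA; apply: ler_wpM2l; first by nonneg.
  have -> : X ^+ k.+1 * (de / X) ^+ 2 = X ^+ k * (de / X) * de.
    by rewrite exprS; field; rewrite gt_eqF.
  rewrite [leRHS]mulrA; apply: ler_wpM2r => //; rewrite exprSr [leRHS]mulrCA; apply: ler_wpM2l.
    by rewrite exprn_ge0 // ltW.
  rewrite ler_pdivrMr //; apply: le_trans de2 _.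
  rewrite -mulrA ler_wpM2l // exprS ler_wpM2l ?(ltW x0) //.
  by apply: expr_k_le; [exact: ltW | apply: le_trans r0_le1; lra].
rewrite (nmM (q - x)) -/de; lra.
Qed.

(** Derivative and growth agree to first order: [T x / x = 1 + a x^k + ...], whose power [k+1]
    begins with [1 + (k+1) a x^k]. This is the near-isometry in the Fatou coordinate. *)
Lemma growth_main x : x != 0 -> nm x < r0 -> (nm a + A) * nm x <= 1 ->
  nm (1 + k.+1%:R * (a * x ^+ k)) <= (nm (T x) / nm x) ^+ k.+1 +
    (k.+1%:R * A + 4 ^+ k.+1 * (nm a + A) ^+ 2) * nm x ^+ k.+1.
Proof.
move=> xn0 xr aX; have x0 : 0 < nm x by rewrite nm_gt0.
have A0 : 0 <= A by exact: le_trans A_ge1.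
have [rho TE hrho] := step_form xn0 xr.
set X := nm x in x0 xr aX hrho *.
have X1 : X <= 1 by exact: le_trans (ltW xr) r0_le1.
have pk0 : 0 <= X ^+ k by rewrite exprn_ge0 // ltW.
have pkX : X ^+ k <= X by apply: expr_k_le => //; exact: ltW.
have aA0 : 0 <= nm a + A by nonneg.
pose v := a * x ^+ k; pose y := v + rho.
have ny : nm y <= (nm a + A) * X ^+ k.
  apply: le_trans (nmD _ _) _; rewrite nmM nmX mulrDl lerD2l.
  by apply: le_trans hrho _; rewrite ler_wpM2l // exprS ler_piMl.
have y1 : nm y <= 1.
  by apply: le_trans ny _; apply: le_trans aX; rewrite ler_wpM2l.
have -> : nm (T x) / X = nm (1 + y) by rewrite TE nmM -/X mulrAC divff ?gt_eqF // mul1r.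
have h := binomial_error k.+1 y1.
have -> : 1 + k.+1%:R * (a * x ^+ k) = (1 + y) ^+ k.+1 - ((1 + y) ^+ k.+1 - 1 - k.+1%:R * y) - k.+1%:R * rho.
  by rewrite /y /v; ring.
apply: le_trans (nmB _ _) _; apply: le_trans (lerD (nmB _ _) (lexx _)) _.
rewrite nmX (nmM _ rho) nm_nat -addrA lerD2l addrC mulrDl; apply: lerD.
  by rewrite -mulrA ler_wpM2l.
apply: le_trans h _; rewrite -mulrA; apply: ler_wpM2l; first by nonneg.
have h2 : nm y ^+ 2 <= ((nm a + A) * X ^+ k) ^+ 2.
  by rewrite lerXn2r ?nnegrE ?nm_ge0 //; nonneg.
apply: le_trans h2 _; rewrite exprMn; apply: ler_wpM2l; first by nonneg.
by rewrite expr2 exprS; apply: ler_wpM2r.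
Qed.

(* Along an orbit leaving 0, the error relative to [|p|^(k+1)] grows at each step by a factor
   [1 + O(|x|^(k+1))], which the growth [|T x| - |x| >= c |x|^(k+1)] turns into a telescoping product. *)
Lemma forward_error : exists r B : R, [/\ 0 < r, 0 <= B, r <= 1, B * r <= 1 &
  forall x q (e : R), 0 < nm x -> nm x < r -> sector x -> 0 <= e -> e <= 1 ->
   nm (q - x) <= e * nm x ^+ k.+1 * (1 + B * nm x) ->
   nm q < r0 /\ nm (T q - T x) <= e * nm (T x) ^+ k.+1 * (1 + B * nm (T x))].
Proof.
have A1 : 1 <= A by exact: A_ge1.
have rr0 : 0 < r0 by exact: r0_gt0.
have r01 : r0 <= 1 by exact: r0_le1.
have al0 : 0 < nm a by rewrite nm_gt0; exact: a_neq0.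
have [s2 s20 grow] := sector_growth.
pose C1 := nm a * (2 * 4 ^+ k.+1) + A * 2 ^+ k.+1.
pose C2 := k.+1%:R * A + 4 ^+ k.+1 * (nm a + A) ^+ 2.
have A0 : 0 <= A by lra.
have C10 : 0 <= C1 by rewrite /C1; nonneg.
have C20 : 0 <= C2 by rewrite /C2; nonneg.
pose B := 20 * (C1 + C2) / nm a.
have B0 : 0 <= B by rewrite /B; apply: divr_ge0; lra.
have q1 : 0 <= B + 2 + nm a + A by lra.
have [s1 s10 hs1] := small_radius q1 ltr01.
pose r := Num.min (Num.min (r0 / 3) s2) (s1 / 2).
have [ra rb rc] : [/\ r <= r0 / 3, r <= s2 & r <= s1 / 2].
  by rewrite /r !ge_min !lexx !orbT.
have r_gt0 : 0 < r by rewrite !lt_min; repeat (apply/andP; split); lra.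
have rs1 : r < s1 by lra.
have hr (X : R) : 0 <= X -> X <= r -> [/\ B * X <= 1, 2 * X <= 1 & (nm a + A) * X <= 1].
  move=> X0 Xr; have h := hs1 X X0 (le_lt_trans Xr rs1).
  by split; apply: le_trans h; apply: ler_wpM2r => //; lra.
have [Br _ _] := hr r (ltW r_gt0) (lexx r).
exists r, B; split=> //; first by lra.
move=> x q e x0 xr sx e0 e1 hq.
have xn0 : x != 0 by rewrite -nm_gt0.
have [BX X2 aX] := hr _ (ltW x0) (ltW xr).
have xr0 : 3 * nm x < r0 by lra.
have xr1 : nm x < r0 by lra.
have g1 := grow x x0 (lt_le_trans xr rb) sx.
have main := @forward_main x q xn0 xr0.
have gr := growth_main xn0 xr1 aX.
set X := nm x in x0 xr xr0 xr1 g1 hq BX X2 aX main gr *.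
have p0 : 0 <= X ^+ k.+1 by rewrite exprn_ge0 // ltW.
have BX0 : 0 <= B * X by rewrite mulr_ge0 // ltW.
have de2 : nm (q - x) <= 2 * X ^+ k.+1.
  apply: le_trans hq _; rewrite mulrC; apply: ler_pM; rewrite ?addr_ge0 //.
  - exact: mulr_ge0.
  - by lra.
  - by rewrite ler_piMl.
have deX : nm (q - x) <= X.
  apply: le_trans de2 _; rewrite exprS mulrA.
  have Xk : X ^+ k <= 1.
    by apply: exprn_ile1; [exact: ltW | exact: le_trans (ltW xr1) r01].
  have X20 : 0 <= 2 * X by rewrite mulr_ge0 // ltW.
  apply: (@le_trans _ _ (1 * X ^+ k)).
    by apply: ler_wpM2r => //; rewrite exprn_ge0 // ltW.
  by rewrite mul1r; apply: expr_k_le; [exact: ltW | exact: le_trans (ltW xr1) r01].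
split.
  by have := nmB_ge q x; rewrite -/X => h; apply: le_lt_trans xr0; lra.
have TX : nm (T x) ^+ k.+1 = X ^+ k.+1 * (nm (T x) / X) ^+ k.+1.
  by rewrite -exprMn mulrC divfK // gt_eqF.
rewrite TX; apply: (@error_combine _ e (X ^+ k.+1) B X _ C1 C2
  (nm (1 + k.+1%:R * (a * x ^+ k))) (nm (q - x)) _ _ (nm a)) => //.
- exact: ltW.
- apply: exprn_ege1; rewrite ler_pdivlMr // mul1r; apply: le_trans g1.
  by rewrite lerDl; apply: mulr_ge0 => //; apply: divr_ge0 => //; exact: ltW.
- exact: nm_ge0.
- exact: main.
- exact: nm_ge0.
- by rewrite /B divfK // gt_eqF.
Qed.

Lemma sector_in_K : exists2 r : R, 0 < r & forall p, 0 < nm p -> nm p < r -> sector p -> K p.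
Proof.
have rr0 : 0 < r0 by exact: r0_gt0.
have r01 : r0 <= 1 by exact: r0_le1.
have al0 : 0 < nm a by rewrite nm_gt0; exact: a_neq0.
have [r1 r10 back] := sector_back.
have [r2 r20 grow] := sector_growth.
have [r3 [B [r30 B0 r31 Br err]]] := forward_error.
pose r := Num.min (Num.min (r0 / 2) (r1 / 2)) (Num.min (r2 / 2) (r3 / 2)).
have [ra rb rc rd] : [/\ r <= r0 / 2, r <= r1 / 2, r <= r2 / 2 & r <= r3 / 2].
  by rewrite /r !ge_min !lexx !orbT.
have r_gt0 : 0 < r by rewrite !lt_min; repeat (apply/andP; split); lra.
exists r => // p p0 pr sp.
have stepS x : 0 < nm x -> nm x < r -> sector x ->
   [/\ 0 < nm (S x), nm (S x) < r, sector (S x) & nm (S x) + nm a / 10 * nm (S x) ^+ k.+1 <= nm x].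
  move=> x0 xr sx; have xr0 : nm x < r0 by lra.
  have TSx := TS xr0; have Sx2 := S_le xr0.
  have Sx0 : 0 < nm (S x).
    rewrite nm_gt0; apply: contraTneq x0 => h; by rewrite -TSx h T0 nm0 ltxx.
  have ss : sector (S x) by apply: back => //; [lra|rewrite TSx].
  have g1 := grow (S x) Sx0 ltac:(lra) ss; rewrite TSx in g1.
  split=> //; apply: le_lt_trans xr; apply: le_trans g1.
  by rewrite lerDl mulr_ge0 ?exprn_ge0 ?nm_ge0 //; lra.
pose u n := iter n S p.
have U n : [/\ 0 < nm (u n), nm (u n) < r & sector (u n)].
  by elim: n => [|n [h1 h2 h3]] //; have [] := stepS _ h1 h2 h3.
apply: K_closed => e0 e00.
(* Half of [e0], because the final factor [1 + B |p|] is at most 2; the cap 1 is required by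
   [forward_error]. *)
pose e := Num.min 1 (e0 / 2).
have [ea eb] : e <= 1 /\ e <= e0 / 2 by rewrite /e !ge_min !lexx !orbT.
have e_gt0 : 0 < e by rewrite lt_min ltr01 /=; lra.
have [s s0 dense] := K_dense e_gt0.
have [n hn] : exists n, nm (u n) < s.
  apply: contrapT => /forallNP H.
  have {}H n : s <= nm (u n) by rewrite leNgt; apply/negP; exact: H.
  (* An orbit staying outside radius [s] would lose at least this much modulus at each step. *)
  pose c := nm a / 10 * s ^+ k.+1.
  have c0 : 0 < c by rewrite mulr_gt0 ?exprn_gt0 //; lra.
  have L n : nm (u n) <= nm p - n%:R * c.
    elim: n => [|n IH]; first by rewrite mul0r subr0.
    have [h1 h2 h3] := U n; have [_ _ _ h4] := stepS _ h1 h2 h3.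
    have h5 : c <= nm a / 10 * nm (u n.+1) ^+ k.+1.
      rewrite /c ler_wpM2l //; first by lra.
      by rewrite lerXn2r ?nnegrE ?nm_ge0 //; exact: ltW.
    rewrite -natr1 mulrDl mul1r; have h6 : nm (u n.+1) + nm a / 10 * nm (u n.+1) ^+ k.+1 <= nm (u n) by exact: h4.
    lra.
  pose n := (Num.truncn (nm p / c)).+1.
  have : nm p / c < n%:R by exact: truncnS_gt.
  rewrite ltr_pdivrMr // => h; have := L n; have := nm_ge0 (u n); lra.
(* [T] carries a neighbour of [u m] to one of [u 0 = p]; the relative error [e] is unchanged, only
   the factor [1 + B |u m|] grows. *)
have down m q : K q -> nm (q - u m) <= e * nm (u m) ^+ k.+1 * (1 + B * nm (u m)) ->
   exists2 q', K q' & nm (q' - p) <= e * nm p ^+ k.+1 * (1 + B * nm p).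
  elim: m q => [|m IH] q Kq hq; first by exists q.
  have [h1 h2 h3] := U m.+1; have [g1 g2 g3] := U m.
  have [h4 h5] := err _ q e h1 ltac:(lra) h3 (ltW e_gt0) ea hq.
  have TSm : T (u m.+1) = u m by apply: TS; lra.
  rewrite TSm in h5; apply: (IH (T q)) => //; exact: TK.
have [h1 h2 h3] := U n.
have [q Kq hq] := dense _ h1 hn.
have [|q' Kq' hq'] := down n q Kq.
  apply: le_trans hq _; rewrite ler_peMr //; first by rewrite mulr_ge0 ?exprn_ge0 ?nm_ge0 // ltW.
  by rewrite lerDl mulr_ge0 ?nm_ge0.
exists q' => //; apply: le_trans hq' _.
have p1 : nm p <= 1 by lra.
have pr3 : nm p <= r3 by lra.
apply: error_le => //; rewrite ?exprn_ge0 ?nm_ge0 ?mulr_ge0 ?nm_ge0 ?(ltW e_gt0) //.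
- by apply: exprn_ile1 => //; exact: nm_ge0.
- by apply: le_trans Br; rewrite ler_wpM2l.
Qed.

(** Applying [f^j] multiplies [a p^k] by [la^(kj)] up to higher order, and some [j < M] brings it
    into the sector; since [g] undoes [f] and preserves [K], the point [p] itself belongs to [K]. *)
Lemma K_nbhd : K 0 -> exists2 r : R, 0 < r & forall z, nm z < r -> K z.
Proof.
move=> K0.
have rr0 : 0 < r0 by exact: r0_gt0.
have r01 : r0 <= 1 by exact: r0_le1.
have al0 : 0 < nm a by rewrite nm_gt0; exact: a_neq0.
have [r1 r10 secK] := sector_in_K.
have mu1 : nm (la ^+ k) = 1 by rewrite nmX la_unit expr1n.
have [M hM] := rotation_Re_large mu1 (mu_neq1 (n := 1) isT) (mu_neq1 (n := 2) isT).
have [r [B [r_gt0 B0 H]]] := iter_f_est M.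
pose C4 := k%:R * 2 ^+ k * B.
have C40 : 0 <= C4 by rewrite /C4; nonneg.
have q1 : 0 <= 2 * C4 + B by lra.
have [s1 s10 hs1] := small_radius q1 (e := 1 / 20) ltac:(lra).
exists (Num.min (Num.min r s1) (r1 / 2)).
  by rewrite !lt_min; repeat (apply/andP; split); lra.
move=> p; rewrite !lt_min => /andP [/andP [pr ps1] pr1].
have [->//|pn0] := eqVneq p 0.
have p0 : 0 < nm p by rewrite nm_gt0.
have [j jM hj] := hM (a * p ^+ k).
have unwind i : (i <= M)%N -> K (iter i f p) -> K p.
  elim: i => [//|i IH] iM Ki; apply: IH; first exact: ltnW.
  by have [_ h] := H i (ltnW iM) p pr; rewrite -(gf h); apply: gK.
apply: (unwind j (ltnW jM)).
have [h1 _] := H j (ltnW jM) p pr.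
set w := iter j f p in h1 *.
set P := nm p in p0 pr ps1 pr1 hj h1.
have hP := hs1 P (ltW p0) ps1.
have BP : B * P <= 1 / 20.
  by apply: le_trans hP; rewrite ler_wpM2r ?(ltW p0) //; lra.
have CP : C4 * P <= 1 / 40.
  have : (2 * C4) * P <= 1 / 20 by apply: le_trans hP; rewrite ler_wpM2r ?(ltW p0) //; lra.
  lra.
have BP2 : B * P ^+ 2 <= P / 20.
  by rewrite expr2 mulrA; have := ler_wpM2r (ltW p0) BP; lra.
have nl : nm (la ^+ j * p) = P by rewrite nmM nmX la_unit expr1n mul1r.
have w2 : nm w <= 2 * P by have := nmB_ge w (la ^+ j * p); rewrite nl; lra.
have w0 : 0 < nm w.
  by have := nmB_ge (la ^+ j * p) w; rewrite nl (nmBC _ w); lra.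
apply: secK => //; first by lra.
pose y := (la ^+ j * p) ^+ k.
have l2 : nm (la ^+ j * p) <= 2 * P by rewrite nl; lra.
(* The tolerance of [cone_near]. *)
have wk : nm (w ^+ k - y) <= P ^+ k / 40.
  apply: le_trans (exprB_le k w2 l2) _.
  have q0 : 0 <= k%:R * (2 * P) ^+ k.-1.
    by apply: mulr_ge0; [exact: ler0n | apply: exprn_ge0; lra].
  apply: le_trans (ler_wpM2l q0 h1) _.
  have k0 : (0 < k)%N by exact: k_gt0.
  have E1 : P ^+ k = P ^+ k.-1 * P by rewrite -exprSr prednK.
  have E2 : 2 ^+ k = 2 ^+ k.-1 * 2 :> R by rewrite -exprSr prednK.
  have pk : 0 <= P ^+ k.-1 by rewrite exprn_ge0 // ltW.
  have pk' : 0 <= P ^+ k by rewrite exprn_ge0 // ltW.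
  have -> : k%:R * (2 * P) ^+ k.-1 * (B * P ^+ 2) = (C4 * P) / 2 * P ^+ k.
    by rewrite /C4 E1 E2 exprMn; field.
  by have := ler_wpM2r pk' CP; lra.
have ny : nm y = P ^+ k by rewrite nmX nl.
apply: (@cone_near _ a y); rewrite ny //.
have -> : a * y = (la ^+ k) ^+ j * (a * p ^+ k) by rewrite /y exprMn -!exprM mulnC; ring.
by move: hj; rewrite nmM nmX.
Qed.

End Dynamics.

(** * Germs and compact sets *)

Section Topology.
Context {R : realType}.
Local Notation C := (R[i]).
Implicit Types (z w p q : C) (K U : set C).

Lemma nmB_continuous p : continuous (fun z : @CT R => nm (z - p)).
Proof.
move=> z B /nbhs_normP [e /= e0 H].
suff : nbhs (z : @CT R) [set t : C | B (nm (t - p))] by [].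
apply/nbhsCT; exists e => // w hw; apply: H => /=.
apply: le_lt_trans hw; rewrite ler_norml.
have h1 := nm_tri w z p; have h2 := nm_tri z w p; rewrite (nmBC z w) in h1.
by apply/andP; split; lra.
Qed.

Lemma nm_continuous : continuous (fun z : @CT R => nm z).
Proof.
have -> : (fun z : @CT R => nm z) = (fun z : @CT R => nm (z - 0)).
  by apply/funext => z; rewrite subr0.
exact: nmB_continuous.
Qed.

Lemma open_disc (s : R) : @open (@CT R) [set z | nm z < s].
Proof.
rewrite openE => z zs; have {}zs : nm z < s by exact: zs.
apply/nbhsCT; exists (s - nm z); first by rewrite subr_gt0.
by move=> w hw /=; have := nmB_ge w z; lra.
Qed.

Lemma open_codisc (s : R) : @open (@CT R) [set z | s < nm z].
Proof.
rewrite openE => z zs; have {}zs : s < nm z by exact: zs.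
apply/nbhsCT; exists (nm z - s); first by rewrite subr_gt0.
by move=> w hw /=; have := nmB_ge z w; rewrite nmBC; lra.
Qed.

Lemma compact_proximinal K p : @compact (@CT R) K -> K !=set0 ->
  exists2 q, K q & forall q', K q' -> nm (q - p) <= nm (q' - p).
Proof.
move=> cK K0.
have [|q Kq H] := @compact_EVT_min (@CT R) R (fun z => nm (z - p)) K K0 cK.
  apply: continuous_subspaceT; exact: nmB_continuous.
exists q; first by rewrite inE in Kq.
by move=> q' Kq'; apply: H; rewrite inE.
Qed.

Lemma compact_nm_bounded K : @compact (@CT R) K -> K !=set0 ->
  exists B : R, forall z, K z -> nm z <= B.
Proof.
move=> cK K0.
have [|q Kq H] := @compact_EVT_max (@CT R) R (fun z => nm z) K K0 cK.
  apply: continuous_subspaceT; exact: nm_continuous.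
by exists (nm q) => z Kz; apply: H; rewrite inE.
Qed.

(** If [K] missed the circle, its part inside would be open and closed in [K], containing 0 but not
    [x]. *)
Lemma connected_circles K : @connected (@CT R) K -> K 0 -> K <> [set 0] ->
  exists2 s : R, 0 < s & forall rho, 0 < rho -> rho < s -> exists2 q, K q & nm q = rho.
Proof.
move=> cK K0 Kn0.
have [x Kx x0] : exists2 x, K x & x != 0.
  apply: contrapT => /forall2NP H; apply: Kn0; apply/seteqP; split=> [z Kz|_ ->] //=.
  by have [//|/negP] := H z; rewrite negbK => /eqP.
exists (nm x); first by rewrite nm_gt0.
move=> rho r0 rx; apply: contrapT => /forall2NP H.
have {}H z : K z -> nm z != rho by move=> Kz; apply/negP => /eqP h; have [] := H z.
have : K `&` [set z | nm z < rho] = K.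
  apply: cK.
  - by exists 0; split=> //=; rewrite nm0.
  - by exists [set z | nm z < rho] => //; exact: open_disc.
  exists [set z | nm z <= rho].
    have -> : [set z | nm z <= rho] = ~` [set z | rho < nm z].
      by apply/seteqP; split=> z /=; [move=> h; apply/negP; rewrite -leNgt|move/negP; rewrite -leNgt].
    by apply: open_closedC; exact: open_codisc.
  apply/seteqP; split=> z [Kz /= h]; split=> //=; first exact: ltW.
  by rewrite lt_neqAle H.
move/seteqP => [_ /(_ x Kx) [_ /=]]; lra.
Qed.

Lemma univalent_hol U (f : C -> C) : @open (@CT R) U -> U 0 -> univalent_on U f ->
  exists2 r : R, 0 < r & hol r f /\ forall z, nm z < r -> U z.
Proof.
move=> oU U0 [fh _]; have [e e0 H] := openCT oU U0.
have HU z : nm z < e -> U z by move=> hz; apply: H; rewrite subr0.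
by exists e => //; split=> // z /HU /fh /cdiff_derive; exists (cderiv f z).
Qed.

(** Dividing twice by [z] gives [f z - l z = z^2 h z] with [h] Lipschitz; a bound on differences,
    not merely on values, is what conjugation by [g] needs. *)
Lemma second_order (f : C -> C) (r : R) l : 0 < r -> hol r f -> f 0 = 0 -> cdiff f 0 l ->
  exists s A : R, [/\ 0 < s, s < r, 0 <= A &
  forall z w (m : R), nm z <= m -> nm w <= m -> m < s ->
   nm (f z - f w - l * (z - w)) <= A * m * nm (z - w)].
Proof.
move=> r0 fh f0 fl.
have gh : hol r (fun z => f z - (0 + l * z)).
  by move=> z /fh [m hm]; exists (m - l); apply: cdiffB => //; exact: cdiff_affine.
have [|g hg gE] := hol_div r0 gh; first by rewrite f0 mulr0 addr0 subrr.
have g0 : g 0 = 0.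
  have [m hm] := hg 0 ltac:(by rewrite nm0).
  have d1 : cdiff (fun z => f z - (0 + l * z)) 0 (l - l) by apply: cdiffB fl _; exact: cdiff_affine.
  have d2 : cdiff (fun z => f z - (0 + l * z)) 0 (1 * g 0 + 0 * m).
    apply: (cdiff_ext r0) _ (cdiffM (f := fun z => z) (l := 1) _ hm) => [w|].
      by rewrite subr0 => /gE ->.
    by apply: cdiff_ext ltr01 _ (cdiff_affine 0 1 0) => w _; rewrite add0r mul1r.
  by have := cdiff_unique d1 d2; rewrite subrr mul1r mul0r addr0.
have [h hh hE] := hol_div r0 hg g0.
have [s [B [s0 sr B0 HB]]] := hol_lipschitz r0 hh.
exists (Num.min s 1), (3 * B); split; [by rewrite lt_min s0 ltr01| |lra|].
  by rewrite gt_min sr.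
move=> z w m hz hw; rewrite lt_min => /andP [ms m1].
have m0 : 0 <= m by apply: le_trans hz; exact: nm_ge0.
have E y : nm y <= m -> f y - l * y = y ^+ 2 * h y.
  by move=> hy; have yr : nm y < r by [lra]; have := gE y yr; rewrite hE // add0r => ->; ring.
have -> : f z - f w - l * (z - w) = (z ^+ 2 - w ^+ 2) * h z + w ^+ 2 * (h z - h w).
  have -> : f z - f w - l * (z - w) = (f z - l * z) - (f w - l * w) by ring.
  by rewrite !E //; ring.
apply: le_trans (nmD _ _) _; rewrite (nmM _ (h z)) (nmM (w ^+ 2)) nmX.
have [h1 h2] := HB z w ltac:(lra) ltac:(lra).
have h3 := exprB_le 2 hz hw; rewrite /= expr1 in h3.
have h4 : nm w ^+ 2 <= m.
  rewrite expr2; apply: (@le_trans _ _ (1 * nm w)); last by rewrite mul1r.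
  by apply: ler_wpM2r; [exact: nm_ge0|lra].
have h5 := ler_pM (nm_ge0 _) (nm_ge0 _) h3 h1.
have h6 := ler_pM (exprn_ge0 2 (nm_ge0 w)) (nm_ge0 _) h4 h2.
lra.
Qed.

Lemma rotnum_irr (a : R) n : ~ (exists q : rat, a = ratr q) -> (0 < n)%N ->
  rotnum a ^+ n != 1.
Proof.
move=> irr n0; apply/negP => /eqP; rewrite rotnumX => /rotnum_eq1 [m hm]; apply: irr.
exists (m%:~R / n%:R); rewrite rmorphM fmorphV /= ratr_int ratr_nat -hm mulfK //.
by rewrite pnatr_eq0 -lt0n.
Qed.

End Topology.

(** * The rigidity dichotomy and the two kinds of invariance *)

Section Main.
Context {R : realType}.
Local Notation C := (R[i]).
Implicit Types (f g T : C -> C) (K : set C) (a : R).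

(** The extended inverse is tied to [f] only near 0; its derivative there comes from the chain rule
    applied to [g (f z) = z]. *)
Lemma siegel_compact_inverse f K a : germ_rot f a -> siegel_compact f K ->
  exists g (r : R), [/\ 0 < r, hol r f & hol r g] /\
   [/\ g 0 = 0, cdiff f 0 (rotnum a), cdiff g 0 (rotnum a)^-1,
       forall z, nm z < r -> g (f z) = z & forall z, K z -> K (g z)].
Proof.
move=> [[U [[oU U0] fU]] [f0 df]] [_ [_ [_ [K0 [_ [_ [[V [g [[oV KV] [gV [gf gK]]]]] _]]]]]]].
have [r1 r10 [fh _]] := univalent_hol oU (U0 0 erefl) fU.
have [r2 r20 [gh _]] := univalent_hol oV (KV 0 K0) gV.
have /(nbhsCT 0) [r3 r30 gf3] := gf.
have n01 : nm (0 : C) < r1 by rewrite nm0.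
have n02 : nm (0 : C) < r2 by rewrite nm0.
have fd : cdiff f 0 (rotnum a).
  by rewrite -df; apply: cdiff_derive; apply: (proj1 fU); exact: U0.
have gfz z : nm z < r3 -> g (f z) = z by move=> h; apply: gf3; rewrite subr0.
have g0 : g 0 = 0 by rewrite -{1}f0 gfz // nm0.
have la0 : rotnum a != 0 :> C by rewrite -nm_gt0 nm_rotnum ltr01.
have gd : cdiff g 0 (rotnum a)^-1.
  have [m hm] := gh 0 n02.
  suff -> : (rotnum a)^-1 = m by [].
  have d1 : cdiff (fun z => g (f z)) 0 (m * rotnum a).
    by apply: cdiff_comp fd _; rewrite f0.
  have d2 : cdiff (fun z => g (f z)) 0 1.
    apply: (cdiff_ext r30) _ (cdiff_affine 0 1 0) => w; rewrite subr0 => /gfz ->.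
    by rewrite add0r mul1r.
  have E := cdiff_unique d1 d2.
  by apply: (mulIf la0); rewrite mulVf.
exists g, (Num.min r1 (Num.min r2 r3)); split.
  split; first by rewrite !lt_min r10 r20.
    by move=> z; rewrite !lt_min => /andP [/fh].
  by move=> z; rewrite !lt_min => /andP [_ /andP [/gh]].
split=> //.
  by move=> z; rewrite !lt_min => /andP [_ /andP [_ /gfz]].
by move=> z Kz; rewrite -gK; exists z.
Qed.

(** The dichotomy is infinite or finite contact of [T] with the identity at 0. Only local data on
    [T] and [S] are assumed, so that the two may exchange roles. *)
Lemma rigidity f T S K a (t : R) : ~ (exists q : rat, a = ratr q) ->
  germ_rot f a -> siegel_compact f K ->
  0 < t -> hol t T -> T 0 = 0 -> cdiff T 0 1 ->
  (forall z, nm z < t -> K z -> K (T z)) ->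
  (forall z, nm z < t -> T (S z) = z) ->
  (forall z, nm z < t -> nm (S z) <= 2 * nm z) ->
  (exists2 s : R, 0 < s & forall z, nm z < s -> T z = z) \/
  (exists2 s : R, 0 < s & forall z, nm z < s -> K z).
Proof.
move=> irr fa sK t0 Th T0 T1 TK TS S2.
have [g [r [[r0 fh gh] [g0 fd gd gf gK]]]] := siegel_compact_inverse fa sK.
have [_ [f0 _]] := fa.
have [cK [coK [_ [K0 [Kn0 [_ [_ fK]]]]]]] := sK.
have [H|[k [b [s [D [k0 b0 s0 D0 form]]]]]] := tangent_to_identity t0 Th T0 T1.
  by left; exists (t / 8) => //; lra.
right.
have [s1 [A1 [s10 s1r A10 H1]]] := second_order r0 fh f0 fd.
have [s2 [A2 [s20 s2r A20 H2]]] := second_order r0 gh g0 gd.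
(* A single constant for the remainders of [T], [f] and [g], at least 1 as [A_ge1] demands. *)
pose A := 1 + D + A1 + A2.
pose q := Num.min (Num.min (Num.min t s) (Num.min s1 s2)) 1.
have [q1 q2] : q <= t /\ q <= s by rewrite /q !ge_min !lexx !orbT.
have [q3 q4 q5] : [/\ q <= s1, q <= s2 & q <= 1] by rewrite /q !ge_min !lexx !orbT.
have q0 : 0 < q by rewrite /q !lt_min t0 s0 s10 s20 ltr01.
have Kne : K !=set0 by exists 0.
apply: (@K_nbhd _ K f g T S (rotnum a) b k q A) => //.
- by move=> p; exact: compact_proximinal.
- exact: connected_circles.
- by rewrite /A; lra.
- exact: nm_rotnum.
- by move=> n n0; exact: rotnum_irr.
- move=> z hz; have := H1 z 0 (nm z) (lexx _) _ ltac:(lra).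
  rewrite nm0 f0 !subr0 => /(_ (nm_ge0 z)) h; apply: le_trans h _.
  rewrite -mulrA -expr2 ler_wpM2r ?exprn_ge0 ?nm_ge0 // /A; lra.
- move=> z w m hz hw hm; have h := H2 z w m hz hw ltac:(lra); apply: le_trans h _.
  have m0 : 0 <= m by apply: le_trans hz; exact: nm_ge0.
  rewrite -!mulrA ler_wpM2r //; first by rewrite mulr_ge0 // nm_ge0.
  by rewrite /A; lra.
- by move=> z hz; apply: gf; lra.
- by move=> z Kz; rewrite -fK; exists z.
- move=> z w m hz hw hm; have h := form z w m hz hw ltac:(lra); apply: le_trans h _.
  have m0 : 0 <= m by apply: le_trans hz; exact: nm_ge0.
  rewrite -!mulrA ler_wpM2r //; first by apply: mulr_ge0; [exact: exprn_ge0|exact: nm_ge0].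
  by rewrite /A; lra.
- by move=> z hz; apply: TK; lra.
- by move=> z hz; apply: TS; lra.
- by move=> z hz; apply: S2; lra.
Qed.

(** A disc inside the bounded, [f]-invariant set [K] keeps all iterates of [f] bounded, so the
    averaging of [linearization] applies. *)
Lemma nonlinearizable_ball f K a (s : R) : germ_rot f a -> siegel_compact f K ->
  ~ linearizable f a -> 0 < s -> ~ (forall z, nm z < s -> K z).
Proof.
move=> fa sK nlin s0 ball.
have [g [r [[r0 fh gh] [g0 fd gd gf gK]]]] := siegel_compact_inverse fa sK.
have [_ [f0 _]] := fa.
have [cK [coK [_ [K0 [Kn0 [[U [[oU KU] [fU _]]] [_ fK]]]]]]] := sK.
have [B hB] := compact_nm_bounded cK (ex_intro _ 0 K0).
apply: nlin.
have [|z Kz|t [h [t0 hh h0 dh [hinj hf]]]] :=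
  @linearization _ f K (rotnum a) s B s0 ball _ hB _ f0 fd (nm_rotnum a).
- by move=> z Kz; rewrite -fK; exists z.
- by exists (cderiv f z); apply: cdiff_derive; apply: fU; exact: KU.
have [_ dE] := cdiff_is_derive dh.
exists h; split; [|split=> //; split; [exact: dE|]].
  exists [set z | nm z < t]; split; [split|split].
  - exact: open_disc.
  - by move=> z ->; rewrite /= nm0.
  - by move=> z /hh [l /cdiff_is_derive []].
  - by move=> x y; exact: hinj.
by apply/(nbhsCT 0); exists t => // w; rewrite subr0 => /hf ->.
Qed.

End Main.

Theorem theorem3p1 (R : realType) (a : R) (f T : R[i] -> R[i]) (K : set R[i]) :
  ~ (exists q : rat, a = ratr q) ->
  germ_rot f a ->
  ~ linearizable f a ->
  hedgehog f a K ->
  (* T(z) = z + O(z^2), univalent on a neighbourhood of K *)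
  (exists W, open_nbhd_of W K /\ univalent_on W T) ->
  T 0 = 0 -> cderiv T 0 = 1 ->
  (T @` K `<=` K \/ K `<=` T @` K) ->
  \forall z \near (0 : @CT R), T z = z.
Proof.
move=> irr fa nlin [sK _] [W [[oW KW] TW]] T0 T1 inv.
have K0 : K 0 by case: sK => _ [_ [_ []]].
have [t t0 [Th tW]] := univalent_hol oW (KW 0 K0) TW.
have Td : cdiff T 0 1 by rewrite -T1; apply: cdiff_derive; apply: (proj1 TW); exact: KW.
have [s [S [s0 st Sh S0 [Sd SP]]]] := local_inverse t0 Th T0 Td.
have [A [A0 [A1 A2 A3 A4]]] := second_order t0 Th T0 Td.
have [s' s'0 hs'] := small_radius A3 ltr01.
(* This is the bound asked of the inverse map once [T] plays the role of the inverse of [S]. *)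
have T2 z : nm z < Num.min A s' -> nm (T z) <= 2 * nm z.
  rewrite lt_min => /andP [z1 z2]; have := A4 z 0 (nm z) (lexx _) _ z1.
  rewrite nm0 T0 !subr0 mul1r => /(_ (nm_ge0 z)) h.
  have h2 := ler_wpM2r (nm_ge0 z) (hs' _ (nm_ge0 z) z2).
  by have := nmB_ge (T z) z; lra.
suff [q q0 H] : exists2 q : R, 0 < q & forall z, nm z < q -> T z = z.
  by apply/(nbhsCT 0); exists q => // z; rewrite subr0; exact: H.
case: inv => inv.
  have [|z hz Kz|z hz|z hz|//|[q q0 H]] := @rigidity R f T S K a s irr fa sK s0 _ T0 Td.
  - by move=> z hz; apply: Th; lra.
  - by apply: inv; exists z.
  - by have [] := SP z hz.
  - by have [] := SP z hz.
  - by case: (nonlinearizable_ball fa sK nlin q0 H).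
(* From here on [K] is contained in its image and [S] replaces [T]. The bound [s / 2] gives
   [|S z| < s < t], so that [S z] lies in [W]. *)
pose u := Num.min (Num.min (s / 2) A) s'.
have u0 : 0 < u by rewrite !lt_min A1 s'0; repeat (apply/andP; split) => //; lra.
have [us uA us'] : [/\ u <= s / 2, u <= A & u <= s'] by rewrite /u !ge_min !lexx !orbT.
have [|z hz Kz|z hz|z hz|[q q0 H]|[q q0 H]] := @rigidity R f S T K a u irr fa sK u0 _ S0 Sd.
- by move=> z hz; apply: Sh; lra.
(* The preimage [y] in [K] could a priori be far from 0; injectivity of [T] on all of [W] identifies
   it with the local preimage [S z]. *)
- have [y Ky yz] := inv z Kz; have [h1 h2 _] := SP z ltac:(lra).
  suff -> : S z = y by [].
  by apply: (proj2 TW); [apply: tW; lra | exact: KW | rewrite h2 yz].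
- by have [] := SP z ltac:(lra).
- by apply: T2; rewrite lt_min; apply/andP; split; lra.
(* If [S] is the identity near 0, then [T z = T (S z) = z]. *)
- exists (Num.min q s); first by rewrite lt_min q0.
  move=> z; rewrite lt_min => /andP [/H E zs].
  by have [_ h2 _] := SP z zs; rewrite -{1}E h2.
- by case: (nonlinearizable_ball fa sK nlin q0 H).
Qed.
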